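(* Let $\mathbf k$ be a field of characteristic zero and $\mathbf k\subset\mathbf K$ a field extension. If $P$ is an operad in complexes of $\mathbf k$-vector spaces with homology of finite type, then the following statements are equivalent: (1) $P$ is formal. (2) $P\otimes_{\mathbf k}\mathbf K$ is a formal operad in complexes of $\mathbf K$-vector spaces. (3) For every $n$, the truncation $t_nP$ is formal.
   Context: Complexes have differential of degree $-1$, with Koszul signs. ''Operad'' means pseudo-operad (non-unital Markl operad): a sequence $P=(P(l))_{l\ge1}$ of complexes with right $\Sigma_l$-actions and chain maps $\circ_i:P(l)\otimes P(m)\to P(l+m-1)$, $1\le i\le l$, satisfying the usual associativity and equivariance axioms; it is assumed throughout that $HP(1)=0$. An $n$-truncated operad is a finite sequence $(P(1),\dots,P(n))$ with right $\Sigma_l$-actions and those operations $\circ_i$, and those axioms, that make sense in arities $\le n$. The truncation of $P$ is $t_nP=(P(1),\dots,P(n))$. $HP$ is the (truncated) operad of componentwise homology with zero differential. A weak equivalence is a morphism of (truncated) operads inducing a homology isomorphism in each arity. A (truncated) operad is formal if it is joined to its homology by a finite zigzag of weak equivalences of (truncated) operads. $P$ has homology of finite type if $HP(l)$ is a finite dimensional $\mathbf k$-vector space for each $l$. *)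

(* Defs.v *)
From HB Require Import structures.
From mathcomp Require Import all_boot all_order all_algebra perm.
From mathcomp Require Import zify.
From mathcomp Require Import boolp.
From mathcomp.multinomials Require Import freeg.
From Stdlib Require Import Relations.

Set Implicit Arguments.
Unset Strict Implicit.
Unset Printing Implicit Defensive.

Import GRing.Theory.
Local Open Scope ring_scope.
Local Open Scope quotient_scope.

Section QuotientModule.
Variables (R : pzRingType) (V : lmodType R).

Record submodule := Submodule {
  sub_mem :> V -> Prop;
  sub_mem0 : sub_mem 0;
  sub_memL : forall a u v, sub_mem u -> sub_mem v -> sub_mem (a *: u + v) }.

Variable W : submodule.

Definition sub_pred : {pred V} := [pred x | `[< W x >]].

Lemma sub_pred_zmod : zmod_closed sub_pred.
Proof.
split; first by apply/asboolP; exact: sub_mem0.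
move=> u v /asboolP Wu /asboolP Wv; apply/asboolP.
by rewrite addrC -scaleN1r; exact: sub_memL.
Qed.
HB.instance Definition _ := GRing.isZmodClosed.Build V sub_pred sub_pred_zmod.

Definition mquot := Quotient.quot (GRing.ZmodClosed.clone V sub_pred _).
HB.instance Definition _ := GRing.Zmodule.on mquot.
HB.instance Definition _ := generic_quotient.Quotient.on mquot.

Definition mproj (x : V) : mquot := \pi x.

Lemma mproj_eq x y : mproj x = mproj y <-> W (x - y).
Proof.
rewrite /mproj; split=> [/eqP|Wxy]; last apply/eqP.
  by rewrite -Quotient.idealrBE => /asboolP.
by rewrite -Quotient.idealrBE; exact/asboolP.
Qed.

Lemma mproj_repr (x : mquot) : mproj (repr x) = x.
Proof. exact: reprK. Qed.

Lemma mprojD x y : mproj (x + y) = mproj x + mproj y.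
Proof. by rewrite /mproj !piE. Qed.

Definition mscale (a : R) (x : mquot) : mquot := mproj (a *: repr x).

Lemma mscaleE a x : mscale a (mproj x) = mproj (a *: x).
Proof.
apply/mproj_eq; rewrite -scalerBr -[_ *: _]addr0.
by apply: sub_memL; [apply/mproj_eq; rewrite mproj_repr | exact: sub_mem0].
Qed.

Lemma mscaleA a b x : mscale a (mscale b x) = mscale (a * b) x.
Proof. by rewrite -(mproj_repr x) !mscaleE scalerA. Qed.
Lemma mscale1 : left_id 1 mscale.
Proof. by move=> x; rewrite -(mproj_repr x) mscaleE scale1r. Qed.
Lemma mscaleDr : right_distributive mscale +%R.
Proof.
by move=> a x y; rewrite -(mproj_repr x) -(mproj_repr y) -mprojD !mscaleE
  scalerDr mprojD.
Qed.
Lemma mscaleDl x : {morph mscale^~ x : a b / a + b}.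
Proof. by move=> a b /=; rewrite -(mproj_repr x) !mscaleE scalerDl mprojD. Qed.

HB.instance Definition _ :=
  GRing.Zmodule_isLmodule.Build R mquot mscaleA mscale1 mscaleDr mscaleDl.

Lemma mproj_linear : linear mproj.
Proof. by move=> a u v; rewrite mprojD -mscaleE. Qed.
HB.instance Definition _ := GRing.isLinear.Build R V mquot *:%R mproj mproj_linear.

Lemma mproj_ind (P : mquot -> Prop) : (forall v, P (mproj v)) -> forall x, P x.
Proof. by move=> Pv x; rewrite -(mproj_repr x). Qed.

End QuotientModule.

Section Complexes.
Variable k : fieldType.

(* Degrees are related by explicit equations ([p = q + 1], [p + q = r]), so   *)
(* that no axiom below needs a transport along an equality of degrees; since  *)
(* [int] and [nat] have unique identity proofs, these arguments carry no data. *)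
Record complex := Complex {
  cx_mod :> int -> lmodType k;
  cx_d : forall p q : int, p = q + 1 -> {linear cx_mod p -> cx_mod q};
  cx_dd : forall (p q r : int) (e1 : p = q + 1) (e2 : q = r + 1) x,
    cx_d e2 (cx_d e1 x) = 0 }.

Record chain_map (C D : complex) := ChainMap {
  cm_fun :> forall p : int, {linear C p -> D p};
  cm_d : forall (p q : int) (e : p = q + 1) x,
    cx_d D e (cm_fun p x) = cm_fun q (cx_d C e x) }.

(* Chain maps A (x) B -> C, as bilinear maps; the differential of A (x) B is  *)
(* d (a (x) b) = da (x) b + (-1)^|a| a (x) db.                                *)
Record bichain_map (A B C : complex) := BichainMap {
  bm_fun : forall p q r : int, p + q = r -> A p -> B q -> C r;
  bm_linl : forall (p q r : int) (e : p + q = r) b,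
    linear (fun a => bm_fun e a b);
  bm_linr : forall (p q r : int) (e : p + q = r) a, linear (bm_fun e a);
  bm_d : forall (p q r p' q' r' : int)
    (e : p + q = r) (el : p' + q = r') (er : p + q' = r')
    (ep : p = p' + 1) (eq : q = q' + 1) (e' : r = r' + 1) a b,
    cx_d C e' (bm_fun e a b) =
      bm_fun el (cx_d A ep a) b
      + (-1) ^+ `|p|%N *: bm_fun er a (cx_d B eq b) }.

End Complexes.

Section Homology.
Variable k : fieldType.

Section Modules.
Variables (C : complex k) (p : int).

Definition is_cycle : C p -> bool := fun x => cx_d C (esym (subrK 1 p)) x == 0.

Lemma cycleP x : reflect (forall (q : int) (e : p = q + 1), cx_d C e x = 0) (is_cycle x).
Proof.
apply: (iffP eqP) => [dx q e|]; last exact.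
have eq : q = p - 1 by rewrite e addrK.
by move: e; rewrite eq => e; rewrite (eq_irrelevance e (esym (subrK 1 p))).
Qed.

Lemma cycle_closed : GRing.subsemimod_closed is_cycle.
Proof.
split; first split; first by rewrite /is_cycle unfold_in /= linear0.
- move=> u v; rewrite !unfold_in /is_cycle => /eqP du /eqP dv.
  by rewrite linearD du dv addr0.
- by move=> a u; rewrite !unfold_in /is_cycle => /eqP du; rewrite linearZ /= du scaler0.
Qed.
HB.instance Definition _ := GRing.isSubmodClosed.Build k (C p) is_cycle cycle_closed.

Record cycles := Cycles { cyc_val : C p; _ : cyc_val \in is_cycle }.
HB.instance Definition _ := [isSub for cyc_val].
HB.instance Definition _ := [Choice of cycles by <:].
HB.instance Definition _ := [SubChoice_isSubLmodule of cycles by <:].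

Lemma cyc_d (z : cycles) (q : int) (e : p = q + 1) : cx_d C e (cyc_val z) = 0.
Proof. by apply/cycleP; case: z. Qed.

Definition boundary (z : cycles) : Prop :=
  exists y : C (p + 1), cx_d C erefl y = cyc_val z.

Lemma boundary0 : boundary 0.
Proof. by exists 0; rewrite linear0. Qed.
Lemma boundaryL a u v : boundary u -> boundary v -> boundary (a *: u + v).
Proof. by move=> [x dx] [y dy]; exists (a *: x + y); rewrite linearP dx dy. Qed.

Definition boundaries := Submodule boundary0 boundaryL.

Definition hmod : lmodType k := mquot boundaries.
Definition hclass : {linear cycles -> hmod} := @mproj k _ boundaries.

Lemma hclass_ind (P : hmod -> Prop) :
  (forall z, P (hclass z)) -> forall h, P h.
Proof. exact: mproj_ind. Qed.

Lemma hclass_eq z z' (q : int) (e : q = p + 1) (y : C q) :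
  cx_d C e y = cyc_val z - cyc_val z' -> hclass z = hclass z'.
Proof. by subst q => dy; apply/mproj_eq; exists y. Qed.

Lemma hclassP z z' : hclass z = hclass z' <->
  exists y : C (p + 1), cx_d C erefl y = cyc_val z - cyc_val z'.
Proof. exact: mproj_eq. Qed.

End Modules.
Arguments is_cycle : clear implicits.

Definition homology (C : complex k) : complex k :=
  @Complex k (hmod C) (fun p q _ => \0) (fun p q r _ _ x => erefl).

Section Functoriality.
Variables (C D : complex k) (F : chain_map C D) (p : int).

Lemma cyc_map_subproof (z : cycles C p) : F p (cyc_val z) \in is_cycle D p.
Proof. by apply/cycleP => q e; rewrite cm_d cyc_d linear0. Qed.
Definition cyc_map z : cycles D p := Cycles (cyc_map_subproof z).

Definition hmap_fun (h : hmod C p) : hmod D p := hclass D p (cyc_map (repr h)).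

Lemma hmap_hclass z : hmap_fun (hclass C p z) = hclass D p (cyc_map z).
Proof.
have /hclassP [y dy] : hclass C p (repr (hclass C p z)) = hclass C p z.
  exact: mproj_repr.
by apply: (@hclass_eq D p _ _ _ erefl (F _ y)); rewrite cm_d dy linearB.
Qed.

Lemma hmap_linear : linear hmap_fun.
Proof.
move=> a; elim/hclass_ind => z; elim/hclass_ind => w.
rewrite -linearP !hmap_hclass -linearP; congr (hclass D p _).
by apply: val_inj; rewrite /= linearP.
Qed.
HB.instance Definition _ :=
  GRing.isLinear.Build k (hmod C p) (hmod D p) *:%R hmap_fun hmap_linear.

Definition hmap : {linear hmod C p -> hmod D p} := hmap_fun.

End Functoriality.

Definition homology_map (C D : complex k) (F : chain_map C D) :
    chain_map (homology C) (homology D).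
Proof.
by exists (hmap F) => p q e x; rewrite /= linear0.
Defined.

Lemma homology_mapE (C D : complex k) (F : chain_map C D) (p : int) z :
  homology_map F p (hclass C p z) = hclass D p (cyc_map F z).
Proof. exact: hmap_hclass. Qed.

Section Products.
Variables (A B C : complex k) (M : bichain_map A B C).

Section Linearity.
Variables (p q r : int) (e : p + q = r).

Lemma bm0l b : bm_fun M e 0 b = 0.
Proof. by have := bm_linl M e b (-1) 0 0; rewrite /= scaler0 addr0 scaleN1r addNr. Qed.
Lemma bm0r a : bm_fun M e a 0 = 0.
Proof. by have := bm_linr M e a (-1) 0 0; rewrite /= scaler0 addr0 scaleN1r addNr. Qed.
Lemma bmBl a a' b : bm_fun M e (a - a') b = bm_fun M e a b - bm_fun M e a' b.
Proof.
by rewrite addrC -scaleN1r (bm_linl M e b (-1) a' a) scaleN1r addrC.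
Qed.
Lemma bmDl a a' b : bm_fun M e (a + a') b = bm_fun M e a b + bm_fun M e a' b.
Proof. by have := bm_linl M e b 1 a a'; rewrite /= !scale1r. Qed.
Lemma bmDr a b b' : bm_fun M e a (b + b') = bm_fun M e a b + bm_fun M e a b'.
Proof. by have := bm_linr M e a 1 b b'; rewrite /= !scale1r. Qed.
Lemma bmBr a b b' : bm_fun M e a (b - b') = bm_fun M e a b - bm_fun M e a b'.
Proof.
by rewrite addrC -scaleN1r (bm_linr M e a (-1) b' b) scaleN1r addrC.
Qed.

End Linearity.

Section Degrees.
Variables (p q r : int) (e : p + q = r).

Lemma cyc_mul_subproof (z : cycles A p) (w : cycles B q) :
  bm_fun M e (cyc_val z) (cyc_val w) \in is_cycle C r.
Proof.
apply/cycleP => s es.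
have el : p - 1 + q = s by lia.
have er : p + (q - 1) = s by lia.
rewrite (bm_d M _ el er (esym (subrK 1 p)) (esym (subrK 1 q))) !cyc_d.
by rewrite bm0l bm0r scaler0 addr0.
Qed.
Definition cyc_mul z w : cycles C r := Cycles (cyc_mul_subproof z w).

Definition hmul (g : hmod A p) (h : hmod B q) : hmod C r :=
  hclass C r (cyc_mul (repr g) (repr h)).

Lemma hmul_hclass z w :
  hmul (hclass A p z) (hclass B q w) = hclass C r (cyc_mul z w).
Proof.
have /hclassP [x dx] : hclass A p (repr (hclass A p z)) = hclass A p z.
  exact: mproj_repr.
have /hclassP [y dy] : hclass B q (repr (hclass B q w)) = hclass B q w.
  exact: mproj_repr.
rewrite /hmul; set z' := repr _ in dx *; set w' := repr _ in dy *.
have e1 : p + 1 + q = r + 1 by lia.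
have e2 : p + (q + 1) = r + 1 by lia.
transitivity (hclass C r (cyc_mul z w')).
  apply: (@hclass_eq C r _ _ _ erefl (bm_fun M e1 x (cyc_val w'))).
  have er : p + 1 + (q - 1) = r by lia.
  rewrite (bm_d M _ e er erefl (esym (subrK 1 q))) cyc_d bm0r scaler0 addr0.
  by rewrite dx bmBl.
apply: (@hclass_eq C r _ _ _ erefl
          ((-1) ^+ `|p|%N *: bm_fun M e2 (cyc_val z) y)).
have el : p - 1 + (q + 1) = r by lia.
rewrite linearZ /= (bm_d M _ el e (esym (subrK 1 p)) erefl) cyc_d bm0l add0r.
by rewrite scalerA -exprMn mulN1r opprK expr1n scale1r dy bmBr.
Qed.

Lemma hmul_linl h : linear (fun g => hmul g h).
Proof.
elim/hclass_ind: h => w a; elim/hclass_ind => z; elim/hclass_ind => z'.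
rewrite -linearP !hmul_hclass -linearP; congr (hclass C r _).
by apply: val_inj; rewrite /= bm_linl.
Qed.

Lemma hmul_linr g : linear (hmul g).
Proof.
elim/hclass_ind: g => z a; elim/hclass_ind => w; elim/hclass_ind => w'.
rewrite -linearP !hmul_hclass -linearP; congr (hclass C r _).
by apply: val_inj; rewrite /= bm_linr.
Qed.

End Degrees.

Definition homology_mul :
  bichain_map (homology A) (homology B) (homology C).
Proof.
exists hmul; first exact: hmul_linl; first exact: hmul_linr.
move=> p q r p' q' r' e el er ep eq e' a b.
rewrite /=.
have -> : hmul el 0 b = 0.
  by have := hmul_linl el b (-1) 0 0; rewrite /= scaler0 addr0 scaleN1r addNr.
have -> : hmul er a 0 = 0.
  by have := hmul_linr er a (-1) 0 0; rewrite /= scaler0 addr0 scaleN1r addNr.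
by rewrite scaler0 addr0.
Defined.

Lemma homology_mulE (p q r : int) (e : p + q = r) z w :
  bm_fun homology_mul e (hclass A p z) (hclass B q w) =
  hclass C r (cyc_mul e z w).
Proof. exact: hmul_hclass. Qed.

End Products.
End Homology.

Section ExtensionOfScalars.
Variables (k K : fieldType) (iota : {rmorphism k -> K}).

Section Tensor.
Variable V : lmodType k.

Inductive tens_rel : {freeg V / K} -> Prop :=
| tens_rel0 : tens_rel 0
| tens_relL a x y : tens_rel x -> tens_rel y -> tens_rel (a *: x + y)
| tens_rel_add v w : tens_rel (<< v + w >> - (<< v >> + << w >>))
| tens_rel_scale c v : tens_rel (<< c *: v >> - iota c *: << v >>).

Definition tens_submod := Submodule tens_rel0 tens_relL.

(* V (x)_k K, presented as the K-vector space on the symbols << v >>, standing *)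
(* for v (x) 1, modulo additivity and << c v >> = iota(c) << v >>.             *)
Definition tens : lmodType K := mquot tens_submod.

Definition tpure (v : V) (b : K) : tens := @mproj _ _ tens_submod << b *g v >>.

Lemma fgZ (b : K) (v : V) : << b *g v >> = b *: << v >> :> {freeg V / K}.
Proof. by apply/eqP/freeg_eqP => w; rewrite coeffZ !coeffU mul1r. Qed.

Lemma tpureE v b : tpure v b = b *: tpure v 1.
Proof. by rewrite /tpure fgZ linearZ. Qed.

Lemma tpureZ v a b : a *: tpure v b = tpure v (a * b).
Proof. by rewrite tpureE scalerA -tpureE. Qed.

Lemma tpure_linl b (c : k) v w :
  tpure (c *: v + w) b = iota c *: tpure v b + tpure w b.
Proof.
rewrite (tpureE _ b) (tpureE v) (tpureE w) scalerA mulrC -scalerA -scalerDr.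
congr (_ *: _); transitivity (tpure (c *: v) 1 + tpure w 1).
  by rewrite -linearD; apply/mproj_eq; exact: tens_rel_add.
by congr (_ + _); rewrite -linearZ; apply/mproj_eq; exact: tens_rel_scale.
Qed.

Lemma tpure0 b : tpure 0 b = 0.
Proof.
have := tpure_linl b (-1) 0 0.
by rewrite scaler0 addr0 rmorphN1 scaleN1r addNr.
Qed.

Lemma tens_ind (P : tens -> Prop) :
  P 0 -> (forall b v x, P x -> P (tpure v b + x)) -> forall x, P x.
Proof.
move=> P0 PD; elim/mproj_ind => D; rewrite -(freeg_sumE D).
elim: (dom D) => [|v s IHs]; first by rewrite big_nil linear0.
by rewrite big_cons linearD; exact: PD.
Qed.

Section Lift.
Variables (M : lmodType K) (f : V -> M).
Hypothesis fL : forall c v w, f (c *: v + w) = iota c *: f v + f w.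

Definition tens_lift_fun (x : tens) : M := fglift f (repr x).

Lemma fgliftD D D' : fglift f (D + D') = fglift f D + fglift f D'.
Proof.
have fB := lift_is_additive f.
have f0 : fglift f 0 = 0 by rewrite -(subrr 0) fB subrr.
have fN x : fglift f (- x) = - fglift f x by rewrite -[- x]sub0r fB f0 sub0r.
by rewrite -{1}[D']opprK fB fN opprK.
Qed.

Lemma fgliftZ a D : fglift f (a *: D) = a *: fglift f D.
Proof.
have fB := lift_is_additive f.
have f0 : fglift f 0 = 0 by rewrite -(subrr 0) fB subrr.
elim/freeg_ind_dom0: D => [|b v D _ _ IH]; first by rewrite scaler0 f0 scaler0.
rewrite scalerDr !fgliftD IH scalerDr; congr (_ + _).
have -> : a *: << b *g v >> = << a * b *g v >> by rewrite fgZ scalerA -fgZ.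
by rewrite !liftU scalerA.
Qed.

Lemma fglift_rel D : tens_rel D -> fglift f D = 0.
Proof.
have fB := lift_is_additive f.
have f0 : f 0 = 0.
  by have := fL (-1) 0 0; rewrite scaler0 addr0 rmorphN1 scaleN1r addNr.
elim=> [|a x y _ IHx _ IHy|v w|c v].
- by rewrite -(subrr 0) fB subrr.
- by rewrite fgliftD fgliftZ IHx IHy scaler0 addr0.
- rewrite fB fgliftD !liftU !scale1r -[v in v + w]scale1r fL rmorph1 scale1r.
  by rewrite subrr.
- rewrite fB fgliftZ !liftU !scale1r -[c *: v]addr0 fL f0 addr0.
  by rewrite subrr.
Qed.

Lemma tens_lift_mproj D : tens_lift_fun (@mproj _ _ tens_submod D) = fglift f D.
Proof.
apply/eqP; rewrite -subr_eq0; apply/eqP.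
rewrite -(lift_is_additive f); apply: fglift_rel.
exact/(@mproj_eq _ _ tens_submod)/mproj_repr.
Qed.

Lemma tens_lift_linear : linear tens_lift_fun.
Proof.
move=> a; elim/mproj_ind => x; elim/mproj_ind => y.
by rewrite -linearP !tens_lift_mproj fgliftD fgliftZ.
Qed.
HB.instance Definition _ :=
  GRing.isLinear.Build K tens M *:%R tens_lift_fun tens_lift_linear.

Definition tens_lift : {linear tens -> M} := tens_lift_fun.

Lemma tens_liftE v b : tens_lift (tpure v b) = b *: f v.
Proof. by rewrite /tens_lift /= tens_lift_mproj liftU. Qed.

End Lift.
End Tensor.

Lemma tens_eq (V : lmodType k) (M : lmodType K) (f g : {linear tens V -> M}) :
  (forall v, f (tpure v 1) = g (tpure v 1)) -> f =1 g.
Proof.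
move=> fg; elim/tens_ind => [|b v x IH]; first by rewrite !linear0.
by rewrite !linearD IH tpureE !linearZ /= fg.
Qed.

Section TensorMap.
Variables (V W : lmodType k) (f : {linear V -> W}).

Lemma tens_map_subproof c v w :
  tpure (f (c *: v + w)) 1 = iota c *: tpure (f v) 1 + tpure (f w) 1.
Proof. by rewrite linearP tpure_linl. Qed.

Definition tens_map : {linear tens V -> tens W} := tens_lift tens_map_subproof.

Lemma tens_mapE v b : tens_map (tpure v b) = tpure (f v) b.
Proof. by rewrite tens_liftE -tpureE. Qed.

End TensorMap.

Section TensorMul.
Variables (U V W : lmodType k) (m : U -> V -> W).
Hypothesis mL : forall v, linear (m^~ v).
Hypothesis mR : forall u, linear (m u).

Lemma tens_mul_subproof1 u c v w :
  tpure (m u (c *: v + w)) 1 = iota c *: tpure (m u v) 1 + tpure (m u w) 1.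
Proof. by rewrite mR tpure_linl. Qed.

Lemma tens_mul_subproof2 y c u w :
  tens_lift (tens_mul_subproof1 (c *: u + w)) y =
  iota c *: tens_lift (tens_mul_subproof1 u) y
  + tens_lift (tens_mul_subproof1 w) y.
Proof.
elim/tens_ind: y => [|b v y IH]; first by rewrite !linear0 addr0.
rewrite !linearD IH !tens_liftE (mL v c u w) tpure_linl !scalerDr !scalerA.
by rewrite mulrC -scalerA addrACA.
Qed.

(* (u (x) a) * (v (x) b) = m u v (x) ab                                        *)
Definition tens_mul (x : tens U) (y : tens V) : tens W :=
  tens_lift (tens_mul_subproof2 y) x.

Lemma tens_mulE u v a b : tens_mul (tpure u a) (tpure v b) = tpure (m u v) (a * b).
Proof. by rewrite /tens_mul !tens_liftE tpureZ mulr1 tpureZ. Qed.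

Lemma tens_mul_linl y : linear (tens_mul^~ y).
Proof. by move=> a x x'; rewrite /tens_mul linearP. Qed.

Lemma tens_mul_linr x : linear (tens_mul x).
Proof.
move=> a y y'; rewrite /tens_mul; elim/tens_ind: x => [|b u x IH].
  by rewrite !linear0 addr0.
by rewrite !linearD IH !tens_liftE linearP !scalerDr !scalerA mulrC -scalerA addrACA.
Qed.

End TensorMul.

Definition cx_tens (C : complex k) : complex K.
Proof.
exists (fun p => tens (C p)) (fun p q e => tens_map (cx_d C e)).
move=> p q r e1 e2; elim/tens_ind => [|b v x IH]; first by rewrite !linear0.
by rewrite !linearD IH !tens_mapE cx_dd tpure0 addr0.
Defined.

Definition cm_tens (C D : complex k) (F : chain_map C D) :
  chain_map (cx_tens C) (cx_tens D).
Proof.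
exists (fun p => tens_map (F p)) => p q e x.
change (tens_map (cx_d D e) (tens_map (F p) x)
        = tens_map (F q) (tens_map (cx_d C e) x)).
elim/tens_ind: x => [|b v x IH]; first by rewrite !linear0.
by rewrite !linearD IH !tens_mapE cm_d.
Defined.

Lemma cm_tensE (C D : complex k) (F : chain_map C D) (p : int) v b :
  cm_tens F p (tpure v b) = tpure (F p v) b.
Proof. exact: tens_mapE. Qed.

Definition bm_tens (A B C : complex k) (M : bichain_map A B C) :
  bichain_map (cx_tens A) (cx_tens B) (cx_tens C).
Proof.
exists (fun p q r (e : p + q = r) => tens_mul (bm_linl M e) (bm_linr M e)).
- by move=> p q r e b; exact: tens_mul_linl.
- by move=> p q r e a; exact: tens_mul_linr.
move=> p q r p' q' r' e el er ep eq e' x y.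
change (tens_map (cx_d C e') (tens_mul (bm_linl M e) (bm_linr M e) x y) =
  tens_mul (bm_linl M el) (bm_linr M el) (tens_map (cx_d A ep) x) y
  + (-1) ^+ `|p|%N *: tens_mul (bm_linl M er) (bm_linr M er) x
      (tens_map (cx_d B eq) y)).
have mul0l u v w (m : A u -> B v -> C w) mL mR z : @tens_mul _ _ _ m mL mR 0 z = 0.
  by rewrite /tens_mul linear0.
have mulDl u v w (m : A u -> B v -> C w) mL mR x1 x2 z :
    @tens_mul _ _ _ m mL mR (x1 + x2) z =
    tens_mul mL mR x1 z + tens_mul mL mR x2 z.
  by rewrite /tens_mul linearD.
have mul0r u v w (m : A u -> B v -> C w) mL mR z : @tens_mul _ _ _ m mL mR z 0 = 0.
  have := tens_mul_linr mL mR z (-1) 0 0.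
  by rewrite /= scaler0 addr0 scaleN1r addNr.
have mulDr u v w (m : A u -> B v -> C w) mL mR x1 x2 z :
    @tens_mul _ _ _ m mL mR z (x1 + x2) =
    tens_mul mL mR z x1 + tens_mul mL mR z x2.
  have := tens_mul_linr mL mR z 1 x1 x2.
  by rewrite /= !scale1r.
elim/tens_ind: x => [|a u x IHx].
  by rewrite linear0 !mul0l linear0 scaler0 addr0.
rewrite linearD !mulDl linearD IHx scalerDr addrACA; congr (_ + _) => {x IHx}.
elim/tens_ind: y => [|b v y IHy].
  by rewrite linear0 !mul0r linear0 scaler0 addr0.
rewrite linearD !mulDr linearD IHy scalerDr addrACA; congr (_ + _) => {y IHy}.
rewrite !tens_mapE !tens_mulE tens_mapE (bm_d M e el er ep eq e').
by rewrite [X in tpure X _]addrC tpure_linl rmorphXn rmorphN1 addrC.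
Defined.

Lemma bm_tensE (A B C : complex k) (M : bichain_map A B C) (p q r : int)
    (e : p + q = r) u v a b :
  bm_fun (bm_tens M) e (tpure u a) (tpure v b) = tpure (bm_fun M e u v) (a * b).
Proof. exact: tens_mulE. Qed.

End ExtensionOfScalars.

Section BlockPermutation.
Local Open Scope nat_scope.
Variables (l m n : nat) (e : (l + m = n.+1)).
Variables (t : 'S_l) (i : 'I_l) (s : 'S_m).

(* In one-line notation: slot i of t is replaced by a block of m consecutive  *)
(* slots, permuted inside by s.                                               *)
Definition block_shift (j : 'I_l) : nat := if j < t i then val j else (j + m).-1.

Definition block_nat (x : nat) : nat :=
  if (x < i) then oapp (fun j => block_shift (t j)) 0 (insub x)
  else if (x < i + m) then oapp (fun j => (t i + s j)) 0 (insub (x - i))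
  else oapp (fun j => block_shift (t j)) 0 (insub (x.+1 - m)).

Lemma block_natL (j : 'I_l) : (j < i) -> block_nat j = block_shift (t j).
Proof. by move=> ji; rewrite /block_nat ji valK. Qed.

Lemma block_natM (j : 'I_m) : block_nat (i + j) = (t i + s j).
Proof.
by rewrite /block_nat ltnNge leq_addr /= ltn_add2l ltn_ord addKn valK.
Qed.

Lemma block_natR (j : 'I_l) : (i < j) -> block_nat (j + m).-1 = block_shift (t j).
Proof.
move=> ij; rewrite /block_nat.
have -> : ((j + m).-1 < i) = false by lia.
have -> : ((j + m).-1 < i + m) = false by lia.
have -> : ((j + m).-1.+1 - m) = j by lia.
by rewrite valK.
Qed.

Variant block_spec : nat -> Type :=
| BlockL (j : 'I_l) of (j < i) : block_spec j
| BlockM (j : 'I_m) : block_spec (i + j)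
| BlockR (j : 'I_l) of (i < j) : block_spec (j + m).-1.

Lemma blockP (x : 'I_n) : block_spec x.
Proof.
have xn := ltn_ord x; have il := ltn_ord i.
have [xi|ix] := ltnP x i; first exact: (@BlockL (Ordinal (ltn_trans xi il))).
have [xm|mx] := ltnP x (i + m).
  have xim : (x - i < m) by lia.
  by rewrite -(subnKC ix); exact: (BlockM (Ordinal xim)).
have xl : (x.+1 - m < l) by lia.
have -> : x = (x.+1 - m + m).-1 :> nat by lia.
by apply: (@BlockR (Ordinal xl)) => /=; lia.
Qed.

Lemma block_bound (x : 'I_n) : (block_nat x < n).
Proof.
have til := ltn_ord (t i).
case: (blockP x) => [j ji|j|j ij].
- rewrite (block_natL ji) /block_shift; have := ltn_ord (t j).
  have : t j != t i by rewrite (inj_eq perm_inj) -val_eqE /=; lia.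
  by rewrite -val_eqE /=; case: ifP; lia.
- by rewrite block_natM; have := ltn_ord (s j); lia.
- rewrite (block_natR ij) /block_shift; have := ltn_ord (t j).
  have : t j != t i by rewrite (inj_eq perm_inj) -val_eqE /=; lia.
  by rewrite -val_eqE /=; case: ifP; lia.
Qed.

Definition block_fun (x : 'I_n) : 'I_n := Ordinal (block_bound x).

Lemma block_shift_inj (j j' : 'I_l) : j != i -> j' != i ->
  block_shift (t j) = block_shift (t j') -> j = j'.
Proof.
move=> ji j'i; rewrite /block_shift /= => E; apply: (@perm_inj _ t).
have : t j != t i by rewrite (inj_eq perm_inj).
have : t j' != t i by rewrite (inj_eq perm_inj).
rewrite -!val_eqE /= => h h'; apply: val_inj => /=.
by move: E; case: ifP; case: ifP; lia.
Qed.

Lemma block_shift_out (j : 'I_l) (j' : 'I_m) : j != i ->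
  block_shift (t j) <> (t i + s j').
Proof.
move=> ji; rewrite /block_shift /=; have := ltn_ord (s j').
have : t j != t i by rewrite (inj_eq perm_inj).
by rewrite -val_eqE /=; case: ifP; lia.
Qed.

Lemma block_inj : injective block_fun.
Proof.
move=> x y /(congr1 val) /= E; apply: val_inj => /=; move: E.
have neqL (j : 'I_l) : (j < i) -> j != i by rewrite -val_eqE /=; lia.
have neqR (j : 'I_l) : (i < j) -> j != i by rewrite -val_eqE /=; lia.
case: (blockP x) => [a ha|a|a ha]; case: (blockP y) => [b hb|b|b hb];
  rewrite ?(block_natL ha) ?(block_natL hb) ?(block_natR ha) ?(block_natR hb)
    ?block_natM.
all: try (move/block_shift_inj=> E;
  have /(congr1 val) /= : a = b :> 'I_l by apply: E; auto).
all: try by lia.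
all: try by move/block_shift_out; case; auto.
all: try by move/esym/block_shift_out; case; auto.
by move/eqP; rewrite eqn_add2l => /eqP /val_inj /perm_inj ->.
Qed.

(* t o_i s, the permutation of n = l + m - 1 slots obtained by inserting s at *)
(* the slot i of t.                                                           *)
Definition block_perm : 'S_n := perm block_inj.

End BlockPermutation.

Section Operads.
Variables (k : fieldType) (I : Type) (ar : I -> nat).

(* Operads are indexed by a type I of "arity labels", a label l standing for  *)
(* the arity [ar l]; only the operations and axioms whose arities are all     *)
(* labelled are required. Labels 0, 1, 2, ... for the arities 1, 2, 3, ...    *)
(* give pseudo-operads and 'I_n for the arities 1, ..., n gives n-truncated   *)
(* ones. Inputs are numbered from 0.                                          *)
(*   [op_act s] is the right action x |-> x s for the usual product           *)
(* s t = s \o t of permutations; as [s * t] is t \o s for [perm],             *)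
(* [op_actM] reads x (t \o s) = (x t) s.                                      *)
Record operad_on := OperadOn {
  op_cx :> I -> complex k;
  op_act : forall l : I, 'S_(ar l) -> chain_map (op_cx l) (op_cx l);
  op_comp : forall l m n : I, (ar l + ar m = (ar n).+1)%N -> 'I_(ar l) ->
    bichain_map (op_cx l) (op_cx m) (op_cx n);

  op_act1 : forall (l : I) (p : int) (x : op_cx l p),
    op_act (1%g : 'S_(ar l)) p x = x;
  op_actM : forall (l : I) (s t : 'S_(ar l)) (p : int) (x : op_cx l p),
    op_act (s * t)%g p x = op_act s p (op_act t p x);

  (* (a t) o_i (b s) = (a o_(t i) b) (t o_i s)                                *)
  op_equiv : forall (l m n : I) (e : (ar l + ar m = (ar n).+1)%N)
    (t : 'S_(ar l)) (i : 'I_(ar l)) (s : 'S_(ar m))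
    (p q r : int) (d : p + q = r) (a : op_cx l p) (b : op_cx m q),
    bm_fun (op_comp e i) d (op_act t p a) (op_act s q b) =
    op_act (block_perm e t i s) r (bm_fun (op_comp e (t i)) d a b);

  (* (a o_j b) o_(j + i) c = a o_j (b o_i c)                                  *)
  op_assoc : forall (l m n lm mn lmn : I)
    (e1 : (ar l + ar m = (ar lm).+1)%N) (e2 : (ar lm + ar n = (ar lmn).+1)%N)
    (e3 : (ar m + ar n = (ar mn).+1)%N) (e4 : (ar l + ar mn = (ar lmn).+1)%N)
    (j : 'I_(ar l)) (i : 'I_(ar m)) (ji : 'I_(ar lm)),
    ji = (j + i)%N :> nat ->
    forall (p q r pq qr pqr : int) (d1 : p + q = pq) (d2 : pq + r = pqr)
      (d3 : q + r = qr) (d4 : p + qr = pqr)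
      (a : op_cx l p) (b : op_cx m q) (c : op_cx n r),
    bm_fun (op_comp e2 ji) d2 (bm_fun (op_comp e1 j) d1 a b) c =
    bm_fun (op_comp e4 j) d4 a (bm_fun (op_comp e3 i) d3 b c);

  (* (a o_j b) o_i c = (-1)^(|b||c|) (a o_i c) o_(j + n - 1) b  for i < j,    *)
  (* n being the arity of c                                                   *)
  op_comm : forall (l m n lm ln lmn : I)
    (e1 : (ar l + ar m = (ar lm).+1)%N) (e2 : (ar lm + ar n = (ar lmn).+1)%N)
    (e3 : (ar l + ar n = (ar ln).+1)%N) (e4 : (ar ln + ar m = (ar lmn).+1)%N)
    (i j : 'I_(ar l)) (i' : 'I_(ar lm)) (j' : 'I_(ar ln)),
    (i < j)%N -> i' = i :> nat -> j'.+1 = (j + ar n)%N ->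
    forall (p q r pq pr pqr : int) (d1 : p + q = pq) (d2 : pq + r = pqr)
      (d3 : p + r = pr) (d4 : pr + q = pqr)
      (a : op_cx l p) (b : op_cx m q) (c : op_cx n r),
    bm_fun (op_comp e2 i') d2 (bm_fun (op_comp e1 j) d1 a b) c =
    (-1) ^+ (`|q| * `|r|)%N *:
      bm_fun (op_comp e4 j') d4 (bm_fun (op_comp e3 i) d3 a c) b }.

Record operad_mor (P Q : operad_on) := OperadMor {
  om_fun :> forall l : I, chain_map (P l) (Q l);
  om_act : forall (l : I) (s : 'S_(ar l)) (p : int) (x : P l p),
    om_fun l p (op_act P s p x) = op_act Q s p (om_fun l p x);
  om_comp : forall (l m n : I) (e : (ar l + ar m = (ar n).+1)%N) (i : 'I_(ar l))
    (p q r : int) (d : p + q = r) (a : P l p) (b : P m q),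
    om_fun n r (bm_fun (op_comp P e i) d a b) =
    bm_fun (op_comp Q e i) d (om_fun l p a) (om_fun m q b) }.

Definition weak_equivalence (P Q : operad_on) (f : operad_mor P Q) : Prop :=
  forall (l : I) (p : int), bijective (hmap (f l) p).

Definition homology_operad (P : operad_on) : operad_on.
Proof.
exists (fun l => homology (P l)) (fun l s => homology_map (op_act P s))
  (fun l m n e i => homology_mul (op_comp P e i)).
- move=> l p; elim/hclass_ind => z; rewrite homology_mapE.
  by congr (hclass _ _ _); apply: val_inj; rewrite /= op_act1.
- move=> l s t p; elim/hclass_ind => z; rewrite !homology_mapE.
  by congr (hclass _ _ _); apply: val_inj; rewrite /= op_actM.
- move=> l m n e t i s p q r d; elim/hclass_ind => a; elim/hclass_ind => b.
  rewrite homology_mulE !homology_mapE homology_mulE.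
  by congr (hclass _ _ _); apply: val_inj; rewrite /= op_equiv.
- move=> l m n lm mn lmn e1 e2 e3 e4 j i ji jiE p q r pq qr pqr d1 d2 d3 d4.
  elim/hclass_ind => a; elim/hclass_ind => b; elim/hclass_ind => c.
  rewrite !homology_mulE; congr (hclass _ _ _); apply: val_inj => /=.
  exact: op_assoc.
- move=> l m n lm ln lmn e1 e2 e3 e4 i j i' j' ij iE jE.
  move=> p q r pq pr pqr d1 d2 d3 d4.
  elim/hclass_ind => a; elim/hclass_ind => b; elim/hclass_ind => c.
  rewrite !homology_mulE -linearZ; congr (hclass _ _ _); apply: val_inj => /=.
  exact: op_comm.
Defined.

Definition zigzag : operad_on -> operad_on -> Prop :=
  clos_refl_sym_trans operad_on
    (fun P Q => exists f : operad_mor P Q, weak_equivalence f).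

Definition formal (P : operad_on) : Prop := zigzag P (homology_operad P).

End Operads.

Definition operad_tens (k K : fieldType) (iota : {rmorphism k -> K})
  (I : Type) (ar : I -> nat) (P : operad_on k ar) : operad_on K ar.
Proof.
exists (fun l => cx_tens iota (P l)) (fun l s => cm_tens iota (op_act P s))
  (fun l m n e i => bm_tens iota (op_comp P e i)).
- move=> l p x; rewrite -[RHS]/(idfun x); apply: tens_eq x => v.
  by rewrite cm_tensE op_act1.
- move=> l s t p; elim/tens_ind => [|b v x IH]; first by rewrite !linear0.
  by rewrite !linearD IH !cm_tensE op_actM.
- move=> l m n e t i s p q r d x y.
  elim/tens_ind: x => [|a u x IHx]; first by rewrite !(linear0, bm0l).
  rewrite !(linearD, bmDl) IHx {IHx}; congr (_ + _).
  elim/tens_ind: y => [|b v y IHy]; first by rewrite !(linear0, bm0r).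
  rewrite !(linearD, bmDr) IHy {IHy}; congr (_ + _).
  by rewrite !cm_tensE !bm_tensE cm_tensE op_equiv.
- move=> l m n lm mn lmn e1 e2 e3 e4 j i ji jiE p q r pq qr pqr d1 d2 d3 d4.
  move=> x y z.
  elim/tens_ind: x => [|a u x IHx]; first by rewrite !bm0l.
  rewrite !bmDl IHx {IHx}; congr (_ + _).
  elim/tens_ind: y => [|b v y IHy]; first by rewrite !(bm0l, bm0r).
  rewrite !(bmDl, bmDr) IHy {IHy}; congr (_ + _).
  elim/tens_ind: z => [|c w z IHz]; first by rewrite !(bm0l, bm0r).
  rewrite !(bmDl, bmDr) IHz {IHz}; congr (_ + _).
  rewrite !bm_tensE mulrA; congr (tpure _ _ _); exact: op_assoc.
- move=> l m n lm ln lmn e1 e2 e3 e4 i j i' j' ij iE jE.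
  move=> p q r pq pr pqr d1 d2 d3 d4 x y z.
  elim/tens_ind: x => [|a u x IHx]; first by rewrite !bm0l scaler0.
  rewrite !bmDl IHx scalerDr {IHx}; congr (_ + _).
  elim/tens_ind: y => [|b v y IHy]; first by rewrite !(bm0l, bm0r) scaler0.
  rewrite !(bmDl, bmDr) IHy scalerDr {IHy}; congr (_ + _).
  elim/tens_ind: z => [|c w z IHz]; first by rewrite !(bm0l, bm0r) scaler0.
  rewrite !(bmDl, bmDr) IHz scalerDr {IHz}; congr (_ + _).
  rewrite !bm_tensE (op_comm e1 e2 e3 e4 ij iE jE d1 d2 d3 d4).
  rewrite -[X in tpure _ X]addr0 tpure_linl tpure0 addr0 rmorphXn rmorphN1.
  by rewrite mulrAC.
Defined.

Definition operad (k : fieldType) := operad_on k succn.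

Definition truncated_operad (k : fieldType) (n : nat) :=
  operad_on k (fun i : 'I_n => i.+1).

Definition truncation (k : fieldType) (n : nat) (P : operad k) :
  truncated_operad k n.
Proof.
exists (fun l : 'I_n => P l) (fun l s => @op_act _ _ _ P l s)
  (fun l m r e i => @op_comp _ _ _ P l m r e i).
- by move=> *; exact: op_act1.
- by move=> *; exact: op_actM.
- by move=> *; exact: op_equiv.
- by move=> *; exact: op_assoc.
- by move=> *; exact: op_comm.
Defined.

Definition finite_dim (k : fieldType) (V : lmodType k) : Prop :=
  exists (n : nat) (b : 'I_n -> V), forall x : V,
    exists c : 'I_n -> k, x = \sum_(j < n) c j *: b j.

(* The total space of HP(l) is the direct sum of its graded pieces, hence is  *)
(* finite dimensional iff each piece is and only finitely many are nonzero.   *)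
Definition homology_finite_type (k : fieldType) (P : operad k) : Prop :=
  forall l : nat,
    (exists s : seq int, forall p : int, p \notin s ->
       forall x : hmod (P l) p, x = 0)
    /\ (forall p : int, finite_dim (hmod (P l) p)).

(* HP(1) = 0; the label 0 stands for the arity 1. *)
Definition homology_arity1_trivial (k : fieldType) (P : operad k) : Prop :=
  forall (p : int) (x : hmod (P 0%N) p), x = 0.

(* Main.v *)
(* Replace [P] by a cofibrant model [M -> P] with [M(1) = 0] and finite       *)
(* dimensional components; cofibrancy of a truncation survives extension of   *)
(* scalars. A formality zigzag of [t_N (P (x) K)] then gives a weak           *)
(* equivalence from [t_N (M (x) K)] to its homology, through which the        *)
(* derivation "multiplication by the degree" of the homology lifts. So        *)
(* formality amounts to the existence of a degree 0 derivation of [t_N M_K]   *)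
(* inducing multiplication by [p] on the homology in degree [p]. This         *)
(* condition is a system of affine equations with coefficients in [k]: a      *)
(* [k]-linear retraction [K -> k] descends its solutions to [k], and by       *)
(* linear compactness solutions for all [N] give one for [M] itself.          *)
(* Conversely, given such a derivation of [M], its generalized eigenspaces    *)
(* split [M] by weights, and the cycles of degree and weight [p] together     *)
(* with everything of smaller weight in degree [p] form a suboperad [A] with  *)
(* weak equivalences [M <- A -> H(M)].                                        *)

From HB Require Import structures.
From mathcomp Require Import all_boot all_order all_algebra fingroup perm.
From mathcomp Require Import zify ring.
From mathcomp Require Import boolp classical_sets.
From mathcomp.multinomials Require Import freeg.
From Stdlib Require Import Relations.
Require Import Defs.

Set Implicit Arguments.
Unset Strict Implicit.
Unset Printing Implicit Defensive.

Import GRing.Theory.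
Local Open Scope ring_scope.
Local Open Scope quotient_scope.

(** * Linear algebra and equivariant contractions *)

(** Formality is detected by a derivation. On [H(P)], multiplication by the degree is a derivation,
    because degrees add under composition. Call a degree 0 derivation of a model [M] of [P] a weight
    derivation if it commutes with the differential and the symmetric groups and induces
    multiplication by [p] on homology in degree [p]. Such a derivation on a good model exists
    exactly when [P] is formal, and finding one is an affine linear problem over [k], which is why
    neither the field nor truncation matters.

    From formality to a derivation. The operad [model] maps to [P] by a weak equivalence, vanishes
    in arity 1, is finite dimensional in each arity and degree, and satisfies [cofibrant_at]
    everywhere: a compatible map given on formal compositions extends equivariantly. Averaging in
    characteristic zero makes linear choices equivariant ([equivariant_contraction]), so maps out of
    such an operad lift through surjective weak equivalences arity by arity ([lift_by_arity]).
    Arbitrary weak equivalences are made surjective with polynomial paths ([cocyl_ev1_we]), so a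
    zigzag collapses to a single weak equivalence out of [t_N (M (x) K)] ([cofibrant_zigzag]).
    Through it the degree derivation of the homology lifts ([weight_derivation_lift]).

    Descent. The equations for a weight derivation have coefficients in [k], so a [k]-linear
    retraction of [K] onto [k] turns solutions over [K] into solutions over [k]
    ([weight_derivation_descent]). As [N] grows, the solution sets form a decreasing chain of
    nonempty affine spaces with countably many coordinates, and a common solution exists by linear
    compactness ([weight_derivation_compactness]).

    From a derivation to formality. Finite dimensionality allows Fitting decompositions of [M] for
    the derivation. Weights add under composition and the homology in degree [p] has weight [p]. In
    degree [p], the cycles of weight [p] together with all weights below [p] form a suboperad that
    computes the homology, and forgetting the lower weights maps it to [H(M)] by a weak equivalence
    ([weight_formality]).

    Together these give [formal_of_truncations]: if all truncations of [P (x) K] are formal then so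
    is [P]. The remaining implications are base change ([formal_tens]) and restriction to low
    arities ([formal_truncation]). *)

Section LinearMaps.
Variables (k : fieldType).

Definition mkLin (V W : lmodType k) (f : V -> W) (fL : linear f) : {linear V -> W} :=
  HB.pack f (GRing.isLinear.Build k V W *:%R f fL).

Lemma mkLinE (V W : lmodType k) (f : V -> W) (fL : linear f) x : mkLin fL x = f x.
Proof. by []. Qed.

Section Regular.
Variables (V W : lmodType k) (f : {linear V -> W}).

(** The conditions say that [G] is the graph of a partial linear map which is a section of [f] over
    the part of the image of [f] where it is defined. *)
Let closed (G : W * V -> Prop) : Prop :=
  [/\ forall a w v w' v', G (w, v) -> G (w', v') -> G (a *: w + w', a *: v + v'),
      forall v, G (0, v) -> v = 0
    & forall x v, G (f x, v) -> f v = f x].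

(** Adjoining [(0, 0)] makes the empty set admissible, as the empty chain in Zorn's lemma
    requires. *)
Let good (G : set (W * V)) : Prop := closed (fun p => G p \/ p = (0, 0)).

Let good_bigcup (F : set (set (W * V))) :
  (F `<=` good)%classic -> total_on F subset -> good (\bigcup_(X in F) X)%classic.
Proof.
move=> Fg Ft; split.
- move=> a w v w' v' [[X FX Xp]|p0] [[Y FY Yp]|q0].
  + have [XY|YX] := Ft _ _ FX FY.
      have [cl _ _] := Fg _ FY.
      have [h|h] := cl a w v w' v' (or_introl (XY _ Xp)) (or_introl Yp); last by right.
      by left; exists Y.
    have [cl _ _] := Fg _ FX.
    have [h|h] := cl a w v w' v' (or_introl Xp) (or_introl (YX _ Yp)); last by right.
    by left; exists X.
  + have [cl _ _] := Fg _ FX.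
    have [h|h] := cl a w v w' v' (or_introl Xp) (or_intror q0); last by right.
    by left; exists X.
  + have [cl _ _] := Fg _ FY.
    have [h|h] := cl a w v w' v' (or_intror p0) (or_introl Yp); last by right.
    by left; exists Y.
  + by right; case: p0 => -> ->; case: q0 => -> ->; rewrite !scaler0 !addr0.
- move=> v [[X FX Xp]|[-> //]].
  by have [_ h _] := Fg _ FX; apply: h; left.
- move=> x v [[X FX Xp]|[fx ->]]; last by rewrite linear0 fx.
  by have [_ _ h] := Fg _ FX; apply: h; left.
Qed.

(* A linear map over a field is von Neumann regular: [g] is a section when    *)
(* [f] is surjective and a retraction when [f] is injective.                  *)
Lemma linear_regular : exists g : {linear W -> V}, forall x, f (g (f x)) = f x.
Proof.
have [A [[Acl A0 Af] Amax]] := Zorn_bigcup good_bigcup.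
set G := fun p => A p \/ p = (0, 0) in Acl A0 Af.
have G0 : G (0, 0) by right.
have GN w v : G (w, v) -> G (- w, - v).
  by move=> h; have := Acl (-1) _ _ _ _ h G0; rewrite !scaleN1r !addr0.
have GB w v w' v' : G (w, v) -> G (w', v') -> G (w - w', v - v').
  by move=> h /GN h'; have := Acl 1 _ _ _ _ h h'; rewrite !scale1r.
have Gf w v v' : G (w, v) -> G (w, v') -> v = v'.
  move=> h h'; apply/eqP; rewrite -subr_eq0; apply/eqP/A0.
  by have := GB _ _ _ _ h h'; rewrite subrr.
have Gtot w : exists v, G (w, v).
  apply: contrapT => Nw.
  (* Once some [w + w0] lies in the image of [f], the value at [w] is forced modulo the kernel of
     [f]; otherwise any value will do. *)
  have [v vP] : exists v, forall w1 v1 x, G (w1, v1) -> w + w1 = f x -> f (v + v1) = f x.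
    case: (pselect (exists w0 v0 x0, G (w0, v0) /\ w + w0 = f x0)) => [|no].
      move=> [w0 [v0 [x0 [G0' e0]]]]; exists (x0 - v0) => w1 v1 x G1 e1.
      have := GB _ _ _ _ G1 G0'.
      have -> : w1 - w0 = f (x - x0) by rewrite linearB -e1 -e0 opprD addrACA subrr add0r.
      move=> /Af; rewrite !linearB linearD linearB => e.
      by rewrite -addrA [- f v0 + _]addrC e addrCA subrr addr0.
    by exists 0 => w1 v1 x G1 e1; case: no; exists w1, v1, x.
  pose B (p : W * V) := exists a w1 v1, G (w1, v1) /\ p = (a *: w + w1, a *: v + v1).
  have BG p : G p -> B p.
    by case: p => w1 v1 h; exists 0, w1, v1; rewrite !scale0r !add0r.
  apply: (Amax B).
    split; first by move=> p Ap; apply: BG; left.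
    move=> /(_ (w, v)) h; apply: Nw; exists v; left; apply: h.
    by exists 1, 0, 0; rewrite !scale1r !addr0.
  have Bor p : B p \/ p = (0, 0) -> B p.
    by case=> // ->; apply: BG.
  split.
  - move=> a w1 v1 w2 v2 /Bor[b [u1 [x1 [h1 [-> ->]]]]] /Bor[c [u2 [x2 [h2 [-> ->]]]]].
    left; exists (a * b + c), (a *: u1 + u2), (a *: x1 + x2).
    split; first exact: Acl.
    by congr (_, _); rewrite scalerDr scalerDl scalerA addrACA.
  - move=> x /Bor[a [w1 [v1 [h1 [e1 ->]]]]].
    have [a0|a0] := eqVneq a 0.
      move: e1; rewrite a0 !scale0r !add0r => e1.
      by apply: A0; move: h1; rewrite -e1.
    exfalso; apply: Nw; exists (- a^-1 *: v1).
    have := Acl (- a^-1) _ _ _ _ h1 G0; rewrite !addr0.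
    suff -> : - a^-1 *: w1 = w by [].
    have -> : w1 = - (a *: w) by apply/eqP; rewrite -addr_eq0 addrC -e1.
    by rewrite scalerN scaleNr opprK scalerA mulVf // scale1r.
  - move=> x y /Bor[a [w1 [v1 [h1 [e1 ->]]]]].
    have [a0|a0] := eqVneq a 0.
      by move: e1; rewrite a0 !scale0r !add0r => e1; apply: Af; rewrite e1.
    have e2 : w + a^-1 *: w1 = f (a^-1 *: x).
      by rewrite linearZ /= e1 scalerDr scalerA mulVf // scale1r.
    have h2 : G (a^-1 *: w1, a^-1 *: v1).
      by have := Acl a^-1 _ _ _ _ h1 G0; rewrite !addr0.
    have := congr1 ( *:%R a) (vP _ _ _ h2 e2).
    by rewrite -2!linearZ /= scalerDr !scalerA divff // !scale1r.
have [g gP] := choice Gtot.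
have gL : linear g.
  move=> a w w'; exact: (Gf _ _ _ (gP _) (Acl _ _ _ _ _ (gP w) (gP w'))).
by exists (mkLin gL) => x; exact: (Af _ _ (gP _)).
Qed.

End Regular.
End LinearMaps.

Lemma dep_choice (X : Type) (Y : X -> Type) (P : forall x, Y x -> Prop) :
  (forall x, exists y, P x y) -> exists f : forall x, Y x, forall x, P x (f x).
Proof. by move=> H; exists (fun x => projT1 (cid (H x))) => x; case: cid. Qed.

Lemma cyc_val_linear (k : fieldType) (C : complex k) p : linear (@cyc_val k C p).
Proof. by []. Qed.

Lemma hmapE (k : fieldType) (C D : complex k) (F : chain_map C D) p z :
  hmap F p (hclass C p z) = hclass D p (cyc_map F z).
Proof. exact: hmap_hclass. Qed.

Section Averaging.
Variables (k : fieldType) (char_k : [pchar k] =i pred0) (G : finGroupType).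
Variables (V W : lmodType k) (aV : G -> {linear V -> V}) (aW : G -> {linear W -> W}).
Hypothesis aVM : forall s t x, aV (s * t)%g x = aV s (aV t x).
Hypothesis aW1 : forall x, aW 1%g x = x.
Hypothesis aWM : forall s t x, aW (s * t)%g x = aW s (aW t x).

(** Each conjugate [s g s^-1] of a regular inverse [g] is again one because [f] is equivariant, and
    the condition is affine in [g]; the average over [G] is therefore an equivariant regular
    inverse. *)
Lemma equivariant_regular (f : {linear V -> W}) :
  (forall s x, f (aV s x) = aW s (f x)) ->
  exists g : {linear W -> V},
    (forall s x, g (aW s x) = aV s (g x)) /\ (forall x, f (g (f x)) = f x).
Proof.
move=> fE; have [g gP] := linear_regular f.
pose N : k := #|G|%:R.
have N0 : N != 0.
  have [/pcharf0P -> _] := (char_k, tt).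
  by rewrite -lt0n; apply/card_gt0P; exists 1%g.
pose h x := N^-1 *: \sum_(s : G) aV s (g (aW s^-1%g x)).
have hL : linear h.
  move=> a x y; rewrite /h scalerA mulrC -scalerA -scalerDr; congr (_ *: _).
  by rewrite scaler_sumr -big_split /=; apply: eq_bigr => s _; rewrite !linearP.
exists (mkLin hL); split=> [t x|x]; rewrite !mkLinE /h.
  rewrite linearZ /= (linear_sum (aV t)); congr (_ *: _).
  rewrite (reindex_inj (mulgI t)) /=; apply: eq_bigr => s _.
  by rewrite aVM -aWM invMg -mulgA mulVg mulg1.
rewrite linearZ /= (linear_sum f) (eq_bigr (fun=> f x)) => [|s _].
  by rewrite sumr_const -[#|_|]/(#|G|) -scaler_nat scalerA mulVf // scale1r.
by rewrite fE -(fE s^-1%g) gP fE -aWM mulgV aW1.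
Qed.
End Averaging.

Record gmod (k : fieldType) (m : nat) := GMod {
  gm_mod :> int -> lmodType k;
  gm_act : 'S_m -> forall p : int, {linear gm_mod p -> gm_mod p};
  gm_act1 : forall p x, gm_act 1%g p x = x;
  gm_actM : forall (s t : 'S_m) p x, gm_act (s * t)%g p x = gm_act s p (gm_act t p x) }.

Record scomplex (k : fieldType) (m : nat) := SComplex {
  sc_cx :> complex k;
  sc_act : 'S_m -> chain_map sc_cx sc_cx;
  sc_act1 : forall p x, sc_act 1%g p x = x;
  sc_actM : forall (s t : 'S_m) p x, sc_act (s * t)%g p x = sc_act s p (sc_act t p x) }.

Definition sc_gmod (k : fieldType) m (C : scomplex k m) : gmod k m :=
  @GMod k m C (sc_act C) (@sc_act1 _ _ C) (@sc_actM _ _ C).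

Definition op_sc (k : fieldType) (I : Type) (ar : I -> nat) (P : operad_on k ar) (l : I) :
    scomplex k (ar l) :=
  SComplex (@op_act1 _ _ _ P l) (@op_actM _ _ _ P l).

Section Contraction.
Variables (k : fieldType) (char_k : [pchar k] =i pred0) (m : nat) (C : scomplex k m).

Lemma cyc_map_linear (A B : complex k) (F : chain_map A B) p :
  linear (@cyc_map k A B F p).
Proof. by move=> a u v; apply: val_inj; rewrite /= linearP. Qed.

Lemma dd0 (A : complex k) (p q r : int) (e1 : p = q + 1) (e2 : q = r + 1) x :
  cx_d A e2 (cx_d A e1 x) = 0.
Proof. exact: cx_dd. Qed.

(** Choose equivariant regular inverses [L] of the differentials and an equivariant section [S] of
    the projection from cycles to homology. Then [s] is [S], [r x] is the class of the cycle
    [x - L (d x)], and [h] applies [L] to the boundary [x - L (d x) - s (r x)]. *)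
Lemma equivariant_contraction :
  exists (s : forall p, {linear hmod C p -> C p})
         (r : forall p, {linear C p -> hmod C p})
         (h : forall p q : int, p = q + 1 -> {linear C q -> C p}),
  [/\ forall p q (e : p = q + 1) x, cx_d C e (s p x) = 0,
      forall p z, r p (cyc_val z) = hclass C p z,
      forall p c, r p (s p c) = c,
      forall p q o (e1 : p = q + 1) (e2 : q = o + 1) x,
        x - s q (r q x) = cx_d C e1 (h p q e1 x) + h q o e2 (cx_d C e2 x)
    & [/\ forall t p c, s p (hmap (sc_act C t) p c) = sc_act C t p (s p c),
          forall t p x, r p (sc_act C t p x) = hmap (sc_act C t) p (r p x)
        & forall t p q e x, h p q e (sc_act C t q x) = sc_act C t p (h p q e x)]].
Proof.
have : forall pq : int * int, exists L : {linear C pq.2 -> C pq.1},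
    (forall t y, L (sc_act C t _ y) = sc_act C t _ (L y)) /\
    (forall (e : pq.1 = pq.2 + 1) y, cx_d C e (L (cx_d C e y)) = cx_d C e y).
  move=> [p q] /=; have [e|ne] := eqVneq p (q + 1); last first.
    by exists \0; split=> [t y|e]; [rewrite linear0 | rewrite e eqxx in ne].
  have [||||L [LE LP]] := @equivariant_regular k char_k _ _ _
    (fun t => sc_act C t p) (fun t => sc_act C t q) _ _ _ (cx_d C e).
  - by move=> s t x; rewrite sc_actM.
  - by move=> x; rewrite sc_act1.
  - by move=> s t x; rewrite sc_actM.
  - by move=> s x; rewrite cm_d.
  by exists L; split=> // e'; rewrite (eq_irrelevance e' e).
move=> /dep_choice[L0 L0P].
pose L (p q : int) (e : p = q + 1) : {linear C q -> C p} := L0 (p, q).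
have LE (p q : int) (e : p = q + 1) t y : L p q e (sc_act C t _ y) = sc_act C t _ (L p q e y).
  exact: (L0P (p, q)).1.
have LP (p q : int) (e : p = q + 1) y : cx_d C e (L p q e (cx_d C e y)) = cx_d C e y.
  exact: (L0P (p, q)).2.
have : forall p, exists S : {linear hmod C p -> cycles C p},
    (forall t c, S (hmap (sc_act C t) p c) = cyc_map (sc_act C t) (S c)) /\
    (forall c, hclass C p (S c) = c).
  move=> p.
  have [||||S [SE SP]] := @equivariant_regular k char_k _ _ _
    (fun t : 'S_m => mkLin (@cyc_map_linear _ _ (sc_act C t) p))
    (fun t => hmap (sc_act C t) p) _ _ _ (hclass C p).
  - by move=> s t x; apply: val_inj; rewrite /= sc_actM.
  - move=> x; elim/hclass_ind: x => z; rewrite hmapE; congr (hclass _ _ _).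
    by apply: val_inj; rewrite /= sc_act1.
  - move=> s t x; elim/hclass_ind: x => z; rewrite !hmapE; congr (hclass _ _ _).
    by apply: val_inj; rewrite /= sc_actM.
  - by move=> s x; rewrite hmapE.
  exists S; split=> // c; elim/hclass_ind: c => z; exact: SP.
move=> /dep_choice[S0 S0P].
pose s p : {linear hmod C p -> C p} := mkLin (@cyc_val_linear k C p) \o S0 p.
pose e0 (p : int) : p = p - 1 + 1 := esym (subrK 1 p).
(* A projection onto the cycles, since [d L d = d]. *)
pose zeta p x := x - L _ _ (e0 p) (cx_d C (e0 p) x).
have zP p x : zeta p x \in @is_cycle k C p.
  apply/eqP; rewrite /zeta linearB; apply/eqP.
  by rewrite LP subrr.
pose z p x := Cycles (zP p x).
have zetaL p a u v : zeta p (a *: u + v) = a *: zeta p u + zeta p v.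
  by rewrite /zeta (linearP (cx_d C _)) (linearP (L _ _ _)) opprD addrACA -scalerBr.
have zL p : linear (z p) by move=> a u v; apply: val_inj; exact: zetaL.
pose r p : {linear C p -> hmod C p} := hclass C p \o mkLin (zL p).
have zE p (w : cycles C p) : z p (cyc_val w) = w.
  by apply: val_inj; rewrite /= /zeta cyc_d linear0 subr0.
have rz p w : r p (cyc_val w) = hclass C p w by rewrite /= zE.
have rd (p q : int) (e : p = q + 1) y : r q (cx_d C e y) = 0.
  have cP : cx_d C e y \in @is_cycle k C q by apply/cycleP => o e'; rewrite dd0.
  rewrite -[cx_d C e y]/(cyc_val (Cycles cP)) rz -[RHS](linear0 (hclass C q)).
  by apply: (hclass_eq (e := e) (y := y)); rewrite /= subr0.
have sd (p q : int) (e : p = q + 1) x : cx_d C e (s p x) = 0 by rewrite /= cyc_d.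
have bdry (p q : int) (e : p = q + 1) x :
    exists y, zeta q x - s q (r q x) = cx_d C e y.
  have /hclassP[y] : hclass C q (z q x) = hclass C q (S0 q (r q x)).
    by rewrite (S0P q).2.
  by subst p => dy; exists y.
have hL q : linear (fun x => zeta q x - s q (r q x)).
  move=> a u v; rewrite zetaL (linearP (r q)) (linearP (s q)) (scalerBr a (zeta q u)) opprD.
  by rewrite addrACA.
pose h (p q : int) (e : p = q + 1) : {linear C q -> C p} := L _ _ e \o mkLin (hL q).
have rE t p x : r p (sc_act C t p x) = hmap (sc_act C t) p (r p x).
  rewrite /= hmap_hclass; congr (hclass _ _ _); apply: val_inj => /=.
  by rewrite /zeta linearB /= cm_d LE.
have sE t p c : s p (hmap (sc_act C t) p c) = sc_act C t p (s p c).
  by rewrite /= (S0P p).1.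
exists s, r, h; split=> //.
- by move=> p c; rewrite -[s p c]/(cyc_val (S0 p c)) rz (S0P p).2.
- move=> p q o e1 e2 x.
  have e2E : cx_d C e2 x = cx_d C e2 x by [].
  have oE : o = q - 1 by rewrite e2 addrK.
  subst o; rewrite (eq_irrelevance e2 (e0 q)) => {e2E}.
  have -> : h q (q - 1) (e0 q) (cx_d C (e0 q) x) = L _ _ (e0 q) (cx_d C (e0 q) x).
    by rewrite /h /= -[hclass C _ _]/(r _ _) /zeta dd0 linear0 subr0 (rd _ _ (e0 q)) linear0 subr0.
  have [y yE] := bdry _ _ e1 x.
  have -> : cx_d C e1 (h p q e1 x) = zeta q x - s q (r q x).
    by rewrite yE /h /= -[LHS]/(cx_d C e1 (L _ _ e1 (zeta q x - s q (r q x)))) yE LP.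
  by rewrite /zeta addrAC subrK.
- split=> // t p q e x.
  have hE y : h p q e y = L p q e (zeta q y - s q (r q y)) by [].
  have zetaE : zeta q (sc_act C t q x) = sc_act C t q (zeta q x).
    by rewrite /zeta cm_d LE linearB.
  by rewrite !hE zetaE rE sE -linearB LE.
Qed.
End Contraction.

(** * Suboperads, products and quasi-isomorphisms *)

Section Submodules.
Variables (k : fieldType) (V : lmodType k) (W : submodule V).

Definition msub_pred : {pred V} := fun x => `[< W x >].

Lemma msub_pred_closed : GRing.subsemimod_closed msub_pred.
Proof.
split; first split; first by apply/asboolP; exact: sub_mem0.
- move=> u v /asboolP Wu /asboolP Wv; apply/asboolP.
  by rewrite -[u]scale1r; exact: sub_memL.
- move=> a u /asboolP Wu; apply/asboolP.
  by rewrite -[a *: u]addr0; apply: sub_memL => //; exact: sub_mem0.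
Qed.
HB.instance Definition _ := GRing.isSubmodClosed.Build k V msub_pred msub_pred_closed.

Record msub := MSub { mval : V; _ : mval \in msub_pred }.
HB.instance Definition _ := [isSub for mval].
HB.instance Definition _ := [Choice of msub by <:].
HB.instance Definition _ := [SubChoice_isSubLmodule of msub by <:].

Lemma msubP (x : msub) : W (mval x).
Proof. by case: x => x /= /asboolP. Qed.

Definition mksub (x : V) (Wx : W x) : msub := MSub (asboolT Wx).

Lemma mval_linear : linear mval.
Proof. by []. Qed.

Lemma sub_memD u v : W u -> W v -> W (u + v).
Proof. by move=> Wu Wv; rewrite -[u]scale1r; exact: sub_memL. Qed.
Lemma sub_memZ a u : W u -> W (a *: u).
Proof. by move=> Wu; rewrite -[a *: u]addr0; apply: sub_memL => //; exact: sub_mem0. Qed.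
End Submodules.

Section DependentProducts.
Variables (k : fieldType) (X : Type) (V : X -> lmodType k).

Definition dprod : Type := forall x, V x.
HB.instance Definition _ := Choice.copy dprod (forall x, V x).

Let add (f g : dprod) : dprod := fun x => f x + g x.
Let opp (f : dprod) : dprod := fun x => - f x.
Let zero : dprod := fun x => 0.
Let scale a (f : dprod) : dprod := fun x => a *: f x.

Let addA : associative add.
Proof. by move=> f g h; apply: functional_extensionality_dep => x; exact: addrA. Qed.
Let addC : commutative add.
Proof. by move=> f g; apply: functional_extensionality_dep => x; exact: addrC. Qed.
Let add0 : left_id zero add.
Proof. by move=> f; apply: functional_extensionality_dep => x; exact: add0r. Qed.
Let addN : left_inverse zero opp add.
Proof. by move=> f; apply: functional_extensionality_dep => x; exact: addNr. Qed.
HB.instance Definition _ := GRing.isZmodule.Build dprod addA addC add0 addN.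

Let scaleA a b f : scale a (scale b f) = scale (a * b) f.
Proof. by apply: functional_extensionality_dep => x; exact: scalerA. Qed.
Let scale1 : left_id 1 scale.
Proof. by move=> f; apply: functional_extensionality_dep => x; exact: scale1r. Qed.
Let scaleDr : right_distributive scale +%R.
Proof. by move=> a f g; apply: functional_extensionality_dep => x; exact: scalerDr. Qed.
Let scaleDl f : {morph scale^~ f : a b / a + b}.
Proof. by move=> a b; apply: functional_extensionality_dep => x; exact: scalerDl. Qed.
HB.instance Definition _ :=
  GRing.Zmodule_isLmodule.Build k dprod scaleA scale1 scaleDr scaleDl.

Lemma dprod_linear (x : X) : linear (fun f : dprod => f x).
Proof. by []. Qed.

Lemma dprodP (f g : dprod) : (forall x, f x = g x) -> f = g.
Proof. exact: functional_extensionality_dep. Qed.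

End DependentProducts.

Section SubOperad.
Variables (k : fieldType) (I : Type) (ar : I -> nat) (P : operad_on k ar).
Variable W : forall (l : I) (p : int), submodule (P l p).
Hypothesis Wd : forall l (p q : int) (e : p = q + 1) x, W l p x -> W l q (cx_d (P l) e x).
Hypothesis Wact : forall l s p x, W l p x -> W l p (op_act P (l := l) s p x).
Hypothesis Wcomp : forall l m n (e : (ar l + ar m = (ar n).+1)%N) i p q r (d : p + q = r) a b,
  W l p a -> W m q b -> W n r (bm_fun (op_comp P e i) d a b).

Let subd l (p q : int) (e : p = q + 1) (x : msub (W l p)) : msub (W l q) :=
  mksub (Wd e (msubP x)).
Let subd_linear l p q e : linear (@subd l p q e).
Proof. by move=> a u v; apply: val_inj; rewrite /= linearP. Qed.

Definition subcx (l : I) : complex k.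
Proof.
exists (fun p => msub (W l p)) (fun p q e => mkLin (@subd_linear l p q e)).
by move=> *; apply: val_inj; exact: cx_dd.
Defined.

Let suba l s p (x : msub (W l p)) : msub (W l p) := mksub (Wact s (msubP x)).
Let suba_linear l s p : linear (@suba l s p).
Proof. by move=> a u v; apply: val_inj; rewrite /= linearP. Qed.

Definition subact (l : I) (s : 'S_(ar l)) : chain_map (subcx l) (subcx l).
Proof.
exists (fun p => mkLin (@suba_linear l s p)).
by move=> *; apply: val_inj; exact: cm_d.
Defined.

Definition subcomp l m n (e : (ar l + ar m = (ar n).+1)%N) (i : 'I_(ar l)) :
  bichain_map (subcx l) (subcx m) (subcx n).
Proof.
exists (fun p q r d (a : msub (W l p)) (b : msub (W m q)) =>
          mksub (Wcomp e i d (msubP a) (msubP b)) : msub (W n r)).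
- by move=> p q r d b a u v; apply: val_inj; exact: bm_linl.
- by move=> p q r d b a u v; apply: val_inj; exact: bm_linr.
- by move=> *; apply: val_inj; exact: bm_d.
Defined.

Definition subop : operad_on k ar.
Proof.
exists subcx subact subcomp.
- by move=> *; apply: val_inj; exact: op_act1.
- by move=> *; apply: val_inj; exact: op_actM.
- by move=> *; apply: val_inj; exact: op_equiv.
- by move=> *; apply: val_inj; exact: op_assoc.
- by move=> *; apply: val_inj; exact: op_comm.
Defined.

Definition subop_incl : operad_mor subop P.
Proof.
unshelve eexists.
- move=> l; exists (fun p => mkLin (@mval_linear k (P l p) (W l p))).
  by [].
- by [].
- by [].
Defined.

End SubOperad.

Lemma bijectiveP (A B : Type) (f : A -> B) :
  bijective f <-> injective f /\ (forall y, exists x, f x = y).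
Proof.
split=> [bf|[fi fs]]; first by split; [exact: bij_inj | case: bf => g fK gK y; exists (g y)].
have [g gP] := choice fs.
by exists g => // x; apply: fi; rewrite gP.
Qed.

Lemma addKB (A : zmodType) (a b c : A) : a + b + (c - a - b) = c.
Proof. by rewrite -[c - a - b]addrA -opprD [LHS]addrC subrK. Qed.

Section QuasiIsomorphisms.
Variable k : fieldType.
Implicit Types C D : complex k.

Definition quasi_iso C D (F : chain_map C D) : Prop := forall p, bijective (hmap F p).

Lemma hclass_congr C p (z z' : cycles C p) :
  cyc_val z = cyc_val z' -> hclass C p z = hclass C p z'.
Proof. by move=> /val_inj ->. Qed.

Lemma hclass0P C p (z : cycles C p) :
  hclass C p z = 0 <-> exists y : C (p + 1), cx_d C erefl y = cyc_val z.
Proof.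
rewrite -[0 in X in X <-> _](linear0 (hclass C p)).
by split=> [/hclassP|] [y]; rewrite ?subr0 => dy; [|apply/hclassP]; exists y; rewrite ?subr0.
Qed.

(** The two halves are injectivity and surjectivity on homology in terms of representatives. *)
Lemma quasi_isoP C D (F : chain_map C D) : quasi_iso F <->
  (forall p (z : cycles C p), (exists y : D (p + 1), cx_d D erefl y = F p (cyc_val z)) ->
     exists x : C (p + 1), cx_d C erefl x = cyc_val z)
  /\ (forall p (w : cycles D p), exists (z : cycles C p) (y : D (p + 1)),
     cx_d D erefl y = cyc_val w - F p (cyc_val z)).
Proof.
split=> [qi|[Finj Fsurj] p].
  split=> p.
    move=> z [y dy]; have /bijectiveP[hi _] := qi p.
    apply/hclass0P; apply: hi; rewrite linear0 hmapE; apply/hclass0P.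
    by exists y.
  move=> w; have /bijectiveP[_ /(_ (hclass D p w))[h]] := qi p.
  elim/hclass_ind: h => z; rewrite hmapE => /esym/hclassP[y dy].
  by exists z, y.
apply/bijectiveP; split.
  have hi0 h : hmap F p h = 0 -> h = 0.
    elim/hclass_ind: h => z; rewrite hmapE => /hclass0P h.
    by apply/hclass0P; apply: Finj.
  move=> h h' e; apply/eqP; rewrite -subr_eq0; apply/eqP/hi0.
  by rewrite linearB e subrr.
move=> h; elim/hclass_ind: h => w; have [z [y dy]] := Fsurj p w.
by exists (hclass C p z); rewrite hmapE; apply/esym/hclassP; exists y.
Qed.

Definition cm_id C : chain_map C C := @ChainMap k C C (fun p => idfun) (fun p q e x => erefl).

Definition cm_comp C D B (G : chain_map D B) (F : chain_map C D) : chain_map C B.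
Proof.
exists (fun p => G p \o F p).
by move=> p q e x; rewrite /= !cm_d.
Defined.

Lemma hmap_id C p : hmap (cm_id C) p =1 id.
Proof.
move=> h; elim/hclass_ind: h => z; rewrite hmapE.
by apply: hclass_congr.
Qed.

Lemma hmap_comp C D B (G : chain_map D B) (F : chain_map C D) p :
  hmap (cm_comp G F) p =1 hmap G p \o hmap F p.
Proof.
elim/hclass_ind=> z; transitivity (hmap G p (hmap F p (hclass C p z))) => //.
by rewrite !hmapE; apply: hclass_congr.
Qed.

Lemma hmap_ext C D (F G : chain_map C D) p :
  (forall x, F p x = G p x) -> hmap F p =1 hmap G p.
Proof.
move=> FG; elim/hclass_ind=> z; rewrite !hmapE.
by apply: hclass_congr; rewrite /= FG.
Qed.

Lemma quasi_iso_ext C D (F G : chain_map C D) :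
  (forall p x, F p x = G p x) -> quasi_iso F -> quasi_iso G.
Proof. by move=> FG qF p; apply: eq_bij (qF p) _ _; apply: hmap_ext. Qed.

Lemma quasi_iso_id C : quasi_iso (cm_id C).
Proof. by move=> p; exists id => x; rewrite hmap_id. Qed.

Lemma quasi_iso_comp C D B (G : chain_map D B) (F : chain_map C D) :
  quasi_iso G -> quasi_iso F -> quasi_iso (cm_comp G F).
Proof.
move=> qG qF p; apply: eq_bij (bij_comp (qG p) (qF p)) _ _ => x.
by rewrite hmap_comp.
Qed.

Lemma quasi_iso_cancell C D B (G : chain_map D B) (F : chain_map C D) :
  quasi_iso G -> quasi_iso (cm_comp G F) -> quasi_iso F.
Proof.
move=> qG qGF p; have [f fK fK'] := qG p; have [g gK gK'] := qGF p.
exists (g \o hmap G p) => x /=.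
  by rewrite -[hmap G p _]/((hmap G p \o hmap F p) _) -hmap_comp gK.
apply: (can_inj fK).
by rewrite -[LHS]/((hmap G p \o hmap F p) _) -hmap_comp gK'.
Qed.

Lemma bijective_quasi_iso C D (F : chain_map C D) :
  (forall p, bijective (F p)) -> quasi_iso F.
Proof.
move=> bF; apply/quasi_isoP; split=> p.
  move=> z [y dy]; have [g gK gK'] := bF (p + 1); exists (g y).
  by have [g' g'K _] := bF p; apply: (can_inj g'K); rewrite -cm_d gK' dy.
move=> w; have [g gK gK'] := bF p.
have cz : g (cyc_val w) \in @is_cycle k C p.
  apply/cycleP => q e; have [g' g'K _] := bF q; apply: (can_inj g'K).
  by rewrite -cm_d gK' cyc_d linear0.
by exists (Cycles cz), 0; rewrite linear0 /= gK' subrr.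
Qed.

(** This is the acyclicity of the kernel of [F] in relative form. Injectivity on homology gives some
    [x] with [d x = t]. The cycle [s - F x] is homologous to the image of a cycle [z], and the
    remaining boundary lifts because [F] is surjective. *)
Lemma surjective_quasi_iso_lift C D (F : chain_map C D) p (t : C p) (s : D (p + 1)) :
  (forall q (y : D q), exists x, F q x = y) -> quasi_iso F ->
  (forall q (e : p = q + 1), cx_d C e t = 0) -> cx_d D erefl s = F p t ->
  exists x : C (p + 1), F _ x = s /\ cx_d C erefl x = t.
Proof.
move=> Fs /quasi_isoP[Finj Fsurj] dt ds.
have ct : t \in @is_cycle k C p by apply/cycleP.
have [x dx] : exists x, cx_d C (erefl (p + 1)) x = t.
  by apply: (Finj p (Cycles ct)); exists s.
have cw : s - F _ x \in @is_cycle k D (p + 1).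
  apply/cycleP => q e; have qp : q = p by apply/(addIr 1).
  subst q; rewrite (eq_irrelevance e erefl) linearB cm_d dx.
  by rewrite ds subrr.
have [z [y dy]] := Fsurj _ (Cycles cw).
have [y' y'E] := Fs _ y.
exists (x + cyc_val z + cx_d C erefl y'); split.
  by rewrite !linearD -(cm_d F erefl y') y'E dy /= addKB.
by rewrite !linearD dx cyc_d dd0 !addr0.
Qed.

End QuasiIsomorphisms.

Section Morphisms.
Variables (k : fieldType) (I : Type) (ar : I -> nat).
Implicit Types P Q R : operad_on k ar.

Definition om_id P : operad_mor P P.
Proof. by exists (fun l => cm_id (P l)). Defined.

Definition om_cmp P Q R (g : operad_mor Q R) (f : operad_mor P Q) : operad_mor P R.
Proof.
exists (fun l => cm_comp (g l) (f l)).
- by move=> *; rewrite /= !om_act.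
- by move=> *; rewrite /= !om_comp.
Defined.

Lemma weak_equivalence_comp P Q R (g : operad_mor Q R) (f : operad_mor P Q) :
  weak_equivalence g -> weak_equivalence f -> weak_equivalence (om_cmp g f).
Proof. by move=> wg wf l; exact: quasi_iso_comp (wg l) (wf l). Qed.

Lemma weak_equivalence_zigzag P Q (f : operad_mor P Q) : weak_equivalence f -> zigzag P Q.
Proof. by move=> wf; apply: rst_step; exists f. Qed.

Section HomologyFunctor.
Variables (P Q : operad_on k ar) (f : operad_mor P Q).

Definition homology_mor : operad_mor (homology_operad P) (homology_operad Q).
Proof.
exists (fun l => homology_map (f l)).
- move=> l s p; elim/hclass_ind => z; rewrite !homology_mapE.
  by apply: hclass_congr; rewrite /= om_act.
- move=> l m n e i p q r d; elim/hclass_ind => a; elim/hclass_ind => b.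
  rewrite homology_mulE !homology_mapE homology_mulE.
  by apply: hclass_congr; rewrite /= om_comp.
Defined.

Lemma weak_equivalence_homology : weak_equivalence f -> weak_equivalence homology_mor.
Proof. by move=> wf l; apply: bijective_quasi_iso => p; exact: wf. Qed.

End HomologyFunctor.

Lemma zigzag_homology P Q : zigzag P Q -> zigzag (homology_operad P) (homology_operad Q).
Proof.
elim=> {P Q} [P Q [f wf]|P|P Q _|P Q R _ + _].
- exact: weak_equivalence_zigzag (weak_equivalence_homology wf).
- exact: rst_refl.
- exact: rst_sym.
- exact: rst_trans.
Qed.

Section ZeroDifferential.
Variable P : operad_on k ar.
Hypothesis d0 : forall l (p q : int) (e : p = q + 1) x, cx_d (P l) e x = 0.

Lemma zero_d_cycle l p (x : P l p) : x \in @is_cycle k (P l) p.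
Proof. by apply/cycleP => q e. Qed.

Lemma zero_d_class_linear l p : linear (fun x : P l p => hclass (P l) p (Cycles (zero_d_cycle x))).
Proof. by move=> a u v; rewrite -linearP; apply: hclass_congr. Qed.

Definition zero_d_mor : operad_mor P (homology_operad P).
Proof.
unshelve eexists.
- move=> l; exists (fun p => mkLin (@zero_d_class_linear l p) : {linear P l p -> homology (P l) p}).
  by move=> p q e x; rewrite d0 linear0.
- by move=> l s p x; rewrite [RHS]homology_mapE; apply: hclass_congr.
- move=> l m n e i p q r d a b.
  by rewrite [RHS]homology_mulE; apply: hclass_congr.
Defined.

Lemma weak_equivalence_zero_d : weak_equivalence zero_d_mor.
Proof.
move=> l; apply: bijective_quasi_iso => p; apply/bijectiveP; split.
  by move=> x y /hclassP[z]; rewrite d0 => /esym/eqP; rewrite subr_eq0 => /eqP.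
elim/hclass_ind=> z; exists (cyc_val z).
by apply: hclass_congr.
Qed.

End ZeroDifferential.

(** Homology preserves weak equivalences, so a zigzag between [P] and [Q] also yields one between
    their homologies. *)
Lemma formal_zigzag P Q : zigzag P Q -> formal P -> formal Q.
Proof.
move=> zPQ fP; apply: rst_trans (rst_sym _ _ _ _ zPQ) _.
exact: rst_trans fP (zigzag_homology zPQ).
Qed.

End Morphisms.

Section Products.
Variables (k : fieldType) (I : Type) (ar : I -> nat).

Section DependentProduct.
Variables (X : Type) (P : X -> operad_on k ar).

Let pd l (p q : int) (e : p = q + 1) (f : dprod (fun x => P x l p)) :
  dprod (fun x => P x l q) := fun x => cx_d (P x l) e (f x).
Let pd_linear l p q e : linear (@pd l p q e).
Proof. by move=> a u v; apply: dprodP => x; rewrite /pd linearP. Qed.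

Definition prodcx (l : I) : complex k.
Proof.
exists (fun p => dprod (fun x => P x l p)) (fun p q e => mkLin (@pd_linear l p q e)).
by move=> *; apply: dprodP => x; exact: cx_dd.
Defined.

Let pa l s p (f : dprod (fun x => P x l p)) : dprod (fun x => P x l p) :=
  fun x => op_act (P x) s p (f x).
Let pa_linear l s p : linear (@pa l s p).
Proof. by move=> a u v; apply: dprodP => x; rewrite /pa linearP. Qed.

Definition prodact (l : I) (s : 'S_(ar l)) : chain_map (prodcx l) (prodcx l).
Proof.
exists (fun p => mkLin (@pa_linear l s p)).
by move=> *; apply: dprodP => x; exact: cm_d.
Defined.

Definition prodcomp l m n (e : (ar l + ar m = (ar n).+1)%N) (i : 'I_(ar l)) :
  bichain_map (prodcx l) (prodcx m) (prodcx n).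
Proof.
exists (fun p q r d (a : dprod (fun x => P x l p)) (b : dprod (fun x => P x m q)) =>
          (fun x => bm_fun (op_comp (P x) e i) d (a x) (b x)) : dprod (fun x => P x n r)).
- by move=> p q r d b a u v; apply: dprodP => x; exact: bm_linl.
- by move=> p q r d b a u v; apply: dprodP => x; exact: bm_linr.
- by move=> *; apply: dprodP => x; exact: bm_d.
Defined.

Definition prodop : operad_on k ar.
Proof.
exists prodcx prodact prodcomp.
- by move=> *; apply: dprodP => x; exact: op_act1.
- by move=> *; apply: dprodP => x; exact: op_actM.
- by move=> *; apply: dprodP => x; exact: op_equiv.
- by move=> *; apply: dprodP => x; exact: op_assoc.
- by move=> *; apply: dprodP => x; exact: op_comm.
Defined.

Definition prodop_proj (x : X) : operad_mor prodop (P x).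
Proof.
unshelve eexists.
- move=> l; exists (fun p => mkLin (@dprod_linear k X (fun x => P x l p) x)).
  by [].
- by [].
- by [].
Defined.

End DependentProduct.

Section BinaryProduct.
Variables (P Q : operad_on k ar).

Let bd l (p q : int) (e : p = q + 1) (x : (P l p * Q l p)%type) : (P l q * Q l q)%type :=
  (cx_d (P l) e x.1, cx_d (Q l) e x.2).
Let bd_linear l p q e : linear (@bd l p q e).
Proof. by move=> a u v; rewrite /bd !linearP. Qed.

Definition bprodcx (l : I) : complex k.
Proof.
exists (fun p => (P l p * Q l p)%type : lmodType k) (fun p q e => mkLin (@bd_linear l p q e)).
by move=> p q r e1 e2 x; congr (_, _); exact: cx_dd.
Defined.

Let ba l s p (x : (P l p * Q l p)%type) : (P l p * Q l p)%type :=
  (op_act P s p x.1, op_act Q s p x.2).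
Let ba_linear l s p : linear (@ba l s p).
Proof. by move=> a u v; rewrite /ba !linearP. Qed.

Definition bprodact (l : I) (s : 'S_(ar l)) : chain_map (bprodcx l) (bprodcx l).
Proof.
exists (fun p => mkLin (@ba_linear l s p)).
by move=> *; congr (_, _); exact: cm_d.
Defined.

Definition bprodcomp l m n (e : (ar l + ar m = (ar n).+1)%N) (i : 'I_(ar l)) :
  bichain_map (bprodcx l) (bprodcx m) (bprodcx n).
Proof.
exists (fun p q r d (a : (P l p * Q l p)%type) (b : (P m q * Q m q)%type) =>
          (bm_fun (op_comp P e i) d a.1 b.1, bm_fun (op_comp Q e i) d a.2 b.2)
          : (P n r * Q n r)%type).
- by move=> p q r d b a u v; congr (_, _); exact: bm_linl.
- by move=> p q r d b a u v; congr (_, _); exact: bm_linr.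
- by move=> *; congr (_, _); exact: bm_d.
Defined.

Definition bprodop : operad_on k ar.
Proof.
exists bprodcx bprodact bprodcomp.
- by move=> l p [x y]; congr (_, _); exact: op_act1.
- by move=> *; congr (_, _); exact: op_actM.
- by move=> *; congr (_, _); exact: op_equiv.
- by move=> *; congr (_, _); exact: op_assoc.
- by move=> *; congr (_, _); exact: op_comm.
Defined.

Definition bprod_fst : operad_mor bprodop P.
Proof.
unshelve eexists.
- move=> l; exists (fun p => mkLin (f := fun x : (P l p * Q l p)%type => x.1) (fun a u v => erefl)).
  by [].
- by [].
- by [].
Defined.

Definition bprod_snd : operad_mor bprodop Q.
Proof.
unshelve eexists.
- move=> l; exists (fun p => mkLin (f := fun x : (P l p * Q l p)%type => x.2) (fun a u v => erefl)).
  by [].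
- by [].
- by [].
Defined.

End BinaryProduct.
End Products.

(** * Cofibrant operads and lifting *)

Lemma addKBC (A : zmodType) (a b c : A) : a + b - (a - c) = b + c.
Proof. by rewrite opprB [a + b]addrC addrACA subrr addr0. Qed.

Section Cofibrancy.
Variables (k : fieldType) (I : Type) (ar : I -> nat).

(** A test is a family of bilinear maps obeying all axioms of partial compositions with result in
    arity [n]. It amounts to an equivariant map to [X] from the graded module of formal compositions
    of arity [n], and lets freeness be expressed without trees. *)
Record test (Q : operad_on k ar) (n : I) (X : gmod k (ar n)) := Test {
  t_fun : forall (l m : I) (e : (ar l + ar m = (ar n).+1)%N) (i : 'I_(ar l))
    (p q r : int) (d : p + q = r), Q l p -> Q m q -> X r;
  t_linl : forall l m e i p q r d b, linear (fun a => @t_fun l m e i p q r d a b);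
  t_linr : forall l m e i p q r d a, linear (@t_fun l m e i p q r d a);
  t_equiv : forall (l m : I) (e : (ar l + ar m = (ar n).+1)%N)
    (t : 'S_(ar l)) (i : 'I_(ar l)) (s : 'S_(ar m))
    (p q r : int) (d : p + q = r) (a : Q l p) (b : Q m q),
    t_fun e i d (op_act Q t p a) (op_act Q s q b) =
    gm_act X (block_perm e t i s) r (t_fun e (t i) d a b);
  t_assoc : forall (l m c lm mc : I)
    (e1 : (ar l + ar m = (ar lm).+1)%N) (e2 : (ar lm + ar c = (ar n).+1)%N)
    (e3 : (ar m + ar c = (ar mc).+1)%N) (e4 : (ar l + ar mc = (ar n).+1)%N)
    (j : 'I_(ar l)) (i : 'I_(ar m)) (ji : 'I_(ar lm)),
    ji = (j + i)%N :> nat ->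
    forall (p q r pq qr pqr : int) (d1 : p + q = pq) (d2 : pq + r = pqr)
      (d3 : q + r = qr) (d4 : p + qr = pqr)
      (a : Q l p) (b : Q m q) (c : Q c r),
    t_fun e2 ji d2 (bm_fun (op_comp Q e1 j) d1 a b) c =
    t_fun e4 j d4 a (bm_fun (op_comp Q e3 i) d3 b c);
  t_comm : forall (l m c lm lc : I)
    (e1 : (ar l + ar m = (ar lm).+1)%N) (e2 : (ar lm + ar c = (ar n).+1)%N)
    (e3 : (ar l + ar c = (ar lc).+1)%N) (e4 : (ar lc + ar m = (ar n).+1)%N)
    (i j : 'I_(ar l)) (i' : 'I_(ar lm)) (j' : 'I_(ar lc)),
    (i < j)%N -> i' = i :> nat -> j'.+1 = (j + ar c)%N ->
    forall (p q r pq pr pqr : int) (d1 : p + q = pq) (d2 : pq + r = pqr)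
      (d3 : p + r = pr) (d4 : pr + q = pqr)
      (a : Q l p) (b : Q m q) (c : Q c r),
    t_fun e2 i' d2 (bm_fun (op_comp Q e1 j) d1 a b) c =
    (-1) ^+ (`|q| * `|r|)%N *:
      t_fun e4 j' d4 (bm_fun (op_comp Q e3 i) d3 a c) b }.

(* The decomposable part of Q(n) is freely generated by the lower arities, and *)
(* is a direct summand as a graded Sigma-module.                              *)
Definition cofibrant_at (Q : operad_on k ar) (n : I) : Prop :=
  forall (X : gmod k (ar n)) (T : test Q X),
  exists h : forall p, {linear Q n p -> X p},
    (forall s p x, h p (op_act Q s p x) = gm_act X s p (h p x)) /\
    (forall l m (e : (ar l + ar m = (ar n).+1)%N) i p q r (d : p + q = r) a b,
       h r (bm_fun (op_comp Q e i) d a b) = t_fun T e i d a b).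

Definition is_bichain (Q : operad_on k ar) (n : I) (C : scomplex k (ar n))
    (T : test Q (sc_gmod C)) : Prop :=
  forall l m (e : (ar l + ar m = (ar n).+1)%N) (i : 'I_(ar l)) (p q r p' q' r' : int)
    (d : p + q = r) (el : p' + q = r') (er : p + q' = r')
    (ep : p = p' + 1) (eq : q = q' + 1) (e' : r = r' + 1) a b,
    cx_d C e' (t_fun T e i d a b) =
      t_fun T e i el (cx_d (Q l) ep a) b
      + (-1) ^+ `|p|%N *: t_fun T e i er a (cx_d (Q m) eq b).

Section ExtendMap.
Hypothesis char_k : [pchar k] =i pred0.
Variables (Q : operad_on k ar) (n : I) (T S : scomplex k (ar n)).
Hypothesis Qn : cofibrant_at Q n.
Variables (f : chain_map T S) (g : chain_map (Q n) S) (mu : test Q (sc_gmod T)).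
Hypothesis fE : forall s p x, f p (sc_act T s p x) = sc_act S s p (f p x).
Hypothesis gE : forall s p x, g p (op_act Q s p x) = sc_act S s p (g p x).
Hypothesis f_surj : forall p y, exists x, f p x = y.
Hypothesis f_qi : quasi_iso f.
Hypothesis mu_bi : is_bichain mu.
Hypothesis mu_g : forall l m (e : (ar l + ar m = (ar n).+1)%N) i p q r (d : p + q = r) a b,
  f r (t_fun mu e i d a b) = g r (bm_fun (op_comp Q e i) d a b).

(** Cofibrancy extends [mu] to some [h]. Adding an equivariant section of [f] applied to [g - f h]
    corrects the image under [f], and this correction vanishes on compositions, where [f mu] already
    agrees with [g]. *)
Lemma extend_graded : exists e1 : forall p, {linear Q n p -> T p},
  [/\ forall s p x, e1 p (op_act Q s p x) = sc_act T s p (e1 p x),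
      forall p x, f p (e1 p x) = g p x
    & forall l m (e : (ar l + ar m = (ar n).+1)%N) i p q r (d : p + q = r) a b,
       e1 r (bm_fun (op_comp Q e i) d a b) = t_fun mu e i d a b].
Proof.
have [h [hE hM]] := Qn mu.
have /dep_choice[sg sgP] : forall p, exists g : {linear S p -> T p},
    (forall s x, g (sc_act S s p x) = sc_act T s p (g x)) /\
    (forall x, f p (g x) = x).
  move=> p; have [||||g' [g'E g'P]] := @equivariant_regular k char_k _ _ _
    (fun t => sc_act T t p) (fun t => sc_act S t p) _ _ _ (f p).
  - by move=> s t x; rewrite sc_actM.
  - by move=> x; rewrite sc_act1.
  - by move=> s t x; rewrite sc_actM.
  - by move=> s x; rewrite fE.
  by exists g'; split=> // x; have [y <-] := f_surj x; exact: g'P.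
have hL p : linear (fun x => h p x + sg p (g p x - f p (h p x))).
  move=> a u v; rewrite (linearP (h p)) (linearP (g p)) (linearP (f p)).
  rewrite opprD addrACA -scalerBr (linearP (sg p)) addrACA -scalerDr.
  exact: erefl.
exists (fun p => mkLin (hL p)); split=> [s p x|p x|l m e i p q r d a b]; rewrite !mkLinE.
- by rewrite hE gE fE -linearB (sgP p).1 (linearD (sc_act T s p)).
- by rewrite linearD (sgP p).2 addrC subrK.
- by rewrite hM mu_g subrr linear0 addr0.
Qed.

(** The defect [d e1 - e1 d] of the graded extension takes values in the kernel of [f] and vanishes
    on compositions. The kernel is acyclic because [f] is a surjective quasi-isomorphism, and it
    contracts equivariantly. Subtracting the contracted defect yields a chain map with the same
    values on compositions and the same composite with [f]. *)
Lemma extend_map : exists F : chain_map (Q n) T,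
  [/\ forall s p x, F p (op_act Q s p x) = sc_act T s p (F p x),
      forall p x, f p (F p x) = g p x
    & forall l m (e : (ar l + ar m = (ar n).+1)%N) i p q r (d : p + q = r) a b,
       F r (bm_fun (op_comp Q e i) d a b) = t_fun mu e i d a b].
Proof.
have [e1 [e1E e1f e1M]] := extend_graded.
have : forall pq : int * int, exists L : {linear T pq.2 -> T pq.1},
    (forall s y, L (sc_act T s _ y) = sc_act T s _ (L y)) /\
    (forall (e : pq.1 = pq.2 + 1) c, f _ c = 0 ->
        (forall o (e' : pq.2 = o + 1), cx_d T e' c = 0) ->
        f _ (L c) = 0 /\ cx_d T e (L c) = c).
  move=> [p q] /=; have [e|ne] := eqVneq p (q + 1); last first.
    by exists \0; split=> [t y|e]; [rewrite linear0 | rewrite e eqxx in ne].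
  (* A regular inverse of [x |-> (f x, d x)] sends [(0, c)] to a primitive of [c] inside the kernel
     of [f] whenever there is one. *)
  pose Psi (x : T p) : (S p * T q)%type := (f p x, cx_d T e x).
  have PsiL : linear Psi by move=> a u v; rewrite /Psi !linearP.
  pose aW (s : 'S_(ar n)) (x : (S p * T q)%type) : (S p * T q)%type :=
    (sc_act S s p x.1, sc_act T s q x.2).
  have aWL s : linear (aW s) by move=> a u v; rewrite /aW !linearP.
  have [||||L [LE LP]] := @equivariant_regular k char_k _ _ _
    (fun t => sc_act T t p) (fun t => mkLin (aWL t)) _ _ _ (mkLin PsiL).
  - by move=> s t x; rewrite sc_actM.
  - by move=> x; rewrite mkLinE /aW !sc_act1; case: x.
  - by move=> s t x; rewrite !mkLinE /aW !sc_actM.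
  - by move=> s x; rewrite !mkLinE /Psi /aW fE cm_d.
  have L0L : linear (fun y : T q => L (0, y)).
    move=> a u v; rewrite -linearP; congr (L _).
    by rewrite -[RHS]/(a *: 0 + 0 : S p, a *: u + v : T q) scaler0 addr0.
  exists (mkLin L0L); split=> [s y|e' c fc dc].
    rewrite !mkLinE -LE; congr (L _); rewrite mkLinE /aW /=; congr (_, _).
    by rewrite linear0.
  subst p; rewrite mkLinE.
  have s0 : cx_d S (erefl (q + 1)) 0 = f q c by rewrite linear0 fc.
  have [x [fx dx]] := surjective_quasi_iso_lift f_surj f_qi dc s0.
  have := LP x; rewrite !mkLinE /Psi fx (eq_irrelevance e' erefl) dx => -[-> ->].
  by [].
move=> /dep_choice[K0 K0P].
pose K p q : {linear T q -> T p} := K0 (p, q).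
have KE p q s y : K p q (sc_act T s _ y) = sc_act T s _ (K p q y).
  exact: (K0P (p, q)).1.
have KP (p q : int) (e : p = q + 1) c : f _ c = 0 ->
    (forall o (e' : q = o + 1), cx_d T e' c = 0) ->
    f _ (K p q c) = 0 /\ cx_d T e (K p q c) = c.
  by move=> fc dc; exact: (K0P (p, q)).2.
pose e0 (p : int) : p = p - 1 + 1 := esym (subrK 1 p).
pose de p x := cx_d T (e0 p) (e1 p x) - e1 (p - 1) (cx_d (Q n) (e0 p) x).
have deL p a u v : de p (a *: u + v) = a *: de p u + de p v.
  rewrite /de (linearP (e1 p)) !(linearP (cx_d _ _)) (linearP (e1 (p - 1))).
  by rewrite opprD addrACA -scalerBr.
(* On the kernel of [f] this is a contraction: [d (ka t) = t - K (d t)] while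
   [ka (d t) = K (d t)]. *)
pose ka p (t : T (p - 1)) : T p :=
  K p (p - 1) (t - K (p - 1) (p - 1 - 1) (cx_d T (e0 (p - 1)) t)).
have kaL p a u v : ka p (a *: u + v) = a *: ka p u + ka p v.
  rewrite /ka -linearP; congr (K _ _ _).
  by rewrite (linearP (cx_d _ _)) (linearP (K _ _)) opprD addrACA -scalerBr.
have FL p : linear (fun x => e1 p x - ka p (de p x)).
  move=> a u v; rewrite (linearP (e1 p)) deL kaL opprD addrACA -scalerBr.
  by [].
have fde p x : f _ (de p x) = 0.
  by rewrite /de linearB -cm_d !e1f cm_d subrr.
have dde p x : cx_d T (e0 (p - 1)) (de p x) =
    - cx_d T (e0 (p - 1)) (e1 _ (cx_d (Q n) (e0 p) x)).
  by rewrite /de linearB dd0 sub0r.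
have fdde p x : f _ (cx_d T (e0 (p - 1)) (de p x)) = 0.
  by rewrite -cm_d fde linear0.
have kad p x : f _ (ka p (de p x)) = 0 /\ cx_d T (e0 p) (ka p (de p x)) =
    de p x - K (p - 1) (p - 1 - 1) (cx_d T (e0 (p - 1)) (de p x)).
  have [|f1 d1] := KP _ _ (e0 (p - 1)) (cx_d T (e0 (p - 1)) (de p x)) (fdde p x).
    by move=> o e'; rewrite dd0.
  apply: KP; first by rewrite linearB fde f1 subrr.
  move=> o e'; have oE : o = p - 1 - 1 by rewrite e' addrK.
  by subst o; rewrite (eq_irrelevance e' (e0 (p - 1))) linearB d1 subrr.
unshelve eexists.
  exists (fun p => mkLin (FL p)).
  move=> p q e x; have qE : q = p - 1 by rewrite e addrK.
  subst q; rewrite (eq_irrelevance e (e0 p)) !mkLinE linearB (kad p x).2.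
  have -> : cx_d T (e0 p) (e1 p x) = de p x + e1 _ (cx_d (Q n) (e0 p) x).
    by rewrite /de subrK.
  rewrite addKBC; congr (_ + _); rewrite dde linearN; congr (- _).
  have deE : de (p - 1) (cx_d (Q n) (e0 p) x) =
      cx_d T (e0 (p - 1)) (e1 _ (cx_d (Q n) (e0 p) x)).
    by rewrite /de dd0 linear0 subr0.
  by rewrite /ka deE dd0 linear0 subr0.
have deE s p x : de p (op_act Q s p x) = sc_act T s _ (de p x).
  by rewrite /de e1E !cm_d e1E linearB.
split=> [s p x|p x|l m e i p q r d a b]; rewrite !mkLinE.
- by rewrite e1E deE /ka cm_d KE -(linearB (sc_act T s _)) KE (linearB (sc_act T s p)).
- by rewrite (linearB (f p)) (kad p x).1 subr0 e1f.
- suff -> : de r (bm_fun (op_comp Q e i) d a b) = 0.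
    by rewrite e1M /ka linear0 linear0 subr0 linear0 subr0.
  have el : p - 1 + q = r - 1 by lia.
  have er : p + (q - 1) = r - 1 by lia.
  rewrite /de e1M (mu_bi e i d el er (e0 p) (e0 q) (e0 r)).
  rewrite (bm_d _ d el er (e0 p) (e0 q) (e0 r)) (linearD (e1 _)) linearZ /= !e1M.
  by rewrite subrr.
Qed.
End ExtendMap.
End Cofibrancy.

Section Lifting.
Variables (k : fieldType) (I : Type) (ar : I -> nat).
Hypothesis char_k : [pchar k] =i pred0.
Variables (B : nat) (ar_bound : forall l, (ar l < B)%N) (ar_pos : forall l, (0 < ar l)%N).
Variables (Q R S : operad_on k ar).
Hypothesis Qcof : forall n, cofibrant_at Q n.
Hypothesis Q1 : forall l, ar l = 1%N -> forall p (x : Q l p), x = 0.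
Variable f : operad_mor R S.
Hypothesis f_surj : forall l p y, exists x, f l p x = y.
Hypothesis f_we : weak_equivalence f.

Lemma zero_or_big l p (x : Q l p) : x = 0 \/ (1 < ar l)%N.
Proof.
by have := ar_pos l; case E : (ar l) => [|[|a]] // _; [left; exact: Q1 | right].
Qed.

(** As [Q(1) = 0], nonzero elements have arity at least 2, so composing them strictly raises the
    arity. This makes induction on the arity possible. *)
Lemma small_arity l m n (e : (ar l + ar m = (ar n).+1)%N) p q (a : Q l p) (b : Q m q) :
  (ar l < ar n)%N /\ (ar m < ar n)%N \/ a = 0 \/ b = 0.
Proof.
have [->|l1] := zero_or_big a; first by right; left.
have [->|m1] := zero_or_big b; first by right; right.
by left; lia.
Qed.

Section Induction.
Variable mu : (forall l, chain_map (Q l) (R l)) ->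
  forall l m n (e : (ar l + ar m = (ar n).+1)%N) (i : 'I_(ar l)) (p q r : int)
    (d : p + q = r), Q l p -> Q m q -> R n r.
Hypothesis mu_local : forall (F F' : forall l, chain_map (Q l) (R l)) l m n e i p q r d a b,
  (forall p x, F l p x = F' l p x) -> (forall p x, F m p x = F' m p x) ->
  @mu F l m n e i p q r d a b = @mu F' l m n e i p q r d a b.
Hypothesis mu0l : forall F l m n e i p q r d b, @mu F l m n e i p q r d 0 b = 0.
Hypothesis mu0r : forall F l m n e i p q r d a, @mu F l m n e i p q r d a 0 = 0.
Variable g : forall l, chain_map (Q l) (S l).
Hypothesis gE : forall l s p x, g l p (op_act Q s p x) = op_act S (l := l) s p (g l p x).

Let good N (F : forall l, chain_map (Q l) (R l)) :=
  [/\ forall l s p x, F l p (op_act Q s p x) = op_act R (l := l) s p (F l p x),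
      forall l p x, (ar l < N)%N -> f l p (F l p x) = g l p x
    & forall l m n (e : (ar l + ar m = (ar n).+1)%N) i p q r (d : p + q = r) a b,
      (ar n < N)%N -> F n r (bm_fun (op_comp Q e i) d a b) = mu F e i d a b].

Hypothesis step : forall n F, good (ar n) F -> exists T : test Q (sc_gmod (op_sc R n)),
  [/\ is_bichain T,
      forall l m e i p q r d a b, t_fun T e i d a b = @mu F l m n e i p q r d a b
    & forall l m (e : (ar l + ar m = (ar n).+1)%N) i p q r (d : p + q = r) a b,
       f n r (t_fun T e i d a b) = g n r (bm_fun (op_comp Q e i) d a b)].

(** In arity [N] the prescribed value [mu F] on compositions depends on [F] in smaller arities only,
    and [extend_map] extends it to the whole component. Leaving [mu] abstract covers both morphisms
    and derivations; the bound [B] on arities ends the induction. *)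
Lemma lift_by_arity : exists F : forall l, chain_map (Q l) (R l),
  [/\ forall l s p x, F l p (op_act Q s p x) = op_act R (l := l) s p (F l p x),
      forall l p x, f l p (F l p x) = g l p x
    & forall l m n (e : (ar l + ar m = (ar n).+1)%N) i p q r (d : p + q = r) a b,
      F n r (bm_fun (op_comp Q e i) d a b) = mu F e i d a b].
Proof.
suff H N : exists F, good N F.
  have [F [FE Ff FM]] := H B; exists F; split=> //.
    by move=> l p x; apply: Ff.
  by move=> l m n e i p q r d a b; apply: FM.
elim: N => [|N [F [FE Ff FM]]].
  exists (fun l => @ChainMap k (Q l) (R l) (fun p => \0) (fun p q e x => linear0 _)).
  by split=> // l s p x; rewrite /= linear0.
have : forall n, exists G : chain_map (Q n) (R n),
    [/\ ar n <> N -> forall p x, G p x = F n p x,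
        forall s p x, G p (op_act Q s p x) = op_act R s p (G p x)
      & ar n = N -> (forall p x, f n p (G p x) = g n p x) /\
         (forall l m (e : (ar l + ar m = (ar n).+1)%N) i p q r (d : p + q = r) a b,
           G r (bm_fun (op_comp Q e i) d a b) = mu F e i d a b)].
  move=> n; have [nN|nN] := eqVneq (ar n) N; last first.
    by exists (F n); split=> // nN'; rewrite nN' eqxx in nN.
  have [|T [Tbi Tmu Tg]] := @step n F.
    by split=> // [l p x|l m o e i p q r d a b]; rewrite nN; [exact: Ff | exact: FM].
  have [G [GE Gf GM]] := extend_map (T := op_sc R n) (S := op_sc S n) (f := f n) (g := g n) (mu := T)
    char_k (@Qcof n) (fun s p x => om_act f s x) (@gE n)
    (@f_surj n) (f_we n) Tbi Tg.
  exists G; split=> // _; split=> // l m e i p q r d a b.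
  by rewrite GM Tmu.
move=> /dep_choice[G GP].
have GF o : (ar o < N)%N -> forall p x, G o p x = F o p x.
  by move=> oN; have [H _ _] := GP o; apply: H => oN'; rewrite oN' ltnn in oN.
exists G; split.
- by move=> l s p x; have [_ -> _] := GP l.
- move=> l p x; rewrite ltnS leq_eqVlt => /orP[/eqP lN|lN].
    by have [_ _ /(_ lN)[-> _]] := GP l.
  by rewrite GF // Ff.
- move=> l m n e i p q r d a b; rewrite ltnS => nN.
  have [|[->|->]] := small_arity e a b; last 2 first.
  + by rewrite bm0l mu0l linear0.
  + by rewrite bm0r mu0r linear0.
  move=> [ln mn].
  have muE : mu G e i d a b = mu F e i d a b.
    by apply: mu_local; apply: GF; apply: leq_trans nN.
  rewrite muE; move: nN; rewrite leq_eqVlt => /orP[/eqP nN|nN].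
    by have [_ _ /(_ nN)[_ ->]] := GP n.
  by rewrite GF // FM.
Qed.

End Induction.

Lemma lift_morphism (g : operad_mor Q S) :
  exists F : operad_mor Q R, forall l p x, f l p (F l p x) = g l p x.
Proof.
have [|||||F [FE Ff FM]] := @lift_by_arity
  (fun F l m n e i p q r d a b => bm_fun (op_comp R e i) d (F l p a) (F m q b)) _ _ _ g.
- by move=> F F' l m n e i p q r d a b -> ->.
- by move=> *; rewrite linear0 bm0l.
- by move=> *; rewrite linear0 bm0r.
- by move=> *; rewrite om_act.
- move=> n F [FE Ff FM].
  unshelve eexists.
    exists (fun l m e i p q r d a b => bm_fun (op_comp R e i) d (F l p a) (F m q b)).
    + by move=> l m e i p q r d b a u v; rewrite linearP bm_linl.
    + by move=> l m e i p q r d a b u v; rewrite linearP bm_linr.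
    + by move=> l m e t i s p q r d a b; rewrite !FE op_equiv.
    + move=> l m c lm mc e1 e2 e3 e4 j i ji jiE p q r pq qr pqr d1 d2 d3 d4 a b x.
      have [->|a1] := zero_or_big a; first by rewrite !(bm0l, linear0).
      have [->|b1] := zero_or_big b; first by rewrite !(bm0l, bm0r, linear0).
      have [->|x1] := zero_or_big x; first by rewrite !(bm0r, linear0).
      by rewrite !FM ?(op_assoc e1 e2 e3 e4 jiE d1 d2 d3 d4) //; lia.
    + move=> l m c lm lc e1 e2 e3 e4 i j i' j' ij iE jE p q r pq pr pqr d1 d2 d3 d4 a b x.
      have [->|a1] := zero_or_big a; first by rewrite !(bm0l, linear0, scaler0, addr0).
      have [->|b1] := zero_or_big b; first by rewrite !(bm0l, bm0r, linear0, scaler0, addr0).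
      have [->|x1] := zero_or_big x; first by rewrite !(bm0l, bm0r, linear0, scaler0, addr0).
      by rewrite !FM ?(op_comm e1 e2 e3 e4 ij iE jE d1 d2 d3 d4) //; lia.
  split=> //.
  + move=> l m e i p q r p' q' r' d el er ep eq e' a b /=.
    by rewrite (bm_d _ _ el er ep eq) !cm_d.
  + move=> l m e i p q r d a b /=.
    have [|[->|->]] := small_arity e a b; last 2 first.
    * by rewrite !(bm0l, linear0).
    * by rewrite !(bm0r, linear0).
    by move=> [ln mn]; rewrite !om_comp !Ff.
unshelve eexists; first by exists F; [exact: FE | exact: FM].
exact: Ff.
Qed.

(** The Leibniz rule determines a derivation on compositions just as multiplicativity determines a
    morphism, so the same induction applies with [mu] the Leibniz expression along [j]. *)
Lemma lift_derivation (j : operad_mor Q R) (g : forall l, chain_map (Q l) (S l)) :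
  (forall l s p x, g l p (op_act Q s p x) = op_act S (l := l) s p (g l p x)) ->
  (forall l m n (e : (ar l + ar m = (ar n).+1)%N) i p q r (d : p + q = r) a b,
     g n r (bm_fun (op_comp Q e i) d a b) =
     bm_fun (op_comp S e i) d (g l p a) (f m q (j m q b))
     + bm_fun (op_comp S e i) d (f l p (j l p a)) (g m q b)) ->
  exists F : forall l, chain_map (Q l) (R l),
  [/\ forall l s p x, F l p (op_act Q s p x) = op_act R (l := l) s p (F l p x),
      forall l p x, f l p (F l p x) = g l p x
    & forall l m n (e : (ar l + ar m = (ar n).+1)%N) i p q r (d : p + q = r) a b,
      F n r (bm_fun (op_comp Q e i) d a b) =
      bm_fun (op_comp R e i) d (F l p a) (j m q b)
      + bm_fun (op_comp R e i) d (j l p a) (F m q b)].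
Proof.
move=> gE gM.
apply: (@lift_by_arity
  (fun F l m n e i p q r d a b => bm_fun (op_comp R e i) d (F l p a) (j m q b)
     + bm_fun (op_comp R e i) d (j l p a) (F m q b))) => //.
- by move=> F F' l m n e i p q r d a b -> ->.
- by move=> *; rewrite !linear0 !bm0l addr0.
- by move=> *; rewrite !linear0 !bm0r addr0.
- move=> n F [FE Ff FM].
  unshelve eexists.
    exists (fun l m e i p q r d a b => bm_fun (op_comp R e i) d (F l p a) (j m q b)
     + bm_fun (op_comp R e i) d (j l p a) (F m q b)).
    + move=> l m e i p q r d b a u v; rewrite (linearP (F _ _)) (linearP (j _ _)) !bm_linl.
      by rewrite addrACA -scalerDr.
    + move=> l m e i p q r d a b u v; rewrite (linearP (F _ _)) (linearP (j _ _)) !bm_linr.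
      by rewrite addrACA -scalerDr.
    + move=> l m e t i s p q r d a b; rewrite !FE !om_act !op_equiv.
      by rewrite -(linearD (op_act R _ _)).
    + move=> l m c lm mc e1 e2 e3 e4 j0 i ji jiE p q r pq qr pqr d1 d2 d3 d4 a b x.
      have [->|a1] := zero_or_big a; first by rewrite !(bm0l, linear0).
      have [->|b1] := zero_or_big b; first by rewrite !(bm0l, bm0r, linear0).
      have [->|x1] := zero_or_big x; first by rewrite !(bm0r, linear0).
      rewrite !FM ?om_comp ?bmDl ?bmDr; try by lia.
      by rewrite !(op_assoc e1 e2 e3 e4 jiE d1 d2 d3 d4) addrA.
    + move=> l m c lm lc e1 e2 e3 e4 i j0 i' j' ij iE jE p q r pq pr pqr d1 d2 d3 d4 a b x.
      have [->|a1] := zero_or_big a; first by rewrite !(bm0l, linear0, scaler0, addr0).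
      have [->|b1] := zero_or_big b; first by rewrite !(bm0l, bm0r, linear0, scaler0, addr0).
      have [->|x1] := zero_or_big x; first by rewrite !(bm0l, bm0r, linear0, scaler0, addr0).
      rewrite !FM ?om_comp ?bmDl ?bmDr; try by lia.
      rewrite !(op_comm e1 e2 e3 e4 ij iE jE d1 d2 d3 d4) -!scalerDr.
      congr ( _ *: _); exact: addrAC.
  split=> //.
  + move=> l m e i p q r p' q' r' d el er ep eq e' a b /=.
    rewrite linearD /= !(bm_d _ _ el er ep eq) !cm_d scalerDr.
    by rewrite addrACA.
  + move=> l m e i p q r d a b /=.
    have [|[->|->]] := small_arity e a b; last 2 first.
    * by rewrite !(bm0l, linear0, addr0).
    * by rewrite !(bm0r, linear0, addr0).
    by move=> [ln mn]; rewrite linearD !om_comp !Ff // gM.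
Qed.
End Lifting.

(** * Path objects *)

Section KoszulSigns.
Variable k : fieldType.

Definition sgn (p : int) : k := (-1) ^+ `|p|%N.

Lemma sgnE p : sgn p = (-1) ^ p.
Proof. by case: p => n //; rewrite -[RHS]/(((-1) ^+ n.+1)^-1) invr_sign. Qed.

Lemma sgnD (p q : int) : sgn (p + q) = sgn p * sgn q.
Proof. by rewrite !sgnE expfzDr // oppr_eq0 oner_eq0. Qed.

Lemma sgn1 : sgn 1 = -1.
Proof. by []. Qed.

Lemma sgnS (p : int) : sgn (p + 1) = - sgn p.
Proof. by rewrite sgnD sgn1 mulrN1. Qed.

Lemma sgn_sqr p : sgn p * sgn p = 1.
Proof. by rewrite /sgn -expr2 sqrr_sign. Qed.

Lemma sgn_mulS (p q : int) : (-1) ^+ (`|(p + 1)%R| * `|q|)%N = (-1) ^+ (`|p| * `|q|)%N * sgn q :> k.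
Proof. by rewrite !exprM -/(sgn (p + 1)) sgnS (exprNn (sgn p)) mulrC. Qed.

Lemma sgn_mulSr (p q : int) : (-1) ^+ (`|p| * `|(q + 1)%R|)%N = (-1) ^+ (`|p| * `|q|)%N * sgn p :> k.
Proof. by rewrite mulnC sgn_mulS mulnC. Qed.

End KoszulSigns.

Section Transport.
Variable k : fieldType.

(** Needed where terms in two provably equal degrees are added, as in the differential of
    [dt_cx]. *)
Definition tr (V : int -> lmodType k) (p q : int) (e : p = q) : {linear V p -> V q} :=
  match e with erefl => idfun end.

Lemma tr_id (V : int -> lmodType k) p (e : p = p) x : tr V e x = x.
Proof. by rewrite (eq_irrelevance e erefl). Qed.

Lemma tr_tr (V : int -> lmodType k) p q r (e : p = q) (e' : q = r) (e'' : p = r) x :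
  tr V e' (tr V e x) = tr V e'' x.
Proof. by subst q r; rewrite !tr_id. Qed.

Lemma tr_map (V W : int -> lmodType k) (F : forall p, V p -> W p) p q (e : p = q) x :
  tr W e (F p x) = F q (tr V e x).
Proof. by subst q. Qed.

Lemma cx_d_tr (C : complex k) p p' q (e : p = p') (e1 : p' = q + 1) (e2 : p = q + 1) x :
  cx_d C e1 (tr C e x) = cx_d C e2 x.
Proof. by subst p'; rewrite tr_id (eq_irrelevance e1 e2). Qed.

Lemma bm_irr (A B C : complex k) (M : bichain_map A B C) p q r (d d' : p + q = r) a b :
  bm_fun M d a b = bm_fun M d' a b.
Proof. by rewrite (eq_irrelevance d d'). Qed.

Lemma tr_bm (A B C : complex k) (M : bichain_map A B C) p q r r' (e : r = r')
    (d : p + q = r) (d' : p + q = r') a b :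
  tr C e (bm_fun M d a b) = bm_fun M d' a b.
Proof. by subst r'; rewrite tr_id (eq_irrelevance d d'). Qed.

Lemma bm_trl (A B C : complex k) (M : bichain_map A B C) p p' q r (e : p = p')
    (d : p' + q = r) (d' : p + q = r) a b :
  bm_fun M d (tr A e a) b = bm_fun M d' a b.
Proof. by subst p'; rewrite tr_id (eq_irrelevance d d'). Qed.

Lemma bm_trr (A B C : complex k) (M : bichain_map A B C) p q q' r (e : q = q')
    (d : p + q' = r) (d' : p + q = r) a b :
  bm_fun M d a (tr B e b) = bm_fun M d' a b.
Proof. by subst q'; rewrite tr_id (eq_irrelevance d d'). Qed.

Lemma bmZl (A B C : complex k) (M : bichain_map A B C) p q r (d : p + q = r) c a b :
  bm_fun M d (c *: a) b = c *: bm_fun M d a b.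
Proof. by have := bm_linl M d b c a 0; rewrite /= addr0 bm0l addr0. Qed.

Lemma bmZr (A B C : complex k) (M : bichain_map A B C) p q r (d : p + q = r) c a b :
  bm_fun M d a (c *: b) = c *: bm_fun M d a b.
Proof. by have := bm_linr M d a c b 0; rewrite /= addr0 bm0r addr0. Qed.

End Transport.

(** The bookkeeping of Koszul signs in the [dt] component of the Leibniz rule for [dt_comp]. *)
Lemma leibniz_rearrange (k : fieldType) (V : lmodType k) (s t : k) (x1 x2 x3 x4 x5 x6 : V) :
  x1 + s *: x2 + - t *: (x3 + - s *: x4) + (s * - t) *: (x5 + x6) =
  x1 + - t *: (x3 + s *: x5) + s *: (x2 + - t *: x6 + t *: x4).
Proof.
rewrite !scalerDr !scalerA mulrNN [- t * s]mulrC [t * s]mulrC !addrA.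
by rewrite [LHS](ACl (1*3*5*2*6*4))%AC.
Qed.

Section DtExtension.
Variables (k : fieldType) (I : Type) (ar : I -> nat) (A : operad_on k ar).
Variable dl : forall l p, {linear A l p -> A l p}.
Hypothesis dl_d : forall l p q (e : p = q + 1) x, cx_d (A l) e (dl l p x) = dl l q (cx_d (A l) e x).
Hypothesis dl_act : forall l s p x, dl l p (op_act A s p x) = op_act A (l := l) s p (dl l p x).
Hypothesis dl_comp : forall l m n (e : (ar l + ar m = (ar n).+1)%N) i p q r (d : p + q = r) a b,
  dl n r (bm_fun (op_comp A e i) d a b) =
  bm_fun (op_comp A e i) d (dl l p a) b + bm_fun (op_comp A e i) d a (dl m q b).

Definition dt_mod (l : I) (p : int) : lmodType k := (A l p * A l (p + 1)%R)%type.

Let dd l (p q : int) (e : p = q + 1) (x : dt_mod l p) : dt_mod l q :=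
  (cx_d (A l) e x.1,
   cx_d (A l) (congr1 (fun z => z + 1) e) x.2 + sgn k p *: tr (A l) e (dl l p x.1)).

Let dd_linear l p q e : linear (@dd l p q e).
Proof.
move=> a u v; rewrite /dd /=; congr (_, _); first by rewrite linearP.
rewrite linearP (linearP (dl l p)) (linearP (tr _ _)) scalerDr scalerA mulrC -scalerA.
by rewrite addrACA -scalerDr.
Qed.

(* A (x) k[dt] with dt of degree -1 and d(a) = da + (-1)^|a| (dl a) dt; a pair *)
(* (a, b) stands for a + b dt.                                                *)
Definition dt_cx (l : I) : complex k.
Proof.
exists (dt_mod l) (fun p q e => mkLin (@dd_linear l p q e)).
move=> p q r e1 e2 [a b]; rewrite !mkLinE /dd /=; congr (_, _); first exact: cx_dd.
subst q p; rewrite !tr_id linearD dd0 add0r linearZ /= dl_d sgnS scaleNr addNr.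
by [].
Defined.

Let da l (s : 'S_(ar l)) p (x : dt_mod l p) : dt_mod l p :=
  (op_act A s p x.1, op_act A s _ x.2).
Let da_linear l s p : linear (@da l s p).
Proof. by move=> a u v; rewrite /da !linearP. Qed.

Definition dt_act (l : I) (s : 'S_(ar l)) : chain_map (dt_cx l) (dt_cx l).
Proof.
exists (fun p => mkLin (@da_linear l s p)).
move=> p q e [a b]; rewrite !mkLinE /da /dd /=; congr (_, _); first exact: cm_d.
by rewrite cm_d linearD linearZ /= dl_act -(tr_map (fun p => op_act A s p)).
Defined.

Let dm_deg_l (p q r : int) (d : p + q = r) : p + 1 + q = r + 1.
Proof. by lia. Qed.
Let dm_deg_r (p q r : int) (d : p + q = r) : p + (q + 1) = r + 1.
Proof. by lia. Qed.

(** The product [(a + a' dt) (b + b' dt)] with [dt dt = 0]; the sign comes from moving [dt], of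
    degree -1, past [b]. *)
Definition dt_mul l m n (e : (ar l + ar m = (ar n).+1)%N) (i : 'I_(ar l)) (p q r : int)
    (d : p + q = r) (x : dt_mod l p) (y : dt_mod m q) : dt_mod n r :=
  (bm_fun (op_comp A e i) d x.1 y.1,
   bm_fun (op_comp A e i) (dm_deg_r d) x.1 y.2
   + sgn k q *: bm_fun (op_comp A e i) (dm_deg_l d) x.2 y.1).

Definition dt_comp l m n (e : (ar l + ar m = (ar n).+1)%N) (i : 'I_(ar l)) :
  bichain_map (dt_cx l) (dt_cx m) (dt_cx n).
Proof.
exists (@dt_mul l m n e i).
- move=> p q r d y a u v; rewrite /dt_mul /=; congr (_, _); first exact: bm_linl.
  by rewrite !bm_linl /= scalerDr scalerDr addrACA !scalerA [_ * a]mulrC.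
- move=> p q r d x a u v; rewrite /dt_mul /=; congr (_, _); first exact: bm_linr.
  by rewrite !bm_linr /= scalerDr scalerDr addrACA !scalerA [_ * a]mulrC.
- move=> p q r p' q' r' d el er ep eq e' [a a'] [b b'].
  rewrite !mkLinE /dt_mul /dd /=; congr (_, _); first exact: bm_d.
  rewrite linearD linearZ /=.
  have ep1 := congr1 (fun z => z + 1) ep; have eq1 := congr1 (fun z => z + 1) eq.
  have d1 : p' + (q + 1) = r' + 1 by lia.
  have d2 : p + (q' + 1) = r' + 1 by lia.
  have d3 : p' + 1 + q = r' + 1 by lia.
  have d4 : p + 1 + q' = r' + 1 by lia.
  have d5 : p + q = r' + 1 by lia.
  rewrite (bm_d _ _ d1 d2 ep eq1) (bm_d _ _ d3 d4 ep1 eq) dl_comp (linearD (tr _ _)) !(tr_bm _ _ _ d5).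
  rewrite !bmDl !bmDr !bmZl !bmZr !(bm_trl _ _ _ d5) !(bm_trr _ _ _ d5).
  rewrite (bm_irr _ (dm_deg_r el) d1) (bm_irr _ (dm_deg_l el) d3).
  rewrite (bm_irr _ (dm_deg_r er) d2) (bm_irr _ (dm_deg_l er) d4).
  rewrite (eq_irrelevance (congr1 _ ep) ep1) (eq_irrelevance (congr1 _ eq) eq1).
  rewrite -!/(sgn k _) sgnS.
  have -> : sgn k q = - sgn k q' by rewrite eq sgnS.
  have -> : sgn k r = sgn k p * - sgn k q' by rewrite -d sgnD eq sgnS.
  exact: leibniz_rearrange.
Defined.
Definition dtop : operad_on k ar.
Proof.
exists dt_cx dt_act dt_comp.
- by move=> l p [a b]; rewrite /= /da /= !op_act1.
- by move=> l s t p [a b]; rewrite /= /da /= !op_actM.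
- move=> l m n e t i s p q r d [a a'] [b b'].
  rewrite /= /da /dt_mul /=; congr (_, _); first exact: op_equiv.
  by rewrite linearD linearZ /= !op_equiv.
- move=> l m n lm mn lmn e1 e2 e3 e4 j i ji jiE p q r pq qr pqr d1 d2 d3 d4.
  move=> [a a'] [b b'] [c c']; rewrite /= /dt_mul /=; congr (_, _); first exact: op_assoc.
  rewrite !bmDl !bmDr !bmZl !bmZr.
  rewrite (op_assoc e1 e2 e3 e4 jiE d1 (dm_deg_r d2) (dm_deg_r d3) (dm_deg_r d4)).
  rewrite (op_assoc e1 e2 e3 e4 jiE (dm_deg_r d1) (dm_deg_l d2) (dm_deg_l d3) (dm_deg_r d4)).
  rewrite (op_assoc e1 e2 e3 e4 jiE (dm_deg_l d1) (dm_deg_l d2) d3 (dm_deg_l d4)).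
  have -> : sgn k qr = sgn k r * sgn k q by rewrite -d3 sgnD mulrC.
  by rewrite scalerDr scalerA !addrA.
- move=> l m n lm ln lmn e1 e2 e3 e4 i j i' j' ij iE jE p q r pq pr pqr d1 d2 d3 d4.
  move=> [a a'] [b b'] [c c']; rewrite /= /dt_mul /=; congr (_, _); first exact: op_comm.
  rewrite !bmDl !bmZl -[RHS]/(_ *: (_ + _ : A lmn (pqr + 1)%R)).
  rewrite (op_comm e1 e2 e3 e4 ij iE jE d1 (dm_deg_r d2) (dm_deg_r d3) (dm_deg_l d4)).
  rewrite (op_comm e1 e2 e3 e4 ij iE jE (dm_deg_r d1) (dm_deg_l d2) d3 (dm_deg_r d4)).
  rewrite (op_comm e1 e2 e3 e4 ij iE jE (dm_deg_l d1) (dm_deg_l d2) (dm_deg_l d3) (dm_deg_l d4)).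
  rewrite sgn_mulS sgn_mulSr !scalerDr !scalerA.
  by rewrite mulrCA sgn_sqr mulr1 addrCA; congr (_ + _); congr (_ + _);
    congr (_ *: _); rewrite mulrC mulrAC mulrA.
Defined.

Lemma dt_d2 l p q (e : p = q + 1) (x : dtop l p) : (cx_d (dtop l) e x).2 =
  cx_d (A l) (congr1 (fun z => z + 1) e) x.2 + sgn k p *: tr (A l) e (dl l p x.1).
Proof. by []. Qed.

Definition dt_fst : operad_mor dtop A.
Proof.
unshelve eexists.
- move=> l; exists (fun p => mkLin (f := fun x : dt_mod l p => x.1) (fun a u v => erefl)).
  by [].
- by [].
- by [].
Defined.

End DtExtension.

(** * Polynomial functions with values in a vector space *)

Section PolynomialFunctions.
Variables (k : fieldType).
Hypothesis char_k : [pchar k] =i pred0.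

Section OneModule.
Variable V : lmodType k.
Implicit Type s : seq (nat * V).

(** A polynomial is given by a list of monomials, each an exponent with a coefficient; exponents may
    repeat. *)
Definition pev s (t : k) : V := \sum_(x <- s) t ^+ x.1 *: x.2.
Definition pdev s (t : k) : V := \sum_(x <- s) (t ^+ x.1.-1 *+ x.1) *: x.2.
Definition pcoef s (j : nat) : V := \sum_(x <- s | x.1 == j) x.2.

Lemma psum_coef s (w : nat -> k) (N : nat) : (forall x, x \in s -> x.1 < N)%N ->
  \sum_(x <- s) w x.1 *: x.2 = \sum_(j < N) w j *: pcoef s j.
Proof.
move=> sN; under [RHS]eq_bigr => j _ do rewrite scaler_sumr.
rewrite (exchange_big_dep xpredT) //= big_seq [RHS]big_seq; apply: eq_bigr => x xs.
by rewrite (big_pred1 (Ordinal (sN _ xs))).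
Qed.

Lemma pbound s : exists N, (forall x, x \in s -> x.1 < N)%N.
Proof.
exists (\max_(x <- s) x.1).+1 => x xs; rewrite ltnS.
by rewrite (big_rem x) //= leq_maxl.
Qed.

(* Replacing t by 2t and subtracting 2^N times the relation removes the top   *)
(* coefficient.                                                               *)
Lemma pcoef_eq0 N (c : nat -> V) :
  (forall t, \sum_(i < N) t ^+ i *: c i = 0) -> forall i, (i < N)%N -> c i = 0.
Proof.
elim: N c => [|N IH] c c0 // i; rewrite ltnS => iN.
have H j : (j < N)%N -> c j = 0.
  move=> jN; have : (2 ^+ j - 2 ^+ N) *: c j = 0.
    apply: (IH (fun j => (2 ^+ j - 2 ^+ N) *: c j)) jN => t.
    transitivity (\sum_(i < N.+1) (2 * t) ^+ i *: c i
        - 2 ^+ N *: \sum_(i < N.+1) t ^+ i *: c i); last by rewrite !c0 scaler0 subrr.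
    rewrite scaler_sumr -sumrB big_ord_recr /= scalerA exprMn subrr addr0.
    apply: eq_bigr => m _; rewrite !scalerA -scalerBl; congr (_ *: _).
    by rewrite mulrBr exprMn mulrC [2 ^+ N * _]mulrC.
  move/eqP; rewrite scaler_eq0 => /orP[|/eqP //].
  rewrite subr_eq0 => /eqP E; exfalso.
  have /eqP : (2 ^ N - 2 ^ j)%N%:R = 0 :> k.
    by rewrite natrB ?leq_exp2l ?(ltnW jN) // !natrX E subrr.
  rewrite (pcharf0P k).1 // subn_eq0 leq_exp2l // => /(leq_trans jN).
  by rewrite ltnn.
have [->|iN'] := eqVneq i N; last by apply: H; rewrite ltn_neqAle iN' iN.
have := c0 1; rewrite big_ord_recr /= expr1n scale1r big1 ?add0r // => j _.
by rewrite H ?scaler0.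
Qed.

Lemma pev0_coef s : (forall t, pev s t = 0) -> forall j, pcoef s j = 0.
Proof.
move=> s0 j; have [N sN] := pbound s.
have [jN|Nj] := ltnP j N; last first.
  rewrite /pcoef big_seq_cond big1 // => x /andP[/sN xN /eqP xj].
  by rewrite xj ltnNge Nj in xN.
apply: (pcoef_eq0 (N := N)) => // t.
by rewrite -(psum_coef (fun j => t ^+ j) sN) -[RHS](s0 t).
Qed.

(** In characteristic zero a polynomial that vanishes as a function has zero coefficients. Hence
    differentiation is well defined on polynomial functions. *)
Lemma pev0_pdev0 s : (forall t, pev s t = 0) -> forall t, pdev s t = 0.
Proof.
move=> /pev0_coef s0 t; have [N sN] := pbound s.
rewrite /pdev (psum_coef (fun j => t ^+ j.-1 *+ j) sN) big1 // => j _.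
by rewrite s0 scaler0.
Qed.

Lemma pdev0_const s : (forall t, pdev s t = 0) -> forall t, pev s t = pev s 0.
Proof.
move=> s0; have [N sN] := pbound s.
have sN1 x : x \in s -> (x.1 < N.+1)%N by move=> /sN /ltnW.
have c0 j : (j < N)%N -> pcoef s j.+1 = 0.
  move=> jN; have : j.+1%:R *: pcoef s j.+1 = 0.
    apply: (pcoef_eq0 (c := fun j => j.+1%:R *: pcoef s j.+1)) jN => t.
    rewrite -[RHS](s0 t) /pdev (psum_coef (fun j => t ^+ j.-1 *+ j) sN1).
    rewrite big_ord_recl /= mulr0n scale0r add0r; apply: eq_bigr => i _.
    by rewrite scalerA mulr_natr.
  move/eqP; rewrite scaler_eq0 => /orP[|/eqP //].
  by rewrite (pcharf0P k).1.
move=> t; rewrite /pev !(psum_coef (fun j => _ ^+ j) sN1) !big_ord_recl !expr0.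
by congr (_ + _); rewrite !big1 // => i _; rewrite c0 ?scaler0 //=.
Qed.

Lemma pev_cat s1 s2 t : pev (s1 ++ s2) t = pev s1 t + pev s2 t.
Proof. exact: big_cat. Qed.
Lemma pdev_cat s1 s2 t : pdev (s1 ++ s2) t = pdev s1 t + pdev s2 t.
Proof. exact: big_cat. Qed.

End OneModule.

Definition pmap V W (f : V -> W) (s : seq (nat * V)) : seq (nat * W) :=
  [seq (x.1, f x.2) | x <- s].

Lemma pev_map (V W : lmodType k) (f : V -> W) (fL : linear f) s t :
  pev (pmap f s) t = f (pev s t).
Proof.
rewrite /pev big_map -[f _]/(mkLin fL _) linear_sum; apply: eq_bigr => x _.
by rewrite linearZ.
Qed.
Lemma pdev_map (V W : lmodType k) (f : V -> W) (fL : linear f) s t :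
  pdev (pmap f s) t = f (pdev s t).
Proof.
rewrite /pdev big_map -[f _]/(mkLin fL _) linear_sum; apply: eq_bigr => x _.
by rewrite linearZ.
Qed.

(** Repeating the monomial of exponent [j - 1] exactly [j] times plays the role of the factor
    [j]. *)
Definition pder V (s : seq (nat * V)) : seq (nat * V) :=
  [seq (x.1.-1, x.2) | x <- flatten [seq nseq x.1 x | x <- s]].
Lemma pev_der (V : lmodType k) (s : seq (nat * V)) t : pev (pder s) t = pdev s t.
Proof.
rewrite /pev /pder big_map big_flatten big_map; apply: eq_bigr => x _.
by rewrite big_nseq iter_addr_0 -scaler_nat scalerA mulr_natl.
Qed.

Definition pint (V : lmodType k) (s : seq (nat * V)) : seq (nat * V) :=
  [seq (x.1.+1, x.1.+1%:R^-1 *: x.2) | x <- s].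
Lemma pdev_int (V : lmodType k) (s : seq (nat * V)) t : pdev (pint s) t = pev s t.
Proof.
rewrite /pdev big_map; apply: eq_bigr => x _ /=.
by rewrite scalerA -mulr_natr -mulrA mulfV ?mulr1 // (pcharf0P k).1.
Qed.
Lemma pev_int0 (V : lmodType k) (s : seq (nat * V)) : pev (pint s) 0 = 0.
Proof. by rewrite /pev big_map big1 // => x _; rewrite expr0n scale0r. Qed.

Definition pmul U V W (m : U -> V -> W) (s : seq (nat * U)) (s' : seq (nat * V)) :
    seq (nat * W) :=
  [seq ((x.1 + y.1)%N, m x.2 y.2) | x <- s, y <- s'].

Section Products.
Variables (U V W : lmodType k) (m : U -> V -> W).
Hypothesis mL : forall v, linear (m^~ v).
Hypothesis mR : forall u, linear (m u).

Lemma pmul_sum (w1 w2 : nat -> k) (s : seq (nat * U)) (s' : seq (nat * V)) :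
  m (\sum_(x <- s) w1 x.1 *: x.2) (\sum_(y <- s') w2 y.1 *: y.2) =
  \sum_(x <- s) \sum_(y <- s') (w1 x.1 * w2 y.1) *: m x.2 y.2.
Proof.
rewrite -[LHS]/(mkLin (mL _) _) linear_sum; apply: eq_bigr => x _.
rewrite linearZ /= -[m _ _]/(mkLin (mR _) _) linear_sum scaler_sumr; apply: eq_bigr => y _.
by rewrite linearZ /= scalerA.
Qed.

Lemma pev_mul s s' t : pev (pmul m s s') t = m (pev s t) (pev s' t).
Proof.
rewrite /pev big_allpairs_dep (pmul_sum (fun i => t ^+ i) (fun i => t ^+ i)).
by apply: eq_bigr => x _; apply: eq_bigr => y _ /=; rewrite exprD.
Qed.

Lemma pdev_mul s s' t :
  pdev (pmul m s s') t = m (pdev s t) (pev s' t) + m (pev s t) (pdev s' t).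
Proof.
rewrite /pdev /pev big_allpairs_dep (pmul_sum (fun i => t ^+ i.-1 *+ i) (fun i => t ^+ i)).
rewrite (pmul_sum (fun i => t ^+ i) (fun i => t ^+ i.-1 *+ i)) -big_split /=.
apply: eq_bigr => x _; rewrite -big_split /=; apply: eq_bigr => y _ /=.
rewrite -scalerDl; congr (_ *: _); case: x => i u; case: y => j v /=.
rewrite mulrnAl mulrnAr mulrnDr; congr (_ + _).
  by case: i => [|i] //=; rewrite -exprD.
by case: j => [|j] //=; rewrite -exprD addnS.
Qed.
End Products.
End PolynomialFunctions.

Section PolynomialOperad.
Variables (k : fieldType) (char_k : [pchar k] =i pred0) (I : Type) (ar : I -> nat).
Variable S : operad_on k ar.

Let F : operad_on k ar := prodop (fun _ : k => S).

Definition is_poly l p (a : F l p) : Prop := exists s, forall t, a t = pev s t.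

Lemma is_poly0 l p : is_poly (0 : F l p).
Proof. by exists [::] => t; rewrite /pev big_nil. Qed.
Lemma is_polyL l p c (a b : F l p) : is_poly a -> is_poly b -> is_poly (c *: a + b).
Proof.
move=> [s sE] [s' s'E]; exists (pmap ( *:%R c) s ++ s') => t.
rewrite pev_cat pev_map -?sE -?s'E // => x u v.
by rewrite scalerDr !scalerA mulrC.
Qed.

Definition poly_sub l p : submodule (F l p) := Submodule (@is_poly0 l p) (@is_polyL l p).

Lemma poly_sub_d l (p q : int) (e : p = q + 1) x :
  poly_sub l p x -> poly_sub l q (cx_d (F l) e x).
Proof.
move=> [s sE]; exists (pmap (cx_d (S l) e) s) => t.
by rewrite pev_map -?sE //; exact: linearP.
Qed.
Lemma poly_sub_act l s p x : poly_sub l p x -> poly_sub l p (op_act F (l := l) s p x).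
Proof.
move=> [u uE]; exists (pmap (op_act S s p) u) => t.
by rewrite pev_map -?uE //; exact: linearP.
Qed.
Lemma poly_sub_comp l m n (e : (ar l + ar m = (ar n).+1)%N) i p q r (d : p + q = r) a b :
  poly_sub l p a -> poly_sub m q b -> poly_sub n r (bm_fun (op_comp F e i) d a b).
Proof.
move=> [u uE] [v vE]; exists (pmul (bm_fun (op_comp S e i) d) u v) => t.
by rewrite pev_mul -?uE -?vE // => x; [exact: bm_linl | exact: bm_linr].
Qed.

(* S (x) k[t], realized as polynomial functions k -> S. *)
Definition polyop : operad_on k ar := subop poly_sub_d poly_sub_act poly_sub_comp.

Definition poly_ev (t : k) : operad_mor polyop S :=
  om_cmp (prodop_proj (fun _ => S) t) (subop_incl poly_sub_d poly_sub_act poly_sub_comp).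

Lemma polyP l p (a b : polyop l p) : (forall t, poly_ev t l p a = poly_ev t l p b) -> a = b.
Proof. by move=> ab; apply: val_inj; apply: dprodP => t; exact: ab. Qed.

Lemma poly_rep l p (a : polyop l p) : exists s, forall t, poly_ev t l p a = pev s t.
Proof. by have [s sE] := msubP a; exists s. Qed.

Definition mkpoly l p (s : seq (nat * S l p)) : polyop l p :=
  mksub (W := poly_sub l p) (x := fun t => pev s t) (ex_intro _ s (fun t => erefl)).

Lemma mkpolyE l p s t : poly_ev t l p (mkpoly s) = pev s t.
Proof. by []. Qed.

Definition poly_der_fun l p (a : polyop l p) : polyop l p :=
  mkpoly (pder (projT1 (cid (poly_rep a)))).

(** The derivative is computed on a chosen list of monomials; two lists for the same function differ
    by one that evaluates to zero, to which [pev0_pdev0] applies. *)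
Lemma poly_der_funE l p (a : polyop l p) s :
  (forall t, poly_ev t l p a = pev s t) ->
  forall t, poly_ev t l p (poly_der_fun a) = pdev s t.
Proof.
move=> aE t; rewrite mkpolyE pev_der; case: cid => s' /= s'E.
apply/eqP; rewrite -subr_eq0; apply/eqP.
have NL : linear (fun x : S l p => - x) by move=> c u v; rewrite opprD scalerN.
rewrite -(pdev_map NL) -pdev_cat; apply: (pev0_pdev0 char_k) => {}t.
by rewrite pev_cat (pev_map NL) -aE -s'E subrr.
Qed.

Lemma poly_der_linear l p : linear (@poly_der_fun l p).
Proof.
move=> c a b; apply: polyP => t; have [s sE] := poly_rep a; have [s' s'E] := poly_rep b.
have cL : linear (fun x : S l p => c *: x).
  by move=> x u v; rewrite scalerDr !scalerA mulrC.
rewrite (@poly_der_funE _ _ _ (pmap ( *:%R c) s ++ s')) => [|{}t].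
  by rewrite pdev_cat (pdev_map cL) linearP (poly_der_funE sE) (poly_der_funE s'E).
by rewrite pev_cat (pev_map cL) linearP sE s'E.
Qed.

Definition poly_der l p : {linear polyop l p -> polyop l p} := mkLin (@poly_der_linear l p).

Lemma poly_derE l p (a : polyop l p) s :
  (forall t, poly_ev t l p a = pev s t) ->
  forall t, poly_ev t l p (poly_der l p a) = pdev s t.
Proof. exact: poly_der_funE. Qed.

Lemma poly_der_d l p q (e : p = q + 1) x :
  cx_d (polyop l) e (poly_der l p x) = poly_der l q (cx_d (polyop l) e x).
Proof.
apply: polyP => t; have [s sE] := poly_rep x.
rewrite -cm_d (poly_derE sE) (@poly_derE _ _ _ (pmap (cx_d (S l) e) s)) => [|{}t].
  by rewrite pdev_map //; exact: linearP.
by rewrite -cm_d sE pev_map //; exact: linearP.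
Qed.

Lemma poly_der_act l s p x :
  poly_der l p (op_act polyop s p x) = op_act polyop (l := l) s p (poly_der l p x).
Proof.
apply: polyP => t; have [u uE] := poly_rep x.
rewrite om_act (poly_derE uE) (@poly_derE _ _ _ (pmap (op_act S s p) u)) => [|{}t].
  by rewrite pdev_map //; exact: linearP.
by rewrite om_act uE pev_map //; exact: linearP.
Qed.

Lemma poly_der_comp l m n (e : (ar l + ar m = (ar n).+1)%N) i p q r (d : p + q = r) a b :
  poly_der n r (bm_fun (op_comp polyop e i) d a b) =
  bm_fun (op_comp polyop e i) d (poly_der l p a) b
  + bm_fun (op_comp polyop e i) d a (poly_der m q b).
Proof.
apply: polyP => t; have [u uE] := poly_rep a; have [v vE] := poly_rep b.
have mL y : linear (fun x => bm_fun (op_comp S e i) d x y) by exact: bm_linl.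
have mR x : linear (bm_fun (op_comp S e i) d x) by exact: bm_linr.
rewrite (@poly_derE _ _ _ (pmul (bm_fun (op_comp S e i) d) u v)) => [|{}t].
  rewrite (pdev_mul mL mR) linearD !om_comp.
  by rewrite (poly_derE uE) (poly_derE vE) uE vE.
by rewrite om_comp uE vE (pev_mul mL mR).
Qed.

Lemma poly_int l p (b : polyop l p) : exists a, poly_der l p a = b /\ poly_ev 0 l p a = 0.
Proof.
have [s sE] := poly_rep b; exists (mkpoly (pint s)); split; last first.
  by rewrite mkpolyE pev_int0.
apply: polyP => t; rewrite (@poly_derE _ _ _ (pint s)) => [|{}t]; last exact: mkpolyE.
by rewrite pdev_int // sE.
Qed.

Lemma poly_der0 l p (a : polyop l p) : poly_der l p a = 0 ->
  forall t, poly_ev t l p a = poly_ev 0 l p a.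
Proof.
move=> a0 t; have [s sE] := poly_rep a; rewrite !sE.
apply: (pdev0_const char_k) => {}t.
by rewrite -(poly_derE sE) a0 linear0.
Qed.

(** The path object [S (x) k[t, dt]] of polynomial forms on the line. *)
Definition pathop : operad_on k ar := dtop poly_der_d poly_der_act poly_der_comp.
Definition path_ev t : operad_mor pathop S := om_cmp (poly_ev t) (dt_fst _ _ _).

End PolynomialOperad.

Lemma addr_scale_eq0 (k : fieldType) (V : lmodType k) (s : k) (a b : V) :
  a + s *: b = 0 -> a = - s *: b.
Proof. by move/eqP; rewrite addr_eq0 => /eqP ->; rewrite scaleNr. Qed.

Lemma quasi_iso_homotopic (k : fieldType) (C D : complex k) (F G : chain_map C D) :
  (forall p (z : cycles C p), exists y, cx_d D (erefl (p + 1)) y = F p (cyc_val z) - G p (cyc_val z)) ->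
  quasi_iso F -> quasi_iso G.
Proof.
move=> FG qF p; apply: eq_bij (qF p) _ _ => h; elim/hclass_ind: h => z.
by rewrite !hmapE; apply/hclassP; have [y dy] := FG p z; exists y.
Qed.

(** * Mapping cocylinders and surjective replacement *)

Section SurjectiveReplacement.
Variables (k : fieldType) (char_k : [pchar k] =i pred0) (I : Type) (ar : I -> nat).
Variables (R S : operad_on k ar) (f : operad_mor R S).

Let Path := pathop char_k S.
Let B := bprodop R Path.
Let ev t : operad_mor Path S := path_ev char_k S t.

(** Pairs of an element of [R] and a path in [S] starting at its image: the mapping cocylinder of
    [f]. *)
Definition glued l p (x : B l p) : Prop := ev 0 l p x.2 = f l p x.1.

Lemma glued0 l p : glued (0 : B l p).
Proof. by rewrite /glued /= !linear0. Qed.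
Lemma gluedL l p c (x y : B l p) : glued x -> glued y -> glued (c *: x + y).
Proof.
rewrite /glued => xE yE; rewrite -[(c *: x + y).1]/(c *: x.1 + y.1).
by rewrite -[(c *: x + y).2]/(c *: x.2 + y.2) !linearP xE yE.
Qed.
Definition glued_sub l p : submodule (B l p) := Submodule (@glued0 l p) (@gluedL l p).

Lemma glued_d l (p q : int) (e : p = q + 1) x :
  glued_sub l p x -> glued_sub l q (cx_d (B l) e x).
Proof.
move=> xE; rewrite /= /glued.
by rewrite -[(cx_d (B l) e x).2]/(cx_d (Path l) e x.2) -[(cx_d (B l) e x).1]/(cx_d (R l) e x.1)
  -!cm_d xE.
Qed.
Lemma glued_act l s p x : glued_sub l p x -> glued_sub l p (op_act B (l := l) s p x).
Proof.
move=> xE; rewrite /= /glued.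
by rewrite -[(op_act B s p x).2]/(op_act Path s p x.2) -[(op_act B s p x).1]/(op_act R s p x.1)
  !om_act xE.
Qed.
Lemma glued_comp l m n (e : (ar l + ar m = (ar n).+1)%N) i p q r (d : p + q = r) a b :
  glued_sub l p a -> glued_sub m q b -> glued_sub n r (bm_fun (op_comp B e i) d a b).
Proof.
move=> aE bE; rewrite /= /glued.
rewrite -[(bm_fun (op_comp B e i) d a b).2]/(bm_fun (op_comp Path e i) d a.2 b.2).
rewrite -[(bm_fun (op_comp B e i) d a b).1]/(bm_fun (op_comp R e i) d a.1 b.1).
by rewrite !om_comp aE bE.
Qed.

Definition cocyl : operad_on k ar := subop glued_d glued_act glued_comp.
Definition cocyl_incl : operad_mor cocyl B := subop_incl glued_d glued_act glued_comp.
Definition cocyl_fst : operad_mor cocyl R := om_cmp (bprod_fst R Path) cocyl_incl.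
Definition cocyl_ev1 : operad_mor cocyl S :=
  om_cmp (ev 1) (om_cmp (bprod_snd R Path) cocyl_incl).

Let A := polyop S.
Let dl := poly_der char_k S.

Let mkc l p r (a : A l p) (b : A l (p + 1)) (H : poly_ev S 0 l p a = f l p r) : cocyl l p :=
  mksub (W := glued_sub l p) (x := (r, (a, b))) H.

Let const l p (s : S l p) : A l p := mkpoly [:: (0%N, s)].
Let constE l p s t : poly_ev S t l p (const s) = s.
Proof. by rewrite mkpolyE /pev big_seq1 expr0 scale1r. Qed.
Let const_dl l p s : dl l p (const s) = 0.
Proof.
apply: polyP => t; rewrite (poly_derE char_k (s := [:: (0%N, s)])) => [|{}t]; last exact: mkpolyE.
by rewrite /pdev big_seq1 mulr0n scale0r linear0.
Qed.
Let const_d l p q (e : p = q + 1) s : cx_d (A l) e (const s) = const (cx_d (S l) e s).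
Proof. by apply: polyP => t; rewrite -cm_d !constE. Qed.

Let poly_eq0 l p (a : A l p) : dl l p a = 0 -> poly_ev S 0 l p a = 0 -> a = 0.
Proof. by move=> da a0; apply: polyP => t; rewrite (poly_der0 da) a0 linear0. Qed.

Let cocyl_d1 l p q (e : p = q + 1) (x : cocyl l p) :
  (mval (cx_d (cocyl l) e x)).1 = cx_d (R l) e (mval x).1.
Proof. by []. Qed.
Let cocyl_d2 l p q (e : p = q + 1) (x : cocyl l p) :
  (mval (cx_d (cocyl l) e x)).2.1 = cx_d (A l) e (mval x).2.1.
Proof. by []. Qed.
Let cocyl_d3 l q (x : cocyl l (q + 1)) :
  (mval (cx_d (cocyl l) (erefl (q + 1)) x)).2.2 =
  cx_d (A l) erefl (mval x).2.2 + sgn k (q + 1) *: dl l (q + 1) (mval x).2.1.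
Proof.
have dE : (mval (cx_d (cocyl l) (erefl (q + 1)) x)).2 = cx_d (Path l) erefl (mval x).2 by [].
rewrite dE; exact: (dt_d2 (erefl (q + 1)) (mval x).2).
Qed.

Let cocyl_cycle l (q : int) (z : cycles (cocyl l) (q + 1)) :
  [/\ poly_ev S 0 _ _ (mval (cyc_val z)).2.1 = f _ _ (mval (cyc_val z)).1,
      cx_d (A l) erefl (mval (cyc_val z)).2.1 = 0
    & cx_d (A l) erefl (mval (cyc_val z)).2.2 =
      - sgn k (q + 1) *: dl l (q + 1) (mval (cyc_val z)).2.1].
Proof.
split; first exact: (msubP (cyc_val z)).
  by rewrite -cocyl_d2 (cyc_d z).
by apply: addr_scale_eq0; rewrite -cocyl_d3 (cyc_d z).
Qed.

Let cocyl_eq l p (x y : cocyl l p) : (mval x).1 = (mval y).1 ->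
  (mval x).2.1 = (mval y).2.1 -> (mval x).2.2 = (mval y).2.2 -> x = y.
Proof.
move=> e1 e2 e3; apply: val_inj; apply: injective_projections; first exact: e1.
by apply: injective_projections; [exact: e2 | exact: e3].
Qed.

(** A path with prescribed starting point contracts to the constant path: for polynomial forms this
    is integration from 0. Constant paths provide the surjectivity on homology. *)
Lemma cocyl_fst_we : weak_equivalence cocyl_fst.
Proof.
move=> l; apply/quasi_isoP; split=> p.
  have [q qE] : exists q : int, p = q + 1 by exists (p - 1); rewrite subrK.
  subst p => z [r' dr']; have [x0 dx1 dx2] := cocyl_cycle z.
  set x := mval (cyc_val z) in x0 dx1 dx2.
  (* With [al] the integral of the [dt] part up to sign, [(r', f r' + al, 0)] is a primitive: its
     boundary and the given cycle have the same [dt] part, and their polynomial parts share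
     derivative and value at 0. *)
  have [al [dal al0]] := poly_int char_k (sgn k (q + 1 + 1) *: x.2.2).
  have H : poly_ev S 0 _ _ (const (f l _ r') + al) = f l _ r'.
    by rewrite linearD constE al0 addr0.
  have dalE : dl l (q + 1) (cx_d (A l) erefl al) = dl l (q + 1) x.2.1.
    rewrite -poly_der_d dal linearZZ dx2 scalerA (sgnS _ (q + 1)) mulrNN.
    by rewrite sgn_sqr scale1r.
  exists (mkc 0 H); apply: cocyl_eq.
  - by rewrite -[LHS]/(cx_d (R l) erefl r') dr'.
  - rewrite -[LHS]/(cx_d (A l) erefl (const (f l _ r') + al)).
    apply/eqP; rewrite -subr_eq0; apply/eqP; apply: poly_eq0.
      by rewrite linearB linearD const_d linearD const_dl add0r dalE subrr.
    rewrite linearB linearD const_d linearD constE -(cm_d (poly_ev S 0 l)) al0 linear0 addr0.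
    by rewrite x0 cm_d dr' subrr.
  - rewrite -[LHS]/(cx_d (A l) erefl 0 + sgn k (q + 1 + 1) *: dl l _ (const (f l _ r') + al)).
    rewrite linear0 add0r linearD const_dl add0r dal scalerA sgn_sqr scale1r.
    by [].
move=> w.
have H : poly_ev S 0 _ _ (const (f l _ (cyc_val w))) = f l _ (cyc_val w) by rewrite constE.
have Hc : mkc 0 H \in @is_cycle k (cocyl l) p.
  apply/cycleP => q e; apply: cocyl_eq.
  - by rewrite -[LHS]/(cx_d (R l) e (cyc_val w)) cyc_d.
  - rewrite -[LHS]/(cx_d (A l) e (const (f l _ (cyc_val w)))) const_d cm_d cyc_d linear0.
    by apply: polyP => t; rewrite constE linear0.
  - rewrite -[LHS]/(cx_d (A l) _ 0 + sgn k p *: tr (A l) e (dl l _ (const (f l _ (cyc_val w))))).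
    by rewrite const_dl !linear0 addr0.
exists (Cycles Hc), 0; rewrite linear0.
by rewrite -[cocyl_fst l p _]/(cyc_val w) subrr.
Qed.

Hypothesis fwe : weak_equivalence f.

(** On cycles, integrating the [dt] part from 0 to 1 bounds the difference of the endpoints. So
    evaluation at 1 is homotopic to evaluation at 0, which is [f] after the projection to [R]. *)
Lemma cocyl_ev1_we : weak_equivalence cocyl_ev1.
Proof.
move=> l.
apply: (@quasi_iso_homotopic _ _ _ (cm_comp (f l) (cocyl_fst l))); last first.
  exact: quasi_iso_comp (fwe l) (cocyl_fst_we l).
move=> p; have [q qE] : exists q : int, p = q + 1 by exists (p - 1); rewrite subrK.
subst p => z; have [x0 dx1 dx2] := cocyl_cycle z.
set x := mval (cyc_val z) in x0 dx1 dx2.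
have [al [dal al0]] := poly_int char_k (sgn k (q + 1) *: x.2.2).
exists (poly_ev S 1 _ _ al).
rewrite -[cm_comp _ _ _ _]/(f l _ x.1) -x0 -[cocyl_ev1 l _ _]/(poly_ev S 1 _ _ x.2.1).
have dalE : dl l (q + 1) (cx_d (A l) erefl al + x.2.1) = 0.
  rewrite linearD -poly_der_d dal linearZZ dx2 scalerA mulrN sgn_sqr scaleN1r.
  by rewrite addNr.
rewrite cm_d; have := poly_der0 dalE 1.
rewrite !linearD -[in RHS](cm_d (poly_ev S 0 l)) al0 linear0 add0r => E.
by rewrite -E addrK.
Qed.

(** The path [t y] runs from 0 to [y]. *)
Lemma cocyl_ev1_surj l p y : exists x, cocyl_ev1 l p x = y.
Proof.
have H : poly_ev S 0 l p (mkpoly [:: (1%N, y)]) = f l p 0.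
  by rewrite mkpolyE /pev big_seq1 expr0n scale0r linear0.
exists (mkc 0 H); rewrite -[LHS]/(poly_ev S 1 l p (mkpoly [:: (1%N, y)])).
by rewrite mkpolyE /pev big_seq1 expr1n scale1r.
Qed.

End SurjectiveReplacement.

(** * Collapsing zigzags out of a cofibrant operad *)

Section FormalLift.
Variables (k : fieldType) (char_k : [pchar k] =i pred0) (I : Type) (ar : I -> nat).
Variables (B : nat) (ar_bound : forall l, (ar l < B)%N) (ar_pos : forall l, (0 < ar l)%N).
Variables (Q : operad_on k ar).
Hypothesis Qcof : forall n, cofibrant_at Q n.
Hypothesis Q1 : forall l, ar l = 1%N -> forall p (x : Q l p), x = 0.

(** Since [f] need not be surjective, [g] is lifted through the cocylinder of [f], and the lift is
    then projected to [R]. By cancellation the lift is a weak equivalence. *)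
Lemma lift_weak_equivalence (R S : operad_on k ar) (f : operad_mor R S) (g : operad_mor Q S) :
  weak_equivalence f -> weak_equivalence g ->
  exists h : operad_mor Q R, weak_equivalence h.
Proof.
move=> wf wg.
have [h hE] := lift_morphism char_k ar_bound ar_pos Qcof Q1
  (@cocyl_ev1_surj k char_k I ar R S f) (cocyl_ev1_we char_k wf) g.
exists (om_cmp (cocyl_fst char_k f) h); apply: weak_equivalence_comp.
  exact: cocyl_fst_we.
move=> l; apply: quasi_iso_cancell (cocyl_ev1_we char_k wf l) _.
by apply: quasi_iso_ext (wg l) => p x; rewrite -hE.
Qed.

(** Arrows pointing forward are composed with, arrows pointing backward are lifted through. *)
Lemma cofibrant_zigzag (R S : operad_on k ar) : zigzag R S ->
  (exists h : operad_mor Q R, weak_equivalence h) <->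
  (exists h : operad_mor Q S, weak_equivalence h).
Proof.
elim=> {R S} [R S [f wf]|R|R S _ IH|R S T _ IH1 _ IH2] //.
- split=> [[h wh]|[h wh]].
    by exists (om_cmp f h); exact: weak_equivalence_comp.
  exact: lift_weak_equivalence wf wh.
- by split=> /IH.
- by rewrite IH1.
Qed.

End FormalLift.

(** * Extension of scalars *)

Section PlainContraction.
Variables (k : fieldType) (char_k : [pchar k] =i pred0) (C : complex k).

(** The equivariant contraction for the trivial group ['S_0]. A contraction consists of linear maps
    and identities, so it survives extension of scalars. *)
Lemma contraction_of_complex :
  exists (s : forall p, {linear hmod C p -> C p})
         (r : forall p, {linear C p -> hmod C p})
         (h : forall p q : int, p = q + 1 -> {linear C q -> C p}),
  [/\ forall p q (e : p = q + 1) x, cx_d C e (s p x) = 0,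
      forall p z, r p (cyc_val z) = hclass C p z,
      forall p c, r p (s p c) = c,
      forall p q o (e1 : p = q + 1) (e2 : q = o + 1) x,
        x - s q (r q x) = cx_d C e1 (h p q e1 x) + h q o e2 (cx_d C e2 x)
    & forall p q (e : p = q + 1) x, r q (cx_d C e x) = 0].
Proof.
pose C0 := @SComplex k 0 C (fun _ => cm_id C) (fun p x => erefl) (fun s t p x => erefl).
have [s [r [h [h1 h2 h3 h4 _]]]] := equivariant_contraction char_k C0.
exists s, r, h; split=> // p q e x.
have cP : cx_d C e x \in @is_cycle k C q by apply/cycleP => o e'; rewrite dd0.
rewrite -[cx_d C e x]/(cyc_val (Cycles cP)) h2; subst p.
by apply/hclass0P; exists x.
Qed.

End PlainContraction.

Section TensorFunctor.
Variables (k K : fieldType) (iota : {rmorphism k -> K}) (char_k : [pchar k] =i pred0).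

Lemma tens_map_comp (U V W : lmodType k) (g : {linear V -> W}) (f : {linear U -> V}) x :
  tens_map iota g (tens_map iota f x) = tens_map iota (g \o f) x.
Proof.
elim/tens_ind: x => [|b v x IH]; first by rewrite !linear0.
by rewrite !linearD IH !tens_mapE.
Qed.

Lemma tens_map_ext (V W : lmodType k) (f g : {linear V -> W}) x :
  (forall v, f v = g v) -> tens_map iota f x = tens_map iota g x.
Proof.
move=> fg; elim/tens_ind: x => [|b v x IH]; first by rewrite !linear0.
by rewrite !linearD IH !tens_mapE fg.
Qed.

Lemma tens_map_id (V : lmodType k) (f : {linear V -> V}) x :
  (forall v, f v = v) -> tens_map iota f x = x.
Proof.
move=> fg; elim/tens_ind: x => [|b v x IH]; first by rewrite !linear0.
by rewrite !linearD IH !tens_mapE fg.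
Qed.

Lemma tens_map_0 (V W : lmodType k) (f : {linear V -> W}) x :
  (forall v, f v = 0) -> tens_map iota f x = 0.
Proof.
move=> fg; elim/tens_ind: x => [|b v x IH]; first by rewrite !linear0.
by rewrite !linearD IH !tens_mapE fg tpure0 addr0.
Qed.

Lemma tens_mapD (V W : lmodType k) (f g h : {linear V -> W}) x :
  (forall v, f v = g v + h v) -> tens_map iota f x = tens_map iota g x + tens_map iota h x.
Proof.
move=> fg; elim/tens_ind: x => [|b v x IH]; first by rewrite !linear0 addr0.
rewrite !linearD IH !tens_mapE fg addrACA; congr (_ + _).
by rewrite -{1}[g v]scale1r tpure_linl rmorph1 scale1r.
Qed.

(** The contractions of [C] and [D] remain contractions after tensoring with [K], so a cycle is a
    boundary as soon as its image under the tensored [r] vanishes. Under these identifications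
    [f (x) K] becomes the tensored map on homology, whose inverse is the tensored inverse [psi]. *)
Lemma quasi_iso_tens (C D : complex k) (f : chain_map C D) :
  quasi_iso f -> quasi_iso (cm_tens iota f).
Proof.
move=> qf.
have [s [r [h [sd rz rs hh rd]]]] := contraction_of_complex char_k C.
have [s' [r' [h' [sd' rz' rs' hh' rd']]]] := contraction_of_complex char_k D.
have /dep_choice[psi psiP] : forall p, exists g : {linear hmod D p -> hmod C p},
    (forall c, g (hmap f p c) = c) /\ (forall c, hmap f p (g c) = c).
  move=> p; have [g gK gK'] := qf p.
  have gL : linear g by apply: (can2_linear gK gK').
  by exists (mkLin gL).
pose T (V W : lmodType k) (g : {linear V -> W}) : {linear tens iota V -> tens iota W} :=
  tens_map iota g.
have homot (E : complex k) (s0 : forall p, {linear hmod E p -> E p})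
    (r0 : forall p, {linear E p -> hmod E p})
    (h0 : forall p q : int, p = q + 1 -> {linear E q -> E p}) :
    (forall p q o (e1 : p = q + 1) (e2 : q = o + 1) x,
        x - s0 q (r0 q x) = cx_d E e1 (h0 p q e1 x) + h0 q o e2 (cx_d E e2 x)) ->
    forall p (x : tens iota (E p)), T _ _ (cx_d E (esym (subrK 1 p))) x = 0 ->
    T _ _ (r0 p) x = 0 ->
    exists y, T _ _ (cx_d E (erefl (p + 1))) y = x.
  move=> H p x dx rx; exists (T _ _ (h0 (p + 1) p erefl) x).
  have E0 : x = T _ _ (s0 p \o r0 p) x + (T _ _ (cx_d E erefl \o h0 (p + 1) p erefl) x
      + T _ _ (h0 p (p - 1) (esym (subrK 1 p)) \o cx_d E (esym (subrK 1 p))) x).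
    transitivity (T _ _ idfun x); first by rewrite /T tens_map_id.
    rewrite /T (tens_mapD (g := s0 p \o r0 p) (h := (cx_d E erefl \o h0 (p + 1) p erefl)
      \+ (h0 p (p - 1) (esym (subrK 1 p)) \o cx_d E (esym (subrK 1 p))))).
      by congr (_ + _); apply: tens_mapD.
    by move=> v; rewrite /= -H addrC subrK.
  by rewrite {2}E0 /T -!tens_map_comp -/(T _ _) -/(T _ _) [tens_map _ (r0 p) x]rx
    [tens_map _ (cx_d E (esym _)) x]dx !linear0 add0r addr0.
have phi_rf p x : T _ _ (r' p) (T _ _ (f p) (T _ _ (s p) x)) = T _ _ (hmap f p) x.
  rewrite /T !tens_map_comp; apply: tens_map_ext => c /=.
  have sc : s p c \in @is_cycle k C p by apply/cycleP => q e; rewrite sd.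
  rewrite -[s p c]/(cyc_val (Cycles sc)) -[f p _]/(cyc_val (cyc_map f (Cycles sc))) rz'.
  by rewrite -hmapE -rz /= rs.
have cyc0 (E : complex k) p (z : cycles (cx_tens iota E) p) :
    T _ _ (cx_d E (esym (subrK 1 p))) (cyc_val z) = 0.
  exact: (cyc_d z (esym (subrK 1 p))).
have sr_f p (x : tens iota (C p)) : T _ _ (cx_d C (esym (subrK 1 p))) x = 0 ->
    T _ _ (r' p) (T _ _ (f p) x) = T _ _ (hmap f p) (T _ _ (r p) x).
  move=> dx; have [||y yE] := homot C s r h hh p (x - T _ _ (s p) (T _ _ (r p) x)).
  - rewrite linearB dx /T !tens_map_comp tens_map_0 ?subr0 // => v.
    by rewrite /= sd.
  - rewrite linearB; apply/eqP; rewrite subr_eq0; apply/eqP.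
    rewrite /T !tens_map_comp; apply: tens_map_ext => v /=.
    by rewrite rs.
  have -> : x = T _ _ (s p) (T _ _ (r p) x) + T _ _ (cx_d C erefl) y.
    by rewrite yE addrC subrK.
  rewrite !linearD phi_rf /T !tens_map_comp; congr (_ + _).
    by apply: tens_map_ext => v /=; rewrite rs.
  rewrite !tens_map_0 // => v /=; first by rewrite rd linear0.
  by rewrite -cm_d rd'.
have psiK p (x : tens iota (hmod C p)) : T _ _ (psi p) (T _ _ (hmap f p) x) = x.
  by rewrite /T tens_map_comp tens_map_id // => c; exact: (psiP p).1.
have psiK' p (x : tens iota (hmod D p)) : T _ _ (hmap f p) (T _ _ (psi p) x) = x.
  by rewrite /T tens_map_comp tens_map_id // => c; exact: (psiP p).2.
apply/quasi_isoP; split=> p.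
  move=> z [y dy]; apply: (homot C s r h hh) (cyc0 _ _ z) _.
  apply: (can_inj (psiK p)); rewrite linear0 -sr_f //.
  rewrite -[T _ _ (f p) _]/(cm_tens iota f p (cyc_val z)) -dy.
  rewrite -[cx_d _ _ y]/(T _ _ (cx_d D erefl) y) /T tens_map_comp tens_map_0 // => v /=.
  by rewrite rd'.
move=> w; pose u : cx_tens iota C p := T _ _ (s p) (T _ _ (psi p) (T _ _ (r' p) (cyc_val w))).
have du : T _ _ (cx_d C (esym (subrK 1 p))) u = 0.
  by rewrite /u /T !tens_map_comp tens_map_0 // => v /=; rewrite sd.
have cu : u \in @is_cycle K (cx_tens iota C) p by apply/eqP.
exists (Cycles cu); apply: (homot D s' r' h' hh').
  have := cyc0 D p w; have := cyc0 D p (cyc_map (cm_tens iota f) (Cycles cu)) => e1 e2.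
  by rewrite linearB; apply/eqP; rewrite subr_eq0; apply/eqP; exact: etrans e2 (esym e1).
rewrite linearB /= -[cm_tens _ _ _ _]/(T _ _ (f p) u) [X in _ - X]phi_rf.
by rewrite psiK' subrr.
Qed.

Section Operads.
Variables (I : Type) (ar : I -> nat).

Definition om_tens (P Q : operad_on k ar) (f : operad_mor P Q) :
  operad_mor (operad_tens iota P) (operad_tens iota Q).
Proof.
exists (fun l => cm_tens iota (f l)).
- move=> l s p x; rewrite /= !tens_map_comp; apply: tens_map_ext => v /=.
  by rewrite om_act.
- move=> l m n e i p q r d a b.
  elim/tens_ind: a => [|u v a IHa]; first by rewrite !(bm0l, linear0).
  rewrite bmDl linearD IHa linearD bmDl; congr (_ + _).
  elim/tens_ind: b {IHa} => [|w x b IHb]; first by rewrite !(bm0r, linear0).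
  rewrite bmDr linearD IHb linearD bmDr; congr (_ + _).
  by rewrite !cm_tensE !bm_tensE cm_tensE om_comp.
Defined.

Lemma weak_equivalence_tens (P Q : operad_on k ar) (f : operad_mor P Q) :
  weak_equivalence f -> weak_equivalence (om_tens f).
Proof. by move=> wf l; exact: quasi_iso_tens. Qed.

Lemma zigzag_tens (P Q : operad_on k ar) :
  zigzag P Q -> zigzag (operad_tens iota P) (operad_tens iota Q).
Proof.
elim=> {P Q} [P Q [f wf]|P|P Q _|P Q R _ + _].
- exact: weak_equivalence_zigzag (weak_equivalence_tens wf).
- exact: rst_refl.
- exact: rst_sym.
- exact: rst_trans.
Qed.

(** Base change joins [P (x) K] to [H(P) (x) K], which has zero differential and is therefore
    formal. *)
Lemma formal_tens (P : operad_on k ar) : formal P -> formal (operad_tens iota P).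
Proof.
move=> /zigzag_tens zz; apply: formal_zigzag (rst_sym _ _ _ _ zz) _.
apply: weak_equivalence_zigzag (weak_equivalence_zero_d _) => l p q e x.
exact: tens_map_0.
Qed.

End Operads.
End TensorFunctor.

Section RestrictionOfScalars.
Variables (k K : fieldType) (iota : {rmorphism k -> K}) (V : lmodType K).

(** The vacuous [let] keeps [iota] visible in the type, so that it determines the [k]-module
    structure. *)
Definition restr : Type := let _ := iota in V.
HB.instance Definition _ := GRing.Zmodule.copy restr V.

Let scale (c : k) (v : restr) : restr := iota c *: (v : V).
Let scaleA a b v : scale a (scale b v) = scale (a * b) v.
Proof. by rewrite /scale scalerA rmorphM. Qed.
Let scale1 : left_id 1 scale.
Proof. by move=> v; rewrite /scale rmorph1 scale1r. Qed.
Let scaleDr : right_distributive scale +%R.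
Proof. by move=> a u v; exact: scalerDr. Qed.
Let scaleDl v : {morph scale^~ v : a b / a + b}.
Proof. by move=> a b; rewrite /scale rmorphD; exact: scalerDl. Qed.
HB.instance Definition _ :=
  GRing.Zmodule_isLmodule.Build k restr scaleA scale1 scaleDr scaleDl.

Lemma restr_scaleE c (v : restr) : c *: v = iota c *: (v : V).
Proof. by []. Qed.

End RestrictionOfScalars.

Section TensorCofibrant.
Variables (k K : fieldType) (iota : {rmorphism k -> K}) (M : operad k) (N : nat).

Let MK : truncated_operad K N := truncation N (operad_tens iota M).

Section Restrict.
Variables (n : 'I_N) (X : gmod K n.+1).

Definition restr_gmod : gmod k n.+1.
Proof.
unshelve refine (@GMod k n.+1 (fun p => restr iota (X p) : lmodType k) _ _ _).
- move=> s p; apply: (mkLin (f := fun x : restr iota (X p) => gm_act X s p x : restr iota (X p))).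
  by move=> c u v; exact: (linearP (gm_act X s p) (iota c) u v).
- by move=> p x; exact: gm_act1.
- by move=> s t p x; exact: gm_actM.
Defined.

Lemma label_ltl l m (e : (l.+1 + m.+1 = n.+2)%N) : (l < N)%N.
Proof. by apply: leq_trans (ltn_ord n); lia. Qed.
Lemma label_ltr l m (e : (l.+1 + m.+1 = n.+2)%N) : (m < N)%N.
Proof. by apply: leq_trans (ltn_ord n); lia. Qed.

Variable T : test MK X.

Let Tn l m (e : (l.+1 + m.+1 = n.+2)%N) (i : 'I_l.+1) (p q r : int) (d : p + q = r)
    (a : M l p) (b : M m q) : restr iota (X r) :=
  t_fun T (l := Ordinal (label_ltl e)) (m := Ordinal (label_ltr e)) e i d
    (tpure iota a 1) (tpure iota b 1).

Definition restr_test : test M (n := n : nat) restr_gmod.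
Proof.
exists Tn.
- move=> l m e i p q r d b c u v; rewrite /Tn tpure_linl.
  exact: (t_linl T).
- move=> l m e i p q r d a c u v; rewrite /Tn tpure_linl.
  exact: (t_linr T).
- move=> l m e t i s p q r d a b; rewrite /Tn.
  have := t_equiv T (l := Ordinal (label_ltl e)) (m := Ordinal (label_ltr e)) e t i s d
    (tpure iota a 1) (tpure iota b 1).
  by rewrite /= !tens_mapE.
- move=> l m c lm mc e1 e2 e3 e4 j i ji jiE p q r pq qr pqr d1 d2 d3 d4 a b x.
  have mN : (m < N)%N by apply: leq_trans (ltn_ord n); lia.
  have := t_assoc T (l := Ordinal (label_ltl e4)) (m := Ordinal mN)
    (c := Ordinal (label_ltr e2)) (lm := Ordinal (label_ltl e2)) (mc := Ordinal (label_ltr e4))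
    e1 e2 e3 e4 jiE d1 d2 d3 d4 (tpure iota a 1) (tpure iota b 1) (tpure iota x 1).
  by rewrite /Tn /= !tens_mulE !mulr1.
- move=> l m c lm lc e1 e2 e3 e4 i j i' j' ij iE jE p q r pq pr pqr d1 d2 d3 d4 a b x.
  have lN : (l < N)%N by apply: leq_trans (ltn_ord n); lia.
  have := t_comm T (l := Ordinal lN) (m := Ordinal (label_ltr e4))
    (c := Ordinal (label_ltr e2)) (lm := Ordinal (label_ltl e2)) (lc := Ordinal (label_ltl e4))
    e1 e2 e3 e4 ij iE jE d1 d2 d3 d4 (tpure iota a 1) (tpure iota b 1) (tpure iota x 1).
  rewrite /Tn /= !tens_mulE !mulr1 restr_scaleE => ->.
  by rewrite rmorphXn rmorphN1.
Defined.

End Restrict.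

(** A test over [K] restricts along [v |-> v (x) 1] to a test over [k] with values in the restricted
    module, and the extension found over [k] is prolonged [K]-linearly. The factors of a composition
    with label below [N] have labels below [N], so the truncation loses nothing. *)
Lemma cofibrant_tens : (forall n, cofibrant_at M n) -> forall n, cofibrant_at MK n.
Proof.
move=> Mcof n X T; have [h [hE hM]] := Mcof n _ (restr_test T).
pose hX p (x : M n p) : X p := h p x.
have hK p c u v : hX p (c *: u + v) = iota c *: hX p u + hX p v by exact: (linearP (h p)).
exists (fun p => tens_lift (hK p)); split.
  move=> s p x; elim/tens_ind: x => [|b v x IH]; first by rewrite !linear0.
  rewrite !linearD IH; congr (_ + _).
  by rewrite -[op_act _ _ _ _]/(tens_map iota (op_act M s p) _) tens_mapE !tens_liftE /hX hE linearZ.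
move=> l m e i p q r d a b.
have hN : (l < N)%N := ltn_ord l; have mN : (m < N)%N := ltn_ord m.
have TD a1 a2 b0 : t_fun T e i d (a1 + a2) b0 = t_fun T e i d a1 b0 + t_fun T e i d a2 b0.
  by have := t_linl T e i d b0 1 a1 a2; rewrite /= !scale1r.
have TDr a0 b1 b2 : t_fun T e i d a0 (b1 + b2) = t_fun T e i d a0 b1 + t_fun T e i d a0 b2.
  by have := t_linr T e i d a0 1 b1 b2; rewrite /= !scale1r.
have T0 b0 : t_fun T e i d 0 b0 = 0.
  by apply: (addrI (t_fun T e i d 0 b0)); rewrite -TD !addr0.
have T0r a0 : t_fun T e i d a0 0 = 0.
  by apply: (addrI (t_fun T e i d a0 0)); rewrite -TDr !addr0.
have TZ c a0 b0 : t_fun T e i d (c *: a0) b0 = c *: t_fun T e i d a0 b0.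
  by have := t_linl T e i d b0 c a0 0; rewrite /= !addr0 T0 addr0.
have TZr c a0 b0 : t_fun T e i d a0 (c *: b0) = c *: t_fun T e i d a0 b0.
  by have := t_linr T e i d a0 c b0 0; rewrite /= !addr0 T0r addr0.
elim/tens_ind: a => [|u v a IHa]; first by rewrite bm0l linear0 T0.
rewrite bmDl linearD IHa TD; congr (_ + _).
elim/tens_ind: b {IHa} => [|w x b IHb]; first by rewrite bm0r linear0 T0r.
rewrite bmDr linearD IHb TDr; congr (_ + _).
rewrite -[bm_fun _ _ _ _]/(bm_fun (bm_tens iota (op_comp M e i)) d _ _) bm_tensE tens_liftE.
rewrite /hX hM (tpureE iota v) (tpureE iota x) TZ TZr scalerA; congr (_ *: _).
case: l m e i hN mN v x {a b T0 T0r TZ TZr TD TDr u w IHb} => [l lN] [m mN] e i hl hm v x.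
by rewrite /= (bool_irrelevance lN (label_ltl e)) (bool_irrelevance mN (label_ltr e)).
Qed.

End TensorCofibrant.

(** * The cofibrant model *)

Section FreeModule.
Variables (k : fieldType) (T : choiceType).

Lemma freegZU (b : k) (x : T) : << b *g x >> = b *: << x >> :> {freeg T / k}.
Proof. by apply/eqP/freeg_eqP => w; rewrite coeffZ !coeffU mul1r. Qed.

Lemma freeg_span (P : {freeg T / k} -> Prop) :
  P 0 -> (forall b x D, P D -> P (b *: << x >> + D)) -> forall D, P D.
Proof.
move=> P0 PD D; rewrite -(freeg_sumE D); elim: (dom D) => [|x s IH].
  by rewrite big_nil.
by rewrite big_cons freegZU; exact: PD.
Qed.

Variables (M : lmodType k) (f : T -> M).

Lemma freeg_lift_linear : linear (fglift f).
Proof.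
have fB := lift_is_additive f.
have f0 : fglift f 0 = 0 by rewrite -(subrr 0) fB subrr.
have fD D D' : fglift f (D + D') = fglift f D + fglift f D'.
  have fN x : fglift f (- x) = - fglift f x by rewrite -[- x]sub0r fB f0 sub0r.
  by rewrite -{1}[D']opprK fB fN opprK.
move=> a D D'; rewrite fD; congr (_ + _) => {D'}.
elim/freeg_span: D => [|b x D IH]; first by rewrite scaler0 f0 scaler0.
rewrite scalerDr !fD IH scalerDr; congr (_ + _).
by rewrite scalerA -!freegZU !liftU scalerA.
Qed.

Definition freeg_lift : {linear {freeg T / k} -> M} := mkLin freeg_lift_linear.

Lemma freeg_liftU x : freeg_lift << x >> = f x.
Proof. by rewrite mkLinE liftU scale1r. Qed.

End FreeModule.

(** * The universal complex of formal compositions *)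

Section UniversalTest.
Variables (k : fieldType) (I : Type) (ar : I -> nat) (Q : operad_on k ar) (n : I).

(** A generator: the formal composition of [sy_a] and [sy_b] at the input [sy_i], acted on by
    [sy_s]. *)
Record symbol (r : int) := Symbol {
  sy_l : I; sy_m : I; sy_e : (ar sy_l + ar sy_m = (ar n).+1)%N; sy_i : 'I_(ar sy_l);
  sy_p : int; sy_q : int; sy_d : sy_p + sy_q = r;
  sy_a : Q sy_l sy_p; sy_b : Q sy_m sy_q; sy_s : 'S_(ar n) }.

Definition sym_free r : lmodType k := {freeg {classic symbol r} / k}.

Definition test_ev (X : gmod k (ar n)) (T : test Q X) r : {linear sym_free r -> X r} :=
  freeg_lift (fun y : {classic symbol r} =>
    gm_act X (sy_s y) r (t_fun T (sy_e y) (sy_i y) (sy_d y) (sy_a y) (sy_b y))).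

Definition sym_rel r (x : sym_free r) : Prop :=
  forall (X : gmod k (ar n)) (T : test Q X), test_ev T r x = 0.

Lemma sym_rel0 r : sym_rel (0 : sym_free r).
Proof. by move=> X T; rewrite linear0. Qed.
Lemma sym_relL r c (x y : sym_free r) : sym_rel x -> sym_rel y -> sym_rel (c *: x + y).
Proof. by move=> xr yr X T; rewrite linearP xr yr scaler0 addr0. Qed.

(* The relations between formal compositions are those holding in every test. *)
Definition univ_mod (r : int) : lmodType k := mquot (Submodule (@sym_rel0 r) (@sym_relL r)).

Definition uproj r : {linear sym_free r -> univ_mod r} := @mproj _ _ _.

Section Lift.
Variables (X : gmod k (ar n)) (T : test Q X).

Definition univ_lift_fun r (x : univ_mod r) : X r := test_ev T r (generic_quotient.repr x).

Lemma univ_lift_proj r D : univ_lift_fun (uproj r D) = test_ev T r D.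
Proof.
apply/eqP; rewrite -subr_eq0 -linearB; apply/eqP.
have /mproj_eq H : uproj r (generic_quotient.repr (uproj r D)) = uproj r D.
  exact: mproj_repr.
exact: H.
Qed.

Lemma univ_lift_linear r : linear (@univ_lift_fun r).
Proof.
move=> c; elim/mproj_ind => x; elim/mproj_ind => y.
by rewrite -[LHS]/(univ_lift_fun (c *: uproj r x + uproj r y)) -linearP !univ_lift_proj linearP.
Qed.

Definition univ_lift r : {linear univ_mod r -> X r} := mkLin (@univ_lift_linear r).

End Lift.

(** The relations are those that hold in every test, so any identity in [univ] may be checked after
    mapping to an arbitrary test; this yields all axioms of [univ_test]. *)
Lemma univ_eq r (x y : univ_mod r) :
  (forall (X : gmod k (ar n)) (T : test Q X), univ_lift T r x = univ_lift T r y) -> x = y.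
Proof.
elim/mproj_ind: x => x; elim/mproj_ind: y => y H; apply/mproj_eq => X T.
have e : test_ev T r x = test_ev T r y by have := H X T; rewrite !mkLinE !univ_lift_proj.
by apply: etrans (linearB (test_ev T r) x y) _; rewrite e subrr.

Qed.

Definition sym_act (t : 'S_(ar n)) r : {linear sym_free r -> sym_free r} :=
  freeg_lift (fun y : {classic symbol r} =>
    << (Symbol (sy_e y) (sy_i y) (sy_d y) (sy_a y) (sy_b y) (t * sy_s y)%g
        : {classic symbol r}) >>).

Lemma test_ev_act X (T : test Q X) t r D : test_ev T r (sym_act t r D) = gm_act X t r (test_ev T r D).
Proof.
elim/freeg_span: D => [|b x D IH]; first by rewrite !linear0.
rewrite !linearD IH !linearZ; congr (_ + _); congr (_ *: _).
by rewrite !freeg_liftU gm_actM.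
Qed.

Definition univ_act_fun t r (x : univ_mod r) : univ_mod r :=
  uproj r (sym_act t r (generic_quotient.repr x)).

Lemma univ_lift_act_fun X (T : test Q X) t r x :
  univ_lift T r (univ_act_fun t x) = gm_act X t r (univ_lift T r x).
Proof. by rewrite mkLinE univ_lift_proj test_ev_act. Qed.

Lemma univ_act_linear t r : linear (@univ_act_fun t r).
Proof.
move=> c x y; apply: univ_eq => X T.
by rewrite univ_lift_act_fun !linearP !univ_lift_act_fun.
Qed.

Definition univ : gmod k (ar n).
Proof.
exists univ_mod (fun t r => mkLin (@univ_act_linear t r)).
- by move=> p x; apply: univ_eq => X T; rewrite univ_lift_act_fun gm_act1.
- by move=> s t p x; apply: univ_eq => X T; rewrite !univ_lift_act_fun gm_actM.
Defined.

Lemma univ_lift_act X (T : test Q X) t r x :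
  univ_lift T r (gm_act univ t r x) = gm_act X t r (univ_lift T r x).
Proof. exact: univ_lift_act_fun. Qed.

Definition univ_sym l m (e : (ar l + ar m = (ar n).+1)%N) (i : 'I_(ar l)) (p q r : int)
    (d : p + q = r) (a : Q l p) (b : Q m q) : univ r :=
  uproj r << (Symbol e i d a b 1%g : {classic symbol r}) >>.

Lemma univ_lift_sym X (T : test Q X) l m (e : (ar l + ar m = (ar n).+1)%N) i p q r
    (d : p + q = r) a b :
  univ_lift T r (univ_sym e i d a b) = t_fun T e i d a b.
Proof. by rewrite mkLinE univ_lift_proj freeg_liftU gm_act1. Qed.

Lemma univ_ind r (P : submodule (univ r)) :
  (forall l m (e : (ar l + ar m = (ar n).+1)%N) i p q (d : p + q = r) a b s,
     P (gm_act univ s r (univ_sym e i d a b))) -> forall x, P x.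
Proof.
move=> H; elim/mproj_ind => D; rewrite -[mproj _ _]/(uproj r D).
elim/freeg_span: D => [|b x D IH]; first by rewrite linear0; exact: sub_mem0.
rewrite linearD linearZ; apply: sub_memL => //; case: x => l m e i p q d x y s.
have -> : uproj r << (Symbol e i d x y s : {classic symbol r}) >> =
    gm_act univ s r (univ_sym e i d x y); last exact: H.
apply: univ_eq => X T; rewrite univ_lift_act univ_lift_sym.
by rewrite mkLinE univ_lift_proj freeg_liftU.
Qed.

Definition univ_test : test Q univ.
Proof.
exists univ_sym.
- move=> l m e i p q r d b c u v; apply: univ_eq => X T.
  by rewrite linearP !univ_lift_sym; exact: (t_linl T).
- move=> l m e i p q r d a c u v; apply: univ_eq => X T.
  by rewrite linearP !univ_lift_sym; exact: (t_linr T).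
- move=> l m e t i s p q r d a b; apply: univ_eq => X T.
  by rewrite univ_lift_act !univ_lift_sym t_equiv.
- move=> l m c lm mc e1 e2 e3 e4 j i ji jiE p q r pq qr pqr d1 d2 d3 d4 a b x.
  by apply: univ_eq => X T; rewrite !univ_lift_sym; exact: t_assoc.
- move=> l m c lm lc e1 e2 e3 e4 i j i' j' ij iE jE p q r pq pr pqr d1 d2 d3 d4 a b x.
  by apply: univ_eq => X T; rewrite linearZZ !univ_lift_sym; exact: t_comm.
Defined.

Lemma univ_testE l m (e : (ar l + ar m = (ar n).+1)%N) i p q r (d : p + q = r) a b :
  t_fun univ_test e i d a b = univ_sym e i d a b.
Proof. by []. Qed.

(** The shift turns a map of degree -1 into a map of degree 0, so that the differential arises from
    the universal property. *)
Definition gshift (X : gmod k (ar n)) : gmod k (ar n) :=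
  @GMod k (ar n) (fun r => X (r - 1)) (fun s r => gm_act X s (r - 1))
    (fun r => @gm_act1 _ _ X (r - 1)) (fun s t r => @gm_actM _ _ X s t (r - 1)).

Section DerivedTest.
Variables (X : gmod k (ar n)) (T : test Q X).

Let e0 (p : int) : p = p - 1 + 1 := esym (subrK 1 p).
Let ddegl (p q r : int) (d : p + q = r) : p - 1 + q = r - 1.
Proof. by lia. Qed.
Let ddegr (p q r : int) (d : p + q = r) : p + (q - 1) = r - 1.
Proof. by lia. Qed.

Let dt l m (e : (ar l + ar m = (ar n).+1)%N) (i : 'I_(ar l)) (p q r : int)
    (d : p + q = r) (a : Q l p) (b : Q m q) : gshift X r :=
  (t_fun T e i (ddegl d) (cx_d (Q l) (e0 p) a) b
  + sgn k p *: t_fun T e i (ddegr d) a (cx_d (Q m) (e0 q) b) : X (r - 1)).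

Lemma tDl l m (e : (ar l + ar m = (ar n).+1)%N) (i : 'I_(ar l)) (p q r : int)
    (d : p + q = r) a a' b : t_fun T e i d (a + a') b = t_fun T e i d a b + t_fun T e i d a' b.
Proof. by have := t_linl T e i d b 1 a a'; rewrite /= !scale1r. Qed.
Lemma tDr l m (e : (ar l + ar m = (ar n).+1)%N) (i : 'I_(ar l)) (p q r : int)
    (d : p + q = r) a b b' : t_fun T e i d a (b + b') = t_fun T e i d a b + t_fun T e i d a b'.
Proof. by have := t_linr T e i d a 1 b b'; rewrite /= !scale1r. Qed.
Lemma t0l l m (e : (ar l + ar m = (ar n).+1)%N) (i : 'I_(ar l)) (p q r : int)
    (d : p + q = r) b : t_fun T e i d 0 b = 0.
Proof. by apply: (addrI (t_fun T e i d 0 b)); rewrite -tDl !addr0. Qed.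
Lemma t0r l m (e : (ar l + ar m = (ar n).+1)%N) (i : 'I_(ar l)) (p q r : int)
    (d : p + q = r) a : t_fun T e i d a 0 = 0.
Proof. by apply: (addrI (t_fun T e i d a 0)); rewrite -tDr !addr0. Qed.
Lemma tZl l m (e : (ar l + ar m = (ar n).+1)%N) (i : 'I_(ar l)) (p q r : int)
    (d : p + q = r) c a b : t_fun T e i d (c *: a) b = c *: t_fun T e i d a b.
Proof. by have := t_linl T e i d b c a 0; rewrite /= !addr0 t0l addr0. Qed.
Lemma tZr l m (e : (ar l + ar m = (ar n).+1)%N) (i : 'I_(ar l)) (p q r : int)
    (d : p + q = r) c a b : t_fun T e i d a (c *: b) = c *: t_fun T e i d a b.
Proof. by have := t_linr T e i d a c b 0; rewrite /= !addr0 t0r addr0. Qed.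

(* The would-be differential of a formal composition, as a test of degree -1. *)
Definition derived_test : test Q (gshift X).
Proof.
exists dt.
- move=> l m e i p q r d b c u v; rewrite /dt (linearP (cx_d _ _)) !tDl !tZl.
  by rewrite !scalerDr !scalerA [sgn k p * c]mulrC addrACA.
- move=> l m e i p q r d a c u v; rewrite /dt (linearP (cx_d _ _)) !tDr !tZr.
  by rewrite !scalerDr !scalerA [sgn k p * c]mulrC addrACA.
- move=> l m e t i s p q r d a b; rewrite /dt !cm_d !t_equiv.
  by rewrite -[RHS]/(gm_act X _ _ _) linearD linearZ.
- move=> l m c lm mc e1 e2 e3 e4 j i ji jiE p q r pq qr pqr d1 d2 d3 d4 a b x.
  rewrite /dt (bm_d _ _ (ddegl d1) (ddegr d1) (e0 p) (e0 q) (e0 pq)).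
  rewrite (bm_d _ _ (ddegl d3) (ddegr d3) (e0 q) (e0 r) (e0 qr)).
  rewrite -!/(sgn k _) !tDl !tDr !tZl !tZr.
  rewrite (t_assoc T e1 e2 e3 e4 jiE (ddegl d1) (ddegl d2) d3 (ddegl d4)).
  have d24 : p + (qr - 1) = pqr - 1 := ddegr d4.
  rewrite (t_assoc T e1 e2 e3 e4 jiE (ddegr d1) (ddegl d2) (ddegl d3) (ddegr d4)).
  rewrite (t_assoc T e1 e2 e3 e4 jiE d1 (ddegr d2) (ddegr d3) (ddegr d4)).
  have -> : sgn k pq = sgn k p * sgn k q by rewrite -d1 sgnD.
  by rewrite scalerDr scalerA addrA.
- move=> l m c lm lc e1 e2 e3 e4 i j i' j' ij iE jE p q r pq pr pqr d1 d2 d3 d4 a b x.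
  rewrite /dt -[RHS]/(_ *: (_ + _ : X (pqr - 1))).
  rewrite (bm_d _ _ (ddegl d1) (ddegr d1) (e0 p) (e0 q) (e0 pq)).
  rewrite (bm_d _ _ (ddegl d3) (ddegr d3) (e0 p) (e0 r) (e0 pr)).
  rewrite -!/(sgn k _) !tDl !tZl.
  rewrite (t_comm T e1 e2 e3 e4 ij iE jE (ddegl d1) (ddegl d2) (ddegl d3) (ddegl d4)).
  rewrite (t_comm T e1 e2 e3 e4 ij iE jE (ddegr d1) (ddegl d2) d3 (ddegr d4)).
  rewrite (t_comm T e1 e2 e3 e4 ij iE jE d1 (ddegr d2) (ddegr d3) (ddegl d4)).
  have -> : sgn k pq = sgn k p * sgn k q by rewrite -d1 sgnD.
  have -> : sgn k pr = sgn k p * sgn k r by rewrite -d3 sgnD.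
  have eql : (-1) ^+ (`|(q - 1)%R| * `|r|)%N = (-1) ^+ (`|q| * `|r|)%N * sgn k r :> k.
    by rewrite {2}(e0 q) sgn_mulS -mulrA sgn_sqr mulr1.
  have eqr : (-1) ^+ (`|q| * `|(r - 1)%R|)%N = (-1) ^+ (`|q| * `|r|)%N * sgn k q :> k.
    by rewrite {2}(e0 r) sgn_mulSr -mulrA sgn_sqr mulr1.
  rewrite eql eqr !scalerDr !scalerA -!addrA; congr (_ + _).
  rewrite addrC; congr (_ *: _ + _ *: _); last by ring.
  by rewrite mulrACA sgn_sqr mulr1 mulrC.
Defined.

Lemma derived_testE l m (e : (ar l + ar m = (ar n).+1)%N) (i : 'I_(ar l)) (p q r p' q' : int)
    (d : p + q = r) (el : p' + q = r - 1) (er : p + q' = r - 1)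
    (ep : p = p' + 1) (eq : q = q' + 1) (a : Q l p) (b : Q m q) :
  t_fun derived_test e i d a b =
  t_fun T e i el (cx_d (Q l) ep a) b + sgn k p *: t_fun T e i er a (cx_d (Q m) eq b).
Proof.
have p'E : p' = p - 1 by rewrite ep addrK.
have q'E : q' = q - 1 by rewrite eq addrK.
subst p' q'; rewrite -[LHS]/(dt e i d a b) /dt.
rewrite (eq_irrelevance ep (e0 p)) (eq_irrelevance eq (e0 q)).
by rewrite (eq_irrelevance el (ddegl d)) (eq_irrelevance er (ddegr d)).
Qed.

End DerivedTest.
End UniversalTest.

Section UniversalComplex.
Variables (k : fieldType) (I : Type) (ar : I -> nat) (Q : operad_on k ar) (n : I).

Let U := univ Q n.
Let e0 (p : int) : p = p - 1 + 1 := esym (subrK 1 p).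
Let Ud r : {linear U r -> U (r - 1)} := univ_lift (derived_test (univ_test Q n)) r.

Let Ud_act r s x : Ud r (gm_act U s r x) = gm_act U s (r - 1) (Ud r x).
Proof. exact: (univ_lift_act (derived_test (univ_test Q n)) s x). Qed.

Let Ud_sym l m (e : (ar l + ar m = (ar n).+1)%N) (i : 'I_(ar l)) (p q r p' q' : int)
    (d : p + q = r) (el : p' + q = r - 1) (er : p + q' = r - 1)
    (ep : p = p' + 1) (eq : q = q' + 1) (a : Q l p) (b : Q m q) :
  Ud r (univ_sym e i d a b) =
  univ_sym e i el (cx_d (Q l) ep a) b + sgn k p *: univ_sym e i er a (cx_d (Q m) eq b).
Proof.
apply: etrans (univ_lift_sym (derived_test (univ_test Q n)) e i d a b) _.
exact: derived_testE.
Qed.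

(** On a generator the terms with two differentials on one factor vanish, and the two mixed terms
    cancel because the Koszul sign flips between degrees [p] and [p - 1]. *)
Lemma univ_dd r x : Ud (r - 1) (Ud r x) = 0.
Proof.
have W0 : Ud (r - 1) (Ud r 0) = 0 by rewrite !linear0.
have WL c u v : Ud (r - 1) (Ud r u) = 0 -> Ud (r - 1) (Ud r v) = 0 ->
    Ud (r - 1) (Ud r (c *: u + v)) = 0.
  by move=> uE vE; rewrite !linearP uE vE scaler0 addr0.
apply: (univ_ind (P := Submodule W0 WL)) => l m e i p q d a b s.
rewrite -[sub_mem _ _]/(Ud (r - 1) (Ud r (gm_act U s r (univ_sym e i d a b))) = 0).
have dl : p - 1 + q = r - 1 by lia.
have dr : p + (q - 1) = r - 1 by lia.
have dll : p - 1 - 1 + q = r - 1 - 1 by lia.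
have dlr : p - 1 + (q - 1) = r - 1 - 1 by lia.
have drr : p + (q - 1 - 1) = r - 1 - 1 by lia.
rewrite !Ud_act (Ud_sym e i d dl dr (e0 p) (e0 q)) linearD linearZZ.
rewrite (Ud_sym e i dl dll dlr (e0 (p - 1)) (e0 q)) (Ud_sym e i dr dlr drr (e0 p) (e0 (q - 1))).
rewrite !dd0 -!univ_testE (t0l (univ_test Q n)) (t0r (univ_test Q n)) add0r scaler0 addr0.
by rewrite -scalerDl {2}(e0 p) sgnS addrN scale0r linear0.
Qed.

Definition univ_d (p q : int) (e : p = q + 1) : {linear U p -> U q} :=
  tr U (etrans (congr1 (fun z => z - 1) e) (addrK 1 q)) \o Ud p.

Lemma univ_dE p (e : p = p - 1 + 1) x : univ_d e x = Ud p x.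
Proof. by rewrite /univ_d /= tr_id. Qed.

Definition univ_cx : complex k.
Proof.
exists U univ_d.
move=> p q r e1 e2 x; have qE : q = p - 1 by rewrite e1 addrK.
move: q qE e1 e2 => q -> e1 e2; have rE : r = p - 1 - 1 by rewrite e2 addrK.
by subst r; rewrite !univ_dE univ_dd.
Defined.

Definition univ_sc : scomplex k (ar n).
Proof.
unshelve refine (@SComplex k (ar n) univ_cx _ _ _).
- move=> s; exists (fun p => gm_act U s p).
  move=> p q e x; have qE : q = p - 1 by rewrite e addrK.
  subst q; rewrite [LHS]univ_dE [X in _ = gm_act _ _ _ X]univ_dE.
  exact: Ud_act.
- by move=> p x; exact: gm_act1.
- by move=> s t p x; exact: gm_actM.
Defined.

Definition univ_sctest : test Q (sc_gmod univ_sc) := univ_test Q n.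

Lemma univ_bichain : is_bichain univ_sctest.
Proof.
move=> l m e i p q r p' q' r' d el er ep eq e' a b.
have rE : r' = r - 1 by rewrite e' addrK.
move: r' rE el er e' => r' -> el er e'.
exact: etrans (univ_dE e' (univ_sym e i d a b)) (Ud_sym e i d el er ep eq a b).
Qed.

End UniversalComplex.

(** * Mapping cylinders with finite dimensional homology part *)

Section Cylinder.
Variables (k : fieldType) (char_k : [pchar k] =i pred0) (m : nat) (L P : scomplex k m).
Variable G : chain_map L P.
Hypothesis GE : forall t p x, G p (sc_act L t p x) = sc_act P t p (G p x).
Variables (s : forall p, {linear hmod P p -> P p}) (r : forall p, {linear P p -> hmod P p})
  (h : forall p q : int, p = q + 1 -> {linear P q -> P p}).
Hypothesis sd : forall p q (e : p = q + 1) x, cx_d P e (s p x) = 0.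
Hypothesis rz : forall p z, r p (cyc_val z) = hclass P p z.
Hypothesis rs : forall p c, r p (s p c) = c.
Hypothesis hh : forall p q o (e1 : p = q + 1) (e2 : q = o + 1) x,
  x - s q (r q x) = cx_d P e1 (h e1 x) + h e2 (cx_d P e2 x).
Hypothesis sE : forall t p c, s p (hmap (sc_act P t) p c) = sc_act P t p (s p c).
Hypothesis rE : forall t p x, r p (sc_act P t p x) = hmap (sc_act P t) p (r p x).
Hypothesis hE : forall t p q e x, h e (sc_act P t q x) = sc_act P t p (h e x).

Let e0 (p : int) : p = p - 1 + 1 := esym (subrK 1 p).

Let rd p q (e : p = q + 1) x : r q (cx_d P e x) = 0.
Proof.
have cP : cx_d P e x \in @is_cycle k P q by apply/cycleP => o e'; rewrite dd0.
rewrite -[cx_d P e x]/(cyc_val (Cycles cP)) rz; subst p.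
by apply/hclass0P; exists x.
Qed.

Definition cyl_mod (p : int) : lmodType k := (L p * (L (p - 1)%R * hmod P p))%type.

Let pred_eq (p q : int) (e : p = q + 1) : p - 1 = q.
Proof. by rewrite e addrK. Qed.
Let pred_eq1 (p q : int) (e : p = q + 1) : p - 1 = q - 1 + 1.
Proof. by rewrite e addrK subrK. Qed.

Let cd (p q : int) (e : p = q + 1) (u : cyl_mod p) : cyl_mod q :=
  (cx_d L e u.1 + tr L (pred_eq e) u.2.1,
   (- cx_d L (pred_eq1 e) u.2.1, - r q (G q (tr L (pred_eq e) u.2.1)))).

Let cd_linear p q e : linear (@cd p q e).
Proof.
move=> c u v; rewrite /cd; congr (_, (_, _)) => /=.
- by rewrite (linearP (cx_d _ _)) (linearP (tr _ _)) addrACA -scalerDr.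
- by rewrite linearP opprD -scalerN.
- by rewrite (linearP (tr _ _)) (linearP (G q)) (linearP (r q)) opprD -scalerN.
Qed.

(* Mapping cylinder of L -> H(P), with x, y, c in L, L[1], H(P):              *)
(* d(x, y, c) = (dx + y, - dy, - rG y).                                       *)
Definition cyl_cx : complex k.
Proof.
exists cyl_mod (fun p q e => mkLin (@cd_linear p q e)).
move=> p q o e1 e2 [x [y c]]; have qE : q = p - 1 by rewrite e1 addrK.
move: q qE e1 e2 => q -> e1 e2; have oE : o = p - 1 - 1 by rewrite e2 addrK.
subst o; rewrite !mkLinE /cd /= !tr_id; congr (_, (_, _)).
- by rewrite linearD dd0 add0r (eq_irrelevance (pred_eq1 e1) e2) subrr.
- by rewrite linearN (eq_irrelevance (pred_eq1 e2) (pred_eq1 (pred_eq1 e1))) dd0 !oppr0.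
- by rewrite !linearN opprK -cm_d rd.
Defined.

Let ca (t : 'S_m) p (u : cyl_mod p) : cyl_mod p :=
  (sc_act L t p u.1, (sc_act L t _ u.2.1, hmap (sc_act P t) p u.2.2)).
Let ca_linear t p : linear (@ca t p).
Proof. by move=> c u v; rewrite /ca !linearP. Qed.

Definition cyl_sc : scomplex k m.
Proof.
unshelve refine (@SComplex k m cyl_cx _ _ _).
- move=> t; exists (fun p => mkLin (@ca_linear t p)).
  move=> p q e [x [y c]]; have qE : q = p - 1 by rewrite e addrK.
  move: q qE e => q -> e; rewrite /= /cd /ca /= !tr_id; congr (_, (_, _)).
  + by rewrite cm_d linearD.
  + by rewrite cm_d linearN.
  + by rewrite GE rE linearN.
- move=> p [x [y c]]; rewrite /= /ca /= !sc_act1; congr (_, (_, _)).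
  elim/hclass_ind: c => z; rewrite -[LHS]/(hmap (sc_act P 1%g) p (hclass P p z)) hmapE.
  by apply: hclass_congr; rewrite /= sc_act1.
- move=> t u p [x [y c]]; rewrite /= /ca /= !sc_actM; congr (_, (_, _)).
  elim/hclass_ind: c => z.
  rewrite -[LHS]/(hmap (sc_act P (t * u)%g) p (hclass P p z)).
  rewrite -[RHS]/(hmap (sc_act P t) p (hmap (sc_act P u) p (hclass P p z))) !hmapE.
  by apply: hclass_congr; rewrite /= sc_actM.
Defined.

Definition cyl_inl : chain_map L cyl_sc.
Proof.
unshelve eexists.
- move=> p; apply: (mkLin (f := fun x : L p => (x, (0, 0)) : cyl_mod p)).
  have E (V : lmodType k) (c : k) : 0 = c *: (0 : V) + 0 by rewrite scaler0 addr0.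
  by move=> c u v; congr (_, (_, _)); exact: E.
- move=> p q e x; rewrite !mkLinE [LHS]/cd /=.
  by rewrite !linear0 addr0 ?oppr0.
Defined.

(** [G] on [L] and [s] on [H(P)]; the term with [h] accounts for the difference between [G y] and
    its representative [s (r (G y))], which makes the map commute with the differentials. Using
    [H(P)] rather than [P] keeps the cylinder finite dimensional. *)
Let ph p (u : cyl_mod p) : P p := G p u.1 + h (e0 p) (G (p - 1) u.2.1) + s p u.2.2.
Let ph_linear p : linear (@ph p).
Proof.
move=> c [x [y z]] [x' [y' z']]; rewrite /ph /= !linearP !scalerDr.
by rewrite [X in X + _ = _]addrACA [LHS]addrACA.
Qed.

Definition cyl_map : chain_map cyl_sc P.
Proof.
exists (fun p => mkLin (@ph_linear p)).
move=> p q e [x [y c]]; have qE : q = p - 1 by rewrite e addrK.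
move: q qE e => q -> e; rewrite !mkLinE /ph [in RHS]/= /cd /= !tr_id.
rewrite !linearD /= sd addr0 cm_d -!addrA; congr (_ + _).
rewrite !linearN (eq_irrelevance e (e0 p)) -(cm_d G) (eq_irrelevance (pred_eq1 _) (e0 (p - 1))).
have H := hh (e0 p) (e0 (p - 1)) (G _ y).
rewrite -[LHS](addrK (h (e0 (p - 1)) (cx_d P (e0 (p - 1)) (G (p - 1) y)))) -H.
by rewrite -addrA [X in _ + X = _]addrC.
Defined.

Lemma cyl_mapE p u : cyl_map p u = G p u.1 + h (e0 p) (G (p - 1) u.2.1) + s p u.2.2.
Proof. by []. Qed.

Lemma cyl_map_act t p u : cyl_map p (sc_act cyl_sc t p u) = sc_act P t p (cyl_map p u).
Proof. by rewrite !cyl_mapE /= !GE hE sE !linearD. Qed.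

Lemma cyl_map_inl p x : cyl_map p (cyl_inl p x) = G p x.
Proof. by rewrite cyl_mapE /= !linear0 !addr0. Qed.

Lemma cyl_inl_act t p x : cyl_inl p (sc_act L t p x) = sc_act cyl_sc t p (cyl_inl p x).
Proof. by rewrite /= /ca /= !linear0. Qed.

(** Modulo [H(P)] the cylinder is the cone of an identity, hence acyclic, and on [H(P)] the map is
    [s], which picks a representative of each class. *)
Lemma cyl_map_qi : quasi_iso cyl_map.
Proof.
apply/quasi_isoP; split=> p.
  move=> z [v dv].
  have := cyc_d z (e0 p).
  case E : (cyc_val z) => [x [y c]]; rewrite /= /cd /= !tr_id => -[d1 d2 d3].
  have yE : y = - cx_d L (e0 p) x := esym (addr0_eq d1).
  have rv : r p (cyl_map p (cyc_val z)) = 0 by rewrite -dv rd.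
  have := hh (erefl (p + 1)) (e0 p) (G p x).
  move: rv; rewrite E cyl_mapE /= yE !linearN -cm_d => rv H.
  have cE : c = - r p (G p x).
    apply/esym/addr0_eq; rewrite -[RHS]rv.
    rewrite [in RHS](linearD (r p)) rs; congr (_ + _).
    have -> : G p x - h (e0 p) (cx_d P (e0 p) (G p x)) =
        s p (r p (G p x)) + cx_d P erefl (h erefl (G p x)).
      apply/eqP; rewrite subr_eq -addrA -H addrC subrK.
      by [].
    by rewrite linearD rs rd addr0.
  (* The cycle equation gives [y = - d x] and the vanishing of the class gives [c = - r (G x)];
     these are the components of the boundary of [(0, x, 0)]. *)
  exists (0, (tr L (esym (addrK 1 p)) x, 0)); rewrite /= /cd /=.
  rewrite linear0 add0r (tr_tr _ _ erefl) cE; congr (_, (_, _)).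
  by congr (- _); rewrite (cx_d_tr _ _ (e0 p)).
move=> w; have z0 : (0, (0, hclass P p w)) \in @is_cycle k cyl_cx p.
  by apply/cycleP => q e; rewrite /= /cd /= !linear0 addr0.
exists (Cycles z0).
have /hclassP[y dy] : hclass P p w = hclass P p (cyc_map cyl_map (Cycles z0)).
  rewrite -[RHS]rz -[cyc_val (cyc_map _ _)]/(cyl_map p (0, (0, hclass P p w))) cyl_mapE.
  by rewrite [(_, _).1]/= [(_, _).2]/= !linear0 !add0r rs.
by exists y.
Qed.

End Cylinder.

(** * Finite generation *)

Section FinitelyGenerated.
Variable k : fieldType.
Implicit Types V W : lmodType k.

(** Spanning is phrased through submodules so that proofs need no explicit linear combinations. *)
Definition fgen V : Prop := exists s : seq V,
  forall S : submodule V, (forall v, v \in s -> S v) -> forall x, S x.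

Lemma fgen_surj V W (f : {linear V -> W}) : (forall y, exists x, f x = y) -> fgen V -> fgen W.
Proof.
move=> fs [s sP]; exists (map f s) => S Ss y; have [x <-] := fs y.
have S0 : S (f 0) by rewrite linear0; exact: sub_mem0.
have SL a u v : S (f u) -> S (f v) -> S (f (a *: u + v)).
  by move=> Su Sv; rewrite linearP; exact: sub_memL.
apply: (sP (Submodule (sub_mem := fun x => S (f x)) S0 SL)) => v vs /=.
by apply: Ss; exact: map_f.
Qed.

Lemma fgen_inj V W (f : {linear V -> W}) : injective f -> fgen W -> fgen V.
Proof.
move=> fi; have [g gP] := linear_regular f; apply: (fgen_surj (f := g)) => x.
by exists (f x); apply: fi; rewrite gP.
Qed.

(** A regular inverse of the map sending coefficients to their linear combination chooses
    coordinates linearly, even for dependent generators. *)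
Lemma fgen_coordinates V : fgen V -> exists (s : seq V) (c : {linear V -> 'rV[k]_(size s)}),
  forall x, x = \sum_j c x 0 j *: s`_j.
Proof.
move=> [s sP]; exists s; pose m := size s.
have FL : linear (fun c : 'rV[k]_m => \sum_(j < m) c 0 j *: s`_j).
  move=> a c c'; rewrite scaler_sumr -big_split /=; apply: eq_bigr => j _.
  by rewrite !mxE scalerDl scalerA.
have [G GP] := linear_regular (mkLin FL); exists G.
have S0 : 0 = mkLin FL (G 0) by rewrite !linear0.
have SL a u v : u = mkLin FL (G u) -> v = mkLin FL (G v) -> a *: u + v = mkLin FL (G (a *: u + v)).
  by move=> uE vE; rewrite (linearP G) (linearP (mkLin FL)) -uE -vE.
apply: (sP (Submodule (sub_mem := fun x => x = mkLin FL (G x)) S0 SL)) => v vs.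
have vm : (index v s < m)%N by rewrite index_mem.
have e : mkLin FL (delta_mx 0 (Ordinal vm)) = v.
  rewrite mkLinE (bigD1 (Ordinal vm)) //= mxE !eqxx scale1r nth_index // big1 ?addr0 //.
  by move=> j jv; rewrite mxE (negbTE jv) andbF scale0r.
by have := GP (delta_mx 0 (Ordinal vm)); rewrite e.
Qed.

Lemma fgen_prod V W : fgen V -> fgen W -> fgen (V * W)%type.
Proof.
move=> [s sP] [t tP].
exists ([seq (x, 0) | x <- s] ++ [seq (0, y) | y <- t]) => S SP [x y].
have -> : (x, y) = (x, 0) + (0, y) :> (V * W)%type.
  by rewrite -[RHS]/(x + 0, 0 + y) addr0 add0r.
apply: sub_memD.
- have S0 : S (0, 0) by exact: sub_mem0.
  have SL a u v : S (u, 0) -> S (v, 0) -> S (a *: u + v, 0).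
    move=> Su Sv; have := sub_memL a Su Sv; rewrite -[X in S X]/(a *: u + v, a *: 0 + 0).
    by rewrite scaler0 addr0.
  apply: (sP (Submodule (sub_mem := fun x => S (x, 0)) S0 SL)) => v vs /=.
  by apply: SP; rewrite mem_cat map_f.
- have S0 : S (0, 0) by exact: sub_mem0.
  have SL a u v : S (0, u) -> S (0, v) -> S (0, a *: u + v).
    move=> Su Sv; have := sub_memL a Su Sv; rewrite -[X in S X]/(a *: 0 + 0, a *: u + v).
    by rewrite scaler0 addr0.
  apply: (tP (Submodule (sub_mem := fun y => S (0, y)) S0 SL)) => v vs /=.
  by apply: SP; rewrite mem_cat orbC map_f.
Qed.

Lemma fgen_finite_dim V : finite_dim V -> fgen V.
Proof.
move=> [n [b bP]]; exists [seq b j | j <- enum 'I_n] => S SP x.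
have [c ->] := bP x; elim/big_ind: _ => [|u v|j _]; first exact: sub_mem0.
  exact: sub_memD.
by apply: sub_memZ; apply: SP; apply: map_f; rewrite mem_enum.
Qed.

(** The values of [f] lie in the span of a finite list; unlike [fgen], this applies to bilinear
    families. *)
Definition covered V (A : Type) (f : A -> V) : Prop := exists s : seq V,
  forall S : submodule V, (forall v, v \in s -> S v) -> forall a, S (f a).

Lemma covered_fin V (T : finType) (A : T -> Type) (f : forall t, A t -> V) :
  (forall t, covered (f t)) -> exists s : seq V,
  forall S : submodule V, (forall v, v \in s -> S v) -> forall t a, S (f t a).
Proof.
move=> /choice[s sP]; exists (flatten [seq s t | t <- enum T]) => S SP t a.
apply: sP => v vs; apply: SP; apply/flattenP; exists (s t) => //.
by apply: map_f; rewrite mem_enum.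
Qed.

Lemma covered_bilinear V (A B : lmodType k) (f : A -> B -> V) :
  (forall b, linear (f^~ b)) -> (forall a, linear (f a)) -> fgen A -> fgen B ->
  covered (fun x : A * B => f x.1 x.2).
Proof.
move=> fL fR [s sP] [t tP]; exists [seq f x y | x <- s, y <- t] => S SP [a b] /=.
have f0 b' : f 0 b' = 0 by have := fL b' (-1) 0 0; rewrite /= scaler0 addr0 scaleN1r addNr.
have f0' a' : f a' 0 = 0 by have := fR a' (-1) 0 0; rewrite /= scaler0 addr0 scaleN1r addNr.
have S0 : S (f 0 b) by rewrite f0; exact: sub_mem0.
have SL c u v : S (f u b) -> S (f v b) -> S (f (c *: u + v) b).
  by move=> Su Sv; rewrite fL; exact: sub_memL.
apply: (sP (Submodule (sub_mem := fun a => S (f a b)) S0 SL)) => x xs /= {a S0 SL}.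
have S0 : S (f x 0) by rewrite f0'; exact: sub_mem0.
have SL c u v : S (f x u) -> S (f x v) -> S (f x (c *: u + v)).
  by move=> Su Sv; rewrite fR; exact: sub_memL.
apply: (tP (Submodule (sub_mem := fun b => S (f x b)) S0 SL)) => y yt /=.
by apply: SP; apply/allpairsP; exists (x, y).
Qed.

Definition finite_cx (C : complex k) : Prop :=
  (exists s : seq int, forall p, p \notin s -> forall x : C p, x = 0) /\ forall p, fgen (C p).

Lemma fgen0 V : (forall x : V, x = 0) -> fgen V.
Proof. by move=> V0; exists [::] => S _ x; rewrite (V0 x); exact: sub_mem0. Qed.

End FinitelyGenerated.

Section UniversalFinite.
Variables (k : fieldType) (Q : operad k) (n : nat).
Hypothesis Qfin : forall l, finite_cx (Q l).

(** Compositions into label [n] involve finitely many labels, inputs and permutations. The degree of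
    the first factor ranges over a finite set and determines that of the second, and for fixed data
    the compositions are bilinear on finitely generated modules. *)
Lemma univ_fgen r : fgen (univ Q n r).
Proof.
have /choice[s sP] : forall l, exists s : seq int, forall p, p \notin s -> forall x : Q l p, x = 0.
  by move=> l; have [] := Qfin l.
pose L := 'I_n.+1; pose S (l : L) := seq_sub (s l).
have H (x : {lm : L * L & S lm.1}) : exists t : seq (univ Q n r),
    forall W : submodule (univ Q n r), (forall v, v \in t -> W v) ->
    forall i q (e : ((val (tag x).1).+1 + (val (tag x).2).+1 = n.+2)%N)
      (d : ssval (tagged x) + q = r) a b (g : 'S_n.+1),
      W (gm_act (univ Q n) g r (univ_sym e i d a b)).
  case: x => -[l m] p; rewrite /=.
  have [e|ne] := eqVneq (l.+1 + m.+1)%N n.+2; last by exists [::] => W _ i q e; rewrite e eqxx in ne.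
  have d : ssval p + (r - ssval p) = r by lia.
  have [|t tP] := @covered_fin k (univ Q n r) ('I_l.+1 * 'S_n.+1)%type
    (fun _ => (Q l (ssval p) * Q m (r - ssval p)%R)%type)
    (fun ig x => gm_act (univ Q n) ig.2 r (univ_sym e ig.1 d x.1 x.2)).
    move=> [i g]; apply: (covered_bilinear (f := fun a b => gm_act (univ Q n) g r (univ_sym e i d a b))).
    + by move=> b c u v; rewrite -linearP -(t_linl (univ_test Q n)).
    + by move=> a c u v; rewrite -linearP -(t_linr (univ_test Q n)).
    + exact: (Qfin l).2.
    + exact: (Qfin m).2.
  exists t => W Wt i q e' d' a b g; have qE : q = r - ssval p by rewrite -d' addrC addKr.
  subst q; rewrite (eq_irrelevance e' e) (eq_irrelevance d' d).
  exact: (tP W Wt (i, g) (a, b)).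
have /choice[t tP] := H.
exists (flatten [seq t x | x <- enum {: {lm : L * L & S lm.1}}]) => W WP.
apply: univ_ind => l m e i p q d a b g.
have [ps|ps] := boolP (p \in s l); last first.
  rewrite (sP l _ ps a) -[univ_sym _ _ _ _ _]/(t_fun (univ_test Q n) e i d 0 b) t0l linear0.
  exact: sub_mem0.
have lL : (l < n.+1)%N by lia.
have mL : (m < n.+1)%N by lia.
pose x : {lm : L * L & S lm.1} :=
  Tagged (fun lm : L * L => S lm.1) (SeqSub ps : S (Ordinal lL, Ordinal mL).1).
apply: (tP x W _ i q e d a b g) => v vt; apply: WP.
by apply/flattenP; exists (t x) => //; apply: map_f; rewrite mem_enum.
Qed.

Lemma univ_finite : finite_cx (univ_sc Q n).
Proof.
split; last exact: univ_fgen.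
have /choice[s sP] : forall l, exists s : seq int, forall p, p \notin s -> forall x : Q l p, x = 0.
  by move=> l; have [] := Qfin l.
exists (flatten [seq [seq p + q | p <- s l, q <- s m] | l <- iota 0 n.+1, m <- iota 0 n.+1]).
move=> r rs x.
have W0 : (0 : univ Q n r) = 0 by [].
have WL c (u v : univ Q n r) : u = 0 -> v = 0 -> c *: u + v = 0.
  by move=> -> ->; rewrite scaler0 addr0.
apply: (univ_ind (P := Submodule (sub_mem := fun x : univ Q n r => x = 0) W0 WL)) => l m e i p q d a b g.
rewrite -[sub_mem _ _]/(gm_act (univ Q n) g r (univ_sym e i d a b) = 0).
have [ps|ps] := boolP (p \in s l); last first.
  by rewrite (sP l _ ps a) -[univ_sym _ _ _ _ _]/(t_fun (univ_test Q n) e i d 0 b) t0l linear0.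
have [qs|qs] := boolP (q \in s m); last first.
  by rewrite (sP m _ qs b) -[univ_sym _ _ _ _ _]/(t_fun (univ_test Q n) e i d a 0) t0r linear0.
case/negP: rs; apply/flattenP; exists [seq p + q | p <- s l, q <- s m].
  by apply/allpairsP; exists (l, m); rewrite !mem_iota; split=> //=; lia.
by apply/allpairsP; exists (p, q).
Qed.

End UniversalFinite.

Section TestConstructions.
Variables (k : fieldType) (I : Type) (ar : I -> nat) (Q : operad_on k ar) (n : I).

Definition test_zero (X : gmod k (ar n)) : test Q X.
Proof.
exists (fun l m e i p q r d a b => 0).
- by move=> l m e i p q r d b c u v; rewrite scaler0 addr0.
- by move=> l m e i p q r d b c u v; rewrite scaler0 addr0.
- by move=> *; rewrite linear0.
- by [].
- by move=> *; rewrite scaler0.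
Defined.

Definition test_push (C D : scomplex k (ar n)) (f : chain_map C D)
    (fE : forall s p x, f p (sc_act C s p x) = sc_act D s p (f p x))
    (T : test Q (sc_gmod C)) : test Q (sc_gmod D).
Proof.
exists (fun l m e i p q r d a b => f r (t_fun T e i d a b)).
- by move=> l m e i p q r d b c u v; rewrite (t_linl T) linearP.
- by move=> l m e i p q r d b c u v; rewrite (t_linr T) linearP.
- by move=> l m e t i s p q r d a b; rewrite t_equiv fE.
- move=> l m c lm mc e1 e2 e3 e4 j i ji jiE p q r pq qr pqr d1 d2 d3 d4 a b x.
  by rewrite (t_assoc T e1 e2 e3 e4 jiE d1 d2 d3 d4).
- move=> l m c lm lc e1 e2 e3 e4 i j i' j' ij iE jE p q r pq pr pqr d1 d2 d3 d4 a b x.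
  by rewrite (t_comm T e1 e2 e3 e4 ij iE jE d1 d2 d3 d4) linearZ.
Defined.

Lemma test_push_bichain C D f fE T : is_bichain T -> is_bichain (@test_push C D f fE T).
Proof.
move=> Tb l m e i p q r p' q' r' d el er ep eq e' a b /=.
by rewrite cm_d (Tb _ _ e i _ _ _ _ _ _ d el er ep eq e') linearD linearZ.
Qed.

Lemma test_zero_bichain (C : scomplex k (ar n)) : is_bichain (test_zero (sc_gmod C)).
Proof. by move=> *; rewrite /= linear0 scaler0 addr0. Qed.

(** On generators both differentials are given by the Leibniz expression, on one side by
    [univ_bichain] and on the other by the hypothesis on [T]. *)
Lemma univ_lift_chain (C : scomplex k (ar n)) (T : test Q (sc_gmod C)) : is_bichain T ->
  exists F : chain_map (univ_sc Q n) C,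
    (forall s p x, F p (sc_act (univ_sc Q n) s p x) = sc_act C s p (F p x)) /\
    (forall l m (e : (ar l + ar m = (ar n).+1)%N) i p q r (d : p + q = r) a b,
       F r (univ_sym e i d a b) = t_fun T e i d a b).
Proof.
move=> Tb.
have Fd (p q : int) (e : p = q + 1) (x : univ Q n p) :
    cx_d C e (univ_lift T p x) = univ_lift T q (cx_d (univ_sc Q n) e x).
  have W0 : cx_d C e (univ_lift T p 0) = univ_lift T q (cx_d (univ_sc Q n) e 0).
    by rewrite !linear0.
  have WL c u v : cx_d C e (univ_lift T p u) = univ_lift T q (cx_d (univ_sc Q n) e u) ->
      cx_d C e (univ_lift T p v) = univ_lift T q (cx_d (univ_sc Q n) e v) ->
      cx_d C e (univ_lift T p (c *: u + v)) = univ_lift T q (cx_d (univ_sc Q n) e (c *: u + v)).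
    by move=> uE vE; rewrite !linearP uE vE.
  apply: (univ_ind (P := Submodule (sub_mem := fun x : univ Q n p =>
    cx_d C e (univ_lift T p x) = univ_lift T q (cx_d (univ_sc Q n) e x)) W0 WL)).
  move=> l m e1 i p1 q1 d a b s.
  rewrite -[sub_mem _ _]/(cx_d C e (univ_lift T p (gm_act (univ Q n) s p (univ_sym e1 i d a b))) =
    univ_lift T q (cx_d (univ_sc Q n) e (sc_act (univ_sc Q n) s p (univ_sym e1 i d a b)))).
  have el : p1 - 1 + q1 = q by lia.
  have er : p1 + (q1 - 1) = q by lia.
  pose e0 (p : int) : p = p - 1 + 1 := esym (subrK 1 p).
  rewrite cm_d univ_lift_act [in RHS]univ_lift_act univ_lift_sym cm_d.
  rewrite (Tb _ _ e1 i _ _ _ _ _ _ d el er (e0 p1) (e0 q1) e).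
  have := @univ_bichain k I ar Q n _ _ e1 i _ _ _ _ _ _ d el er (e0 p1) (e0 q1) e a b.
  rewrite /univ_sctest !univ_testE => ->.
  by rewrite (linearD (univ_lift T q)) [univ_lift T q (_ *: _)]linearZZ !univ_lift_sym.
exists (@ChainMap k (univ_sc Q n) C (univ_lift T) Fd).
split=> [s p x|l m e i p q r d a b]; first exact: (univ_lift_act T s x).
exact: (univ_lift_sym T e i d a b).
Qed.

End TestConstructions.

Section SquareZeroExtension.
Variables (k : fieldType) (I : Type) (ar : I -> nat) (Q : operad_on k ar).
Variables (Y : forall l, scomplex k (ar l)) (T : forall n, test Q (sc_gmod (Y n))).
Hypothesis Tb : forall n, is_bichain (T n).

Definition ext_mod (l : I) (p : int) : lmodType k := (Q l p * Y l p)%type.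

Let ed l (p q : int) (e : p = q + 1) (x : ext_mod l p) : ext_mod l q :=
  (cx_d (Q l) e x.1, cx_d (Y l) e x.2).
Let ed_linear l p q e : linear (@ed l p q e).
Proof. by move=> a u v; rewrite /ed !linearP. Qed.

Definition ext_cx (l : I) : complex k.
Proof.
exists (ext_mod l) (fun p q e => mkLin (@ed_linear l p q e)).
by move=> p q r e1 e2 x; congr (_, _); exact: cx_dd.
Defined.

Let ea l s p (x : ext_mod l p) : ext_mod l p := (op_act Q s p x.1, sc_act (Y l) s p x.2).
Let ea_linear l s p : linear (@ea l s p).
Proof. by move=> a u v; rewrite /ea !linearP. Qed.

Definition ext_act (l : I) (s : 'S_(ar l)) : chain_map (ext_cx l) (ext_cx l).
Proof.
exists (fun p => mkLin (@ea_linear l s p)).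
by move=> *; congr (_, _); exact: cm_d.
Defined.

(** Compositions read only the components in [Q], so [Y] composes to zero with everything, and the
    operad axioms in [Y] are exactly the axioms of the tests [T]. *)
Definition ext_comp l m n (e : (ar l + ar m = (ar n).+1)%N) (i : 'I_(ar l)) :
  bichain_map (ext_cx l) (ext_cx m) (ext_cx n).
Proof.
exists (fun p q r d (a : ext_mod l p) (b : ext_mod m q) =>
          (bm_fun (op_comp Q e i) d a.1 b.1, t_fun (T n) e i d a.1 b.1) : ext_mod n r).
- by move=> p q r d b a u v; congr (_, _); [exact: bm_linl | exact: (t_linl (T n))].
- by move=> p q r d b a u v; congr (_, _); [exact: bm_linr | exact: (t_linr (T n))].
- by move=> *; congr (_, _); [exact: bm_d | exact: Tb].
Defined.

Definition extop : operad_on k ar.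
Proof.
exists ext_cx ext_act ext_comp.
- by move=> l p [x y]; congr (_, _); [exact: op_act1 | exact: sc_act1].
- by move=> *; congr (_, _); [exact: op_actM | exact: sc_actM].
- by move=> *; congr (_, _); [exact: op_equiv | exact: (t_equiv (T _))].
- by move=> *; congr (_, _); [exact: op_assoc | exact: (t_assoc (T _))].
- by move=> *; congr (_, _); [exact: op_comm | exact: (t_comm (T _))].
Defined.

Definition ext_fst : operad_mor extop Q.
Proof.
unshelve eexists.
- move=> l; exists (fun p => mkLin (f := fun x : ext_mod l p => x.1) (fun a u v => erefl)).
  by [].
- by [].
- by [].
Defined.

End SquareZeroExtension.

(** * Adding one arity to the model *)

Section Stage.
Variables (k : fieldType) (char_k : [pchar k] =i pred0) (P : operad k).
Hypothesis Pfin : homology_finite_type P.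

(** An approximation of [P] up to label [n], that is arity [n + 1], and zero beyond. As [Q] vanishes
    above [n], multiplicativity of [F] is demanded only for results in labels at most [n]. *)
Record stage (n : nat) (Q : operad k) (F : forall l, chain_map (Q l) (P l)) : Prop := Stage {
  st_zero : forall p (x : Q 0%N p), x = 0;
  st_bound : forall l, (n < l)%N -> forall p (x : Q l p), x = 0;
  st_fin : forall l, finite_cx (Q l);
  st_act : forall l s p x, F l p (op_act Q s p x) = op_act P (l := l) s p (F l p x);
  st_comp : forall l m r (e : (l.+1 + m.+1 = r.+2)%N) i p q o (d : p + q = o) a b, (r <= n)%N ->
    F r o (bm_fun (@op_comp _ _ _ Q l m r e i) d a b) =
    bm_fun (@op_comp _ _ _ P l m r e i) d (F l p a) (F m q b);
  st_qi : forall l, (l <= n)%N -> quasi_iso (F l);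
  st_cof : cofibrant_at Q n }.

Section Step.
Variables (n : nat) (Q : operad k) (F : forall l, chain_map (Q l) (P l)).
Hypothesis QF : stage n F.

Let N := n.+1.

Let zero_or_pos l p (x : Q l p) : x = 0 \/ (0 < l)%N.
Proof. by case: l x => [|l] x; [left; exact: (st_zero QF) | right]. Qed.

(** Because [Q(1) = 0], the inner compositions in the axioms land in labels at most [n], where [F]
    is multiplicative. *)
Let product_test : exists T : test Q (n := N) (sc_gmod (op_sc P N)),
  is_bichain T /\
  forall l m e i p q r d a b, @t_fun _ _ _ _ _ _ T l m e i p q r d a b =
    bm_fun (@op_comp _ _ _ P l m N e i) d (F l p a) (F m q b).
Proof.
unshelve eexists.
  exists (fun l m e i p q r d a b => bm_fun (@op_comp _ _ _ P l m N e i) d (F l p a) (F m q b)).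
  + by move=> l m e i p q r d b a u v; rewrite linearP bm_linl.
  + by move=> l m e i p q r d a b u v; rewrite linearP bm_linr.
  + by move=> l m e t i s p q r d a b; rewrite !(st_act QF) op_equiv.
  + move=> l m c lm mc e1 e2 e3 e4 j i ji jiE p q r pq qr pqr d1 d2 d3 d4 a b x.
    have [->|a1] := zero_or_pos a; first by rewrite !(bm0l, linear0).
    have [->|b1] := zero_or_pos b; first by rewrite !(bm0l, bm0r, linear0).
    have [->|x1] := zero_or_pos x; first by rewrite !(bm0r, linear0).
    by rewrite !(st_comp QF) ?(op_assoc e1 e2 e3 e4 jiE d1 d2 d3 d4) //; rewrite /N in e2 e4; lia.
  + move=> l m c lm lc e1 e2 e3 e4 i j i' j' ij iE jE p q r pq pr pqr d1 d2 d3 d4 a b x.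
    have [->|a1] := zero_or_pos a; first by rewrite !(bm0l, linear0, scaler0).
    have [->|b1] := zero_or_pos b; first by rewrite !(bm0l, bm0r, linear0, scaler0).
    have [->|x1] := zero_or_pos x; first by rewrite !(bm0l, bm0r, linear0, scaler0).
    by rewrite !(st_comp QF) ?(op_comm e1 e2 e3 e4 ij iE jE d1 d2 d3 d4) //; rewrite /N in e2 e4; lia.
split=> //.
move=> l m e i p q r p' q' r' d el er ep eq e' a b /=.
by rewrite (bm_d _ _ el er ep eq) !cm_d.
Qed.

(** The component to be added in label [N]: it contains the formal compositions as an equivariant
    retract through [c_pr], which yields cofibrancy, and it maps quasi-isomorphically to [P]. Cells
    are taken at all labels since [extop] expects a family; [only_at] then discards those away from
    [N]. *)
Record cell (l : nat) := Cell {
  c_cx : scomplex k l.+1;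
  c_inl : chain_map (univ_sc Q l) c_cx;
  c_map : chain_map c_cx (P l);
  c_pr : forall p, {linear c_cx p -> univ Q l p};
  c_inlE : forall t p x, c_inl p (sc_act (univ_sc Q l) t p x) = sc_act c_cx t p (c_inl p x);
  c_mapE : forall t p x, c_map p (sc_act c_cx t p x) = op_act P t p (c_map p x);
  c_prE : forall t p x, c_pr p (sc_act c_cx t p x) = gm_act (univ Q l) t p (c_pr p x);
  c_prK : forall p x, c_pr p (c_inl p x) = x;
  c_qi : quasi_iso c_map;
  c_fin : finite_cx c_cx;
  c_sym : l = N -> forall a b (e : (a.+1 + b.+1 = l.+2)%N) i p q r (d : p + q = r) x y,
    c_map r (c_inl r (@univ_sym _ _ _ Q l a b e i p q r d x y)) =
    bm_fun (@op_comp _ _ _ P a b l e i) d (F a p x) (F b q y) }.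

(** The cell is the cylinder of the map from formal compositions to [P], given by composing in [P]
    at label [N] and zero at other labels. *)
Lemma cell_exists l : exists c : cell l, True.
Proof.
have [G [GE GP]] : exists G : chain_map (univ_sc Q l) (op_sc P l),
    (forall t p x, G p (sc_act (univ_sc Q l) t p x) = sc_act (op_sc P l) t p (G p x)) /\
    (l = N -> forall a b (e : (a.+1 + b.+1 = l.+2)%N) i p q r (d : p + q = r) x y,
      G r (@univ_sym _ _ _ Q l a b e i p q r d x y) =
      bm_fun (@op_comp _ _ _ P a b l e i) d (F a p x) (F b q y)).
  have [lN|lN] := eqVneq l N; last first.
    exists (@ChainMap k (univ_sc Q l) (P l) (fun p => \0) (fun p q e x => linear0 _)).
    by split=> [t p x|lN']; [rewrite /= linear0 | rewrite lN' eqxx in lN].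
  have [muT [muTb muE]] := product_test.
  have [GN [GNE GNs]] := univ_lift_chain muTb.
  subst l; exists GN; split=> // _ a b e i p q r d x y.
  by rewrite GNs muE.
have [s [r [h [sd rz rs hh [sE rE hE]]]]] := equivariant_contraction char_k (op_sc P l).
have prL p : linear (fun u : cyl_mod (univ_sc Q l) (op_sc P l) p => u.1 : univ Q l p) by [].
unshelve eexists => //.
unshelve refine (@Cell l (cyl_sc GE rz rE) (cyl_inl GE rz rE) (cyl_map GE sd rz hh rE)
  (fun p => mkLin (prL p)) _ _ _ _ _ _ _) => //.
- exact: cyl_inl_act.
- exact: (cyl_map_act sd hh sE hE).
- exact: (cyl_map_qi GE sd rz rs hh rE).
- have [[su suP] ufg] := univ_finite l (st_fin QF).
  have [[sh shP] hfg] := Pfin l.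
  split=> [|p]; last first.
    apply: fgen_prod; first exact: ufg.
    by apply: fgen_prod; [exact: ufg | apply: fgen_finite_dim; exact: hfg].
  exists (su ++ [seq p + 1 | p <- su] ++ sh) => p; rewrite !mem_cat !negb_or.
  move=> /and3P[p1 p2 p3] [x [y c]].
  have p2' : p - 1 \notin su.
    by apply: contra p2 => p2; apply/mapP; exists (p - 1); rewrite ?subrK.
  by rewrite (suP _ p1 x) (suP _ p2' y) (shP _ p3 c).
- by move=> lN a b e i p q o d x y; rewrite cyl_map_inl GP.
Qed.

Section Attach.
Variable c : forall l, cell l.

Let Y l := c_cx (c l).

Definition attach_test l : test Q (n := l) (sc_gmod (Y l)) :=
  if l == N then test_push (@c_inlE l (c l)) (univ_sctest Q l) else test_zero Q (n := l) (sc_gmod (Y l)).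

Lemma attach_bichain l : is_bichain (attach_test l).
Proof.
rewrite /attach_test; case: eqP => _; last exact: test_zero_bichain.
by apply: test_push_bichain; exact: univ_bichain.
Qed.

Lemma attach_testN a b (e : (a.+1 + b.+1 = N.+2)%N) i p q r (d : p + q = r) x y :
  @t_fun _ _ _ _ _ _ (attach_test N) a b e i p q r d x y =
  c_inl (c N) r (@univ_sym _ _ _ Q N a b e i p q r d x y).
Proof. by rewrite /attach_test eqxx. Qed.

Lemma attach_test0 l a b e i p q r (d : p + q = r) x y : l <> N ->
  @t_fun _ _ _ _ _ _ (attach_test l) a b e i p q r d x y = 0.
Proof. by rewrite /attach_test; case: eqP. Qed.

Let E : operad k := extop attach_bichain.

Let only_at l p (u : E l p) : Prop := l <> N -> u.2 = 0.
Let only_at0 l p : only_at (0 : E l p).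
Proof. by []. Qed.
Let only_atL l p a (u v : E l p) : only_at u -> only_at v -> only_at (a *: u + v).
Proof.
move=> uE vE lN; rewrite -[LHS]/(a *: u.2 + v.2) uE // vE //.
by rewrite scaler0 addr0.
Qed.
Let Wa l p : submodule (E l p) := Submodule (@only_at0 l p) (@only_atL l p).

Let Wa_d l (p q : int) (e : p = q + 1) x : Wa l p x -> Wa l q (cx_d (E l) e x).
Proof. by move=> xE lN; rewrite -[LHS]/(cx_d (Y l) e x.2) xE // linear0. Qed.
Let Wa_act l s p x : Wa l p x -> Wa l p (op_act E (l := l) s p x).
Proof. by move=> xE lN; rewrite -[LHS]/(sc_act (Y l) s p x.2) xE // linear0. Qed.
Let Wa_comp l m r e i p q o (d : p + q = o) a b :
  Wa l p a -> Wa m q b -> Wa r o (bm_fun (@op_comp _ _ _ E l m r e i) d a b).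
Proof. by move=> aE bE lN; exact: attach_test0. Qed.

Definition attached : operad k := subop Wa_d Wa_act Wa_comp.
Definition attached_incl : operad_mor attached E := subop_incl Wa_d Wa_act Wa_comp.
Definition attached_fst : operad_mor attached Q := om_cmp (ext_fst attach_bichain) attached_incl.

Let F'fun l p (u : attached l p) : P l p := F l p (mval u).1 + c_map (c l) p (mval u).2.
Let F'lin l p : linear (@F'fun l p).
Proof.
move=> a u v; rewrite /F'fun -[mval _]/(a *: mval u + mval v) /= !linearP.
by rewrite addrACA scalerDr.
Qed.
Definition attached_map l : chain_map (attached l) (P l).
Proof.
exists (fun p => mkLin (@F'lin l p)).
by move=> p q e u; rewrite !mkLinE /F'fun linearD !cm_d.
Defined.

Let zero_or_pos' l p (x : attached l p) : x = 0 \/ (0 < l)%N.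
Proof.
case: l x => [|l] x; [left | by right].
apply: val_inj; apply: injective_projections; first exact: (st_zero QF).
by have := msubP x; apply.
Qed.

Let snd0 l p (u : attached l p) : l <> N -> (mval u).2 = 0.
Proof. exact: (msubP u). Qed.

Let addN_lt l m r (e : (l.+1 + m.+1 = r.+2)%N) : (0 < l)%N -> (0 < m)%N -> (r <= N)%N ->
  (l <= n)%N /\ (m <= n)%N.
Proof. by rewrite /N; lia. Qed.

Let jl l p (a : Q l p) : attached l p :=
  mksub (W := Wa l p) (x := (a, 0) : E l p) (fun _ => erefl).
Let jl_linear l p : linear (@jl l p).
Proof.
move=> a u v; apply: val_inj; rewrite -[RHS]/(a *: (u, 0) + (v, 0) : E l p).
by rewrite -[RHS]/(a *: u + v, a *: 0 + 0) scaler0 addr0.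
Qed.
Let jl_act l s p a : jl (op_act Q (l := l) s p a) = op_act attached s p (jl a).
Proof.
by apply: val_inj; rewrite -[RHS]/(op_act Q s p a, sc_act (Y l) s p 0) linear0.
Qed.
Let jl_comp l m r e i p q o (d : p + q = o) a b : r <> N ->
  jl (bm_fun (@op_comp _ _ _ Q l m r e i) d a b) =
  bm_fun (@op_comp _ _ _ attached l m r e i) d (jl a) (jl b).
Proof.
move=> rN; apply: val_inj.
rewrite -[RHS]/(bm_fun (@op_comp _ _ _ Q l m r e i) d a b,
   @t_fun _ _ _ _ _ _ (attach_test r) l m e i p q o d a b).
by rewrite attach_test0.
Qed.
Let jlK l p (u : attached l p) : l <> N -> u = jl (mval u).1.
Proof.
by move=> lN; apply: val_inj; apply: injective_projections => //; exact: snd0.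
Qed.

(** The section [jl] respects compositions away from [N], so a test on the new operad restricts to
    one on [Q]. That test factors through the universal module, onto which the cell retracts. *)
Lemma attached_cof : cofibrant_at attached N.
Proof.
move=> X T.
have : exists T' : test Q (n := N) X, forall l m e i p q r d a b,
    @t_fun _ _ _ _ _ _ T' l m e i p q r d a b = @t_fun _ _ _ _ _ _ T l m e i p q r d (jl a) (jl b).
  unshelve eexists.
    exists (fun l m e i p q r d a b => @t_fun _ _ _ _ _ _ T l m e i p q r d (jl a) (jl b)).
    + by move=> l m e i p q r d b a u v; rewrite jl_linear (t_linl T).
    + by move=> l m e i p q r d b a u v; rewrite jl_linear (t_linr T).
    + by move=> l m e t i s p q r d a b; rewrite !jl_act (t_equiv T).
    + move=> l m x lm mx e1 e2 e3 e4 j i ji jiE p q r pq qr pqr d1 d2 d3 d4 a b y.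
      have j0 l0 p0 : jl (0 : Q l0 p0) = 0 := linear0 (mkLin (@jl_linear l0 p0)).
      have [->|a1] := zero_or_pos a; first by rewrite bm0l !j0 !t0l.
      have [->|b1] := zero_or_pos b; first by rewrite bm0l bm0r !j0 t0l t0r.
      have [->|x1] := zero_or_pos y; first by rewrite bm0r !j0 !t0r.
      have lmN : lm <> N by move=> lmN; move: e2; rewrite lmN; lia.
      have mxN : mx <> N by move=> mxN; move: e4; rewrite mxN; lia.
      by rewrite !jl_comp // (t_assoc T e1 e2 e3 e4 jiE d1 d2 d3 d4).
    + move=> l m x lm lx e1 e2 e3 e4 i j i' j' ij iE jE p q r pq pr pqr d1 d2 d3 d4 a b y.
      have j0 l0 p0 : jl (0 : Q l0 p0) = 0 := linear0 (mkLin (@jl_linear l0 p0)).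
      have [->|a1] := zero_or_pos a; first by rewrite !bm0l !j0 !t0l scaler0.
      have [->|b1] := zero_or_pos b; first by rewrite bm0r !j0 t0l t0r scaler0.
      have [->|x1] := zero_or_pos y; first by rewrite bm0r !j0 t0l t0r scaler0.
      have lmN : lm <> N by move=> lmN; move: e2; rewrite lmN; lia.
      have lxN : lx <> N by move=> lxN; move: e4; rewrite lxN; lia.
      by rewrite !jl_comp // (t_comm T e1 e2 e3 e4 ij iE jE d1 d2 d3 d4).
  by [].
move=> [T' T'E].
have hL p : linear (fun u : attached N p => univ_lift T' p (c_pr (c N) p (mval u).2)).
  move=> a u v; rewrite -[mval _]/(a *: mval u + mval v) -[(_ + _).2]/(a *: (mval u).2 + (mval v).2).
  by rewrite !linearP.
exists (fun p => mkLin (hL p)); split.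
  move=> s p u; rewrite !mkLinE -[LHS]/(univ_lift T' p (c_pr (c N) p (sc_act (Y N) s p (mval u).2))).
  by rewrite c_prE univ_lift_act.
move=> l m e i p q r d u v; rewrite mkLinE.
rewrite -[LHS]/(univ_lift T' r (c_pr (c N) r
  (@t_fun _ _ _ _ _ _ (attach_test N) l m e i p q r d (mval u).1 (mval v).1))).
rewrite attach_testN c_prK univ_lift_sym T'E.
have j0 l0 p0 : jl (mval (0 : attached l0 p0)).1 = 0 := linear0 (mkLin (@jl_linear l0 p0)).
have [->|u1] := zero_or_pos' u; first by rewrite j0 !t0l.
have [->|v1] := zero_or_pos' v; first by rewrite j0 !t0r.
by rewrite -!jlK // => E0; move: e; rewrite E0; lia.
Qed.

Lemma attached_stage : stage N attached_map.
Proof.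
split.
- by move=> p x; have [->|] := zero_or_pos' x.
- move=> l Nl p x; have lN : l <> N by move=> lN; rewrite lN ltnn in Nl.
  apply: val_inj; apply: injective_projections; last exact: snd0.
  by apply: (st_bound QF); apply: ltn_trans Nl.
- move=> l; have [[sQ sQP] Qfg] := st_fin QF l; have [[sY sYP] Yfg] := c_fin (c l).
  split=> [|p]; last first.
    apply: (fgen_inj (f := attached_incl l p)); first exact: val_inj.
    exact: fgen_prod.
  exists (sQ ++ sY) => p; rewrite mem_cat negb_or => /andP[pQ pY] x.
  by apply: val_inj; apply: injective_projections; [exact: sQP | exact: sYP].
- move=> l s p u; rewrite !mkLinE /F'fun.
  by rewrite [(mval _).1]/= [(mval _).2]/= (st_act QF) c_mapE linearD.
- move=> l m r e i p q o d u v rN.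
  have [->|u1] := zero_or_pos' u; first by rewrite bm0l !linear0 bm0l.
  have [->|v1] := zero_or_pos' v; first by rewrite bm0r !linear0 bm0r.
  have [ln mn] := addN_lt e u1 v1 rN.
  have lN : l <> N by rewrite /N => lN; rewrite lN ltnn in ln.
  have mN : m <> N by rewrite /N => mN; rewrite mN ltnn in mn.
  rewrite !mkLinE /F'fun (snd0 u lN) (snd0 v mN) !linear0 !addr0.
  rewrite -[(mval _).1]/(bm_fun (@op_comp _ _ _ Q l m r e i) d (mval u).1 (mval v).1).
  rewrite -[(mval _).2]/(@t_fun _ _ _ _ _ _ (attach_test r) l m e i p q o d (mval u).1 (mval v).1).
  have [rE|rE] := eqVneq r N.
    subst r; rewrite attach_testN c_sym // [bm_fun _ _ (mval u).1 _](st_bound QF) //.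
    by rewrite linear0 add0r.
  rewrite attach_test0; last exact/eqP.
  by rewrite linear0 addr0 (st_comp QF) // -ltnS ltn_neqAle rE.
- move=> l; rewrite leq_eqVlt => /orP[/eqP lN|lN].
    subst l; apply: (@quasi_iso_ext _ _ _ (cm_comp (c_map (c N))
      (@ChainMap k (attached N) (Y N)
        (fun p => mkLin (f := fun u : attached N p => (mval u).2) (fun a u v => erefl))
        (fun p q e u => erefl)))).
      move=> p u; rewrite -[RHS]/(F'fun u) /F'fun [(mval u).1](st_bound QF) //.
      by rewrite linear0 add0r.
    apply: quasi_iso_comp (c_qi (c N)) _; apply: bijective_quasi_iso => p.
    apply/bijectiveP; split.
      move=> u v uv; apply: val_inj; apply: injective_projections; last exact: uv.
      by rewrite [LHS](st_bound QF) // [RHS](st_bound QF).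
    move=> y; have H : Wa N p ((0, y) : E N p) by [].
    by exists (mksub H).
  have lN' : l <> N by move=> lN'; rewrite lN' ltnn in lN.
  apply: (@quasi_iso_ext _ _ _ (cm_comp (F l) (attached_fst l))).
    by move=> p u; rewrite -[RHS]/(F'fun u) /F'fun snd0 // linear0 addr0.
  apply: quasi_iso_comp (st_qi QF lN) _; apply: bijective_quasi_iso => p.
  exists (@jl l p) => [u|//]; exact/esym/jlK.
- exact: attached_cof.
Qed.

Lemma attached_fst_surj l p y : exists x, attached_fst l p x = y.
Proof. by exists (jl y). Qed.

End Attach.

Lemma stage_step : exists (Q' : operad k) (F' : forall l, chain_map (Q' l) (P l))
    (pi : operad_mor Q' Q),
  [/\ stage N F', forall l p x, (l <= n)%N -> F' l p x = F l p (pi l p x),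
      forall l p y, exists x, pi l p x = y
    & forall l p, (l <= n)%N -> injective (pi l p)].
Proof.
have /dep_choice[c _] := cell_exists.
exists (attached c), (attached_map c), (attached_fst c); split.
- exact: attached_stage.
- move=> l p u ln; have lN : l <> N by rewrite /N => lN; rewrite lN ltnn in ln.
  have := msubP u => /(_ lN) u2.
  by rewrite -[LHS]/(F l p (mval u).1 + c_map (c l) p (mval u).2) u2 linear0 addr0.
- exact: attached_fst_surj.
- move=> l p ln u v uv; have lN : l <> N by rewrite /N => lN; rewrite lN ltnn in ln.
  apply: val_inj; apply: injective_projections; first exact: uv.
  by rewrite (msubP u lN) (msubP v lN).
Qed.

End Step.
End Stage.

(** Above [n] one lifts step by step, below [n] one applies the projections; shifting the tower by
    one reduces to [n = 0]. *)
Lemma tower_surj (A : nat -> Type) (pi : forall n, A n.+1 -> A n) :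
  (forall n y, exists x, pi n x = y) ->
  forall n (x : A n), exists f : forall m, A m, (forall m, pi m (f m.+1) = f m) /\ f n = x.
Proof.
move=> ps n; elim: n A pi ps => [|n IH] A pi ps x.
  have /dep_choice[s sP] : forall m, exists s : A m -> A m.+1, forall y, pi m (s y) = y.
    by move=> m; have [s sP] := choice (ps m); exists s.
  by exists (nat_rect A x s); split=> // m; exact: sP.
have [f [fP fn]] := IH (fun m => A m.+1) (fun m => pi m.+1) (fun m => ps m.+1) x.
by exists (fun m => match m with 0%N => pi 0%N (f 0%N) | m'.+1 => f m' end); split=> // -[|m].
Qed.

(** * The model as the limit of a tower *)

Section Model.
Variables (k : fieldType) (char_k : [pchar k] =i pred0) (P : operad k).
Hypothesis P1 : homology_arity1_trivial P.
Hypothesis Pfin : homology_finite_type P.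

Record level (n : nat) := Level {
  lv_op : operad k;
  lv_map : forall l, chain_map (lv_op l) (P l);
  lv_stage : stage n lv_map }.

(** The zero operad approximates [P] in arity 1 because [HP(1) = 0]. *)
Lemma level0_exists : exists x : level 0, True.
Proof.
have W0 l p : (0 : P l p) = 0 by [].
have WL l p (a : k) (u v : P l p) : u = 0 -> v = 0 -> a *: u + v = 0.
  by move=> -> ->; rewrite scaler0 addr0.
pose W l p := Submodule (sub_mem := fun x : P l p => x = 0) (W0 l p) (WL l p).
have Wd l (p q : int) (e : p = q + 1) x : W l p x -> W l q (cx_d (P l) e x).
  by move=> xE; rewrite (xE : x = 0); exact: linear0.
have Wa l s p x : W l p x -> W l p (op_act P (l := l) s p x).
  by move=> xE; rewrite (xE : x = 0); exact: linear0.
have Wc l m n (e : (l.+1 + m.+1 = n.+2)%N) i p q r (d : p + q = r) a b :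
    W l p a -> W m q b -> W n r (bm_fun (@op_comp _ _ _ P l m n e i) d a b).
  by move=> aE _; rewrite (aE : a = 0); exact: bm0l.
pose Z : operad k := subop Wd Wa Wc.
have Z0 l p (x : Z l p) : x = 0 by apply: val_inj; exact: (msubP x).
pose f : operad_mor Z P := subop_incl Wd Wa Wc.
unshelve eexists => //; exists Z (fun l => f l); split.
- by move=> p x; exact: Z0.
- by move=> l _ p x; exact: Z0.
- move=> l; split; first by exists [::] => p _ x; exact: Z0.
  by move=> p; apply: fgen0 => x; exact: Z0.
- by move=> l s p x; rewrite om_act.
- by move=> l m r e i p q o d a b _; rewrite om_comp.
- move=> l; rewrite leqn0 => /eqP -> p; apply/bijectiveP; split.
    move=> x y _; elim/hclass_ind: x => x; elim/hclass_ind: y => y.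
    by apply: hclass_congr; rewrite (Z0 _ _ (cyc_val x)) (Z0 _ _ (cyc_val y)).
  by move=> y; exists 0; rewrite linear0 (P1 y).
- move=> X T; exists (fun p => \0); split=> [s p x|l m e i p q r d a b].
    by rewrite /= linear0.
  by rewrite (Z0 _ _ a) t0l.
Qed.

Record next_level n (x : level n) := NextLevel {
  nx_level : level n.+1;
  nx_pi : operad_mor (lv_op nx_level) (lv_op x);
  nx_map : forall l p y, (l <= n)%N -> lv_map nx_level l p y = lv_map x l p (nx_pi l p y);
  nx_surj : forall l p y, exists z, nx_pi l p z = y;
  nx_inj : forall l p, (l <= n)%N -> injective (nx_pi l p) }.

Lemma next_level_exists n (x : level n) : exists y : next_level x, True.
Proof.
have [Q' [F' [pi [st Fpi ps pj]]]] := stage_step char_k Pfin (lv_stage x).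
by exists (@NextLevel n x (Level st) pi Fpi ps pj).
Qed.

Definition next n (x : level n) : next_level x := projT1 (cid (next_level_exists x)).

Fixpoint tower n : level n :=
  match n with
  | 0%N => projT1 (cid level0_exists)
  | m.+1 => nx_level (next (tower m))
  end.

Let Q n : operad k := lv_op (tower n).
Let pi n : operad_mor (Q n.+1) (Q n) := nx_pi (next (tower n)).
Let F n l : chain_map (Q n l) (P l) := lv_map (tower n) l.
Let QF n : stage n (F n) := lv_stage (tower n).
Let Fpi n l p y : (l <= n)%N -> F n.+1 l p y = F n l p (pi n l p y).
Proof. exact: nx_map. Qed.
Let pi_surj n l p y : exists z, pi n l p z = y.
Proof. exact: nx_surj. Qed.
Let pi_inj n l p : (l <= n)%N -> injective (pi n l p).
Proof. exact: nx_inj. Qed.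

Let B : operad k := prodop Q.

Let compat l p (x : B l p) : Prop := forall n, pi n l p (x n.+1) = x n.
Let compat0 l p : compat (0 : B l p).
Proof. by move=> n; exact: linear0. Qed.
Let compatL l p a (u v : B l p) : compat u -> compat v -> compat (a *: u + v).
Proof.
move=> uE vE n; rewrite -[RHS]/(a *: u n + v n) -uE -vE.
by rewrite -linearP.
Qed.
Let W l p : submodule (B l p) := Submodule (@compat0 l p) (@compatL l p).
Let Wd l (p q : int) (e : p = q + 1) x : W l p x -> W l q (cx_d (B l) e x).
Proof. by move=> xE n; rewrite -[RHS]/(cx_d (Q n l) e (x n)) -xE cm_d. Qed.
Let Wa l s p x : W l p x -> W l p (op_act B (l := l) s p x).
Proof. by move=> xE n; rewrite -[RHS]/(op_act (Q n) s p (x n)) -xE -om_act. Qed.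
Let Wc l m r e i p q o (d : p + q = o) a b :
  W l p a -> W m q b -> W r o (bm_fun (@op_comp _ _ _ B l m r e i) d a b).
Proof.
move=> aE bE n; rewrite -[RHS]/(bm_fun (@op_comp _ _ _ (Q n) l m r e i) d (a n) (b n)).
by rewrite -aE -bE -om_comp.
Qed.

(** The inverse limit of the stages. In each label the tower is eventually constant, so [pr n] is
    bijective in labels up to [n]. *)
Definition model : operad k := subop Wd Wa Wc.

Let pr n : operad_mor model (Q n) := om_cmp (prodop_proj Q n) (subop_incl Wd Wa Wc).

Let pr_pi n l p x : pi n l p (pr n.+1 l p x) = pr n l p x.
Proof. exact: (msubP x n). Qed.

Let pr_surj n l p y : exists x, pr n l p x = y.
Proof.
have [f [fP fn]] := tower_surj (fun m => @pi_surj m l p) y.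
by exists (mksub (W := W l p) (x := f) fP).
Qed.

Let pr_inj n l p : (l <= n)%N -> injective (pr n l p).
Proof.
move=> ln x y xy; apply: val_inj; apply: dprodP => m.
rewrite -[val x m]/(pr m l p x) -[val y m]/(pr m l p y).
have up j : pr (n + j)%N l p x = pr (n + j)%N l p y.
  elim: j => [|j IH]; first by rewrite addn0.
  rewrite addnS; apply: (@pi_inj (n + j)%N l p); first exact: leq_trans (leq_addr _ _).
  by rewrite !pr_pi.
have down j : pr (m + j)%N l p x = pr (m + j)%N l p y -> pr m l p x = pr m l p y.
  elim: j => [|j IH]; first by rewrite addn0.
  by rewrite addnS => e; apply: IH; rewrite -pr_pi e pr_pi.
by apply: (down n); rewrite addnC.
Qed.

Let F_le l n p x : (l <= n)%N -> F n l p (pr n l p x) = F l l p (pr l l p x).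
Proof.
move=> /subnKC <-; elim: (n - l)%N => [|j IH]; first by rewrite addn0.
by rewrite addnS Fpi ?leq_addr // pr_pi.
Qed.

Definition model_map : operad_mor model P.
Proof.
exists (fun l => cm_comp (F l l) (pr l l)).
- move=> l s p x; rewrite -[LHS]/(F l l p (pr l l p (op_act model s p x))).
  by rewrite om_act (st_act (QF l)).
- move=> l m r e i p q o d a b.
  rewrite -[LHS]/(F r r o (pr r r o (bm_fun (@op_comp _ _ _ model l m r e i) d a b))).
  rewrite om_comp (st_comp (QF r)) // -[RHS]/(bm_fun _ d (F l l p (pr l l p a)) (F m m q (pr m m q b))).
  by rewrite !F_le //; lia.
Defined.

Lemma model_we : weak_equivalence model_map.
Proof.
move=> l; apply: quasi_iso_comp (st_qi (QF l) (leqnn l)) _.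
apply: bijective_quasi_iso => p; apply/bijectiveP; split; first exact: pr_inj.
exact: pr_surj.
Qed.

Lemma model_arity1 p (x : model 0%N p) : x = 0.
Proof. by apply: (@pr_inj 0%N) => //; rewrite linear0; exact: (st_zero (QF 0)). Qed.

Lemma model_fgen l p : fgen (model l p).
Proof. by apply: (fgen_inj (@pr_inj l l p (leqnn l))); have [] := st_fin (QF l) l. Qed.

(** The condition at [n] involves only labels up to [n], where the inverse [g] of [pr n] transports
    it from the stage [n]. *)
Lemma model_cofibrant n : cofibrant_at model n.
Proof.
have : forall lp : nat * int, exists g : {linear Q n lp.1 lp.2 -> model lp.1 lp.2},
    (lp.1 <= n)%N -> forall y, pr n lp.1 lp.2 (g y) = y.
  move=> [l p] /=; have [ln|ln] := leqP l n; last by exists \0.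
  have /choice[g gK] := @pr_surj n l p.
  have gK' : cancel (pr n l p) g by move=> x; apply: (pr_inj ln); rewrite gK.
  by exists (mkLin (can2_linear gK' gK)).
move=> /dep_choice[g0 g0P]; pose g l p : {linear Q n l p -> model l p} := g0 (l, p).
have gP l p y : (l <= n)%N -> pr n l p (g l p y) = y by move=> ln; exact: (g0P (l, p) ln y).
have gA l s p y : (l <= n)%N -> g l p (op_act (Q n) (l := l) s p y) = op_act model s p (g l p y).
  by move=> ln; apply: (pr_inj ln); rewrite om_act !gP.
have gC l m r e i p q o (d : p + q = o) a b : (r <= n)%N ->
    g r o (bm_fun (@op_comp _ _ _ (Q n) l m r e i) d a b) =
    bm_fun (@op_comp _ _ _ model l m r e i) d (g l p a) (g m q b).
  by move=> rn; apply: (pr_inj rn); rewrite om_comp !gP //; lia.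
move=> X T.
have [T' T'E] : exists T' : test (Q n) (n := n) X, forall l m e i p q r d a b,
    @t_fun _ _ _ _ _ _ T' l m e i p q r d a b =
    @t_fun _ _ _ _ _ _ T l m e i p q r d (g l p a) (g m q b).
  unshelve eexists.
    exists (fun l m e i p q r d a b => @t_fun _ _ _ _ _ _ T l m e i p q r d (g l p a) (g m q b)).
    + by move=> l m e i p q r d b a u v; rewrite linearP (t_linl T).
    + by move=> l m e i p q r d b a u v; rewrite linearP (t_linr T).
    + by move=> l m e t i s p q r d a b; rewrite !gA ?(t_equiv T) //; lia.
    + move=> l m c lm mc e1 e2 e3 e4 j i ji jiE p q r pq qr pqr d1 d2 d3 d4 a b x.
      by rewrite !gC ?(t_assoc T e1 e2 e3 e4 jiE d1 d2 d3 d4) //; lia.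
    + move=> l m c lm lc e1 e2 e3 e4 i j i' j' ij iE jE p q r pq pr' pqr d1 d2 d3 d4 a b x.
      by rewrite !gC ?(t_comm T e1 e2 e3 e4 ij iE jE d1 d2 d3 d4) //; lia.
  by [].
have [h [hE hM]] := st_cof (QF n) T'.
exists (fun p => h p \o pr n n p); split=> [s p x|l m e i p q r d a b].
  by rewrite -[LHS]/(h p (pr n n p (op_act model s p x))) om_act hE.
rewrite -[LHS]/(h r (pr n n r (bm_fun (@op_comp _ _ _ model l m n e i) d a b))) om_comp hM T'E.
have ln : (l <= n)%N by lia.
have mn : (m <= n)%N by lia.
by congr (t_fun T _ _ _ _ _); apply: (@pr_inj n) => //; rewrite gP.
Qed.

End Model.

(** * Weight decompositions *)

Section WeightFormality.
Variables (k : fieldType) (char_k : [pchar k] =i pred0) (I : Type) (ar : I -> nat).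
Variables (M : operad_on k ar) (th : forall l p, {linear M l p -> M l p}).
Hypothesis Mfg : forall l p, fgen (M l p).
Hypothesis th_d : forall l p q (e : p = q + 1) x,
  cx_d (M l) e (th l p x) = th l q (cx_d (M l) e x).
Hypothesis th_act : forall l s p x, th l p (op_act M s p x) = op_act M (l := l) s p (th l p x).
Hypothesis th_comp : forall l m n (e : (ar l + ar m = (ar n).+1)%N) i p q r (d : p + q = r) a b,
  th n r (bm_fun (op_comp M e i) d a b) =
  bm_fun (op_comp M e i) d (th l p a) b + bm_fun (op_comp M e i) d a (th m q b).
Hypothesis th_h : forall l p (z : cycles (M l) p),
  exists y, cx_d (M l) (erefl (p + 1)) y = th l p (cyc_val z) - p%:~R *: cyc_val z.

Lemma intr_eq0_char0 (n : int) : (n%:~R == 0 :> k) = (n == 0).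
Proof.
case: n => n; first by rewrite -[n%:~R]/(n%:R) ((pcharf0P k).1 char_k).
by rewrite NegzE mulrNz oppr_eq0 -pmulrn oppr_eq0 ((pcharf0P k).1 char_k).
Qed.

Section OneModule.
Variables (l : I) (p : int).
Implicit Types (w u : int) (x y : M l p).

Definition ph w x := th l p x - w%:~R *: x.

Lemma ph_linear w : linear (ph w).
Proof.
move=> a x y; rewrite /ph linearP scalerDr opprD addrACA scalerBr !scalerA.
by rewrite [_ * a]mulrC.
Qed.
Definition phl w : {linear M l p -> M l p} := mkLin (ph_linear w).

(** The product of the operators [th - w] over the weights [w] in [s]. *)
Definition kills (s : seq int) : M l p -> M l p := fun x => foldr (fun w y => phl w y) x s.

Lemma kills_linear s : linear (kills s).
Proof.
elim: s => [|w s IH] a x y //.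
by rewrite -[LHS]/(phl w (kills s (a *: x + y))) IH (linearP (phl w)).
Qed.
Definition killsl s : {linear M l p -> M l p} := mkLin (kills_linear s).

Lemma phlC w u x : phl w (phl u x) = phl u (phl w x).
Proof.
rewrite !mkLinE /ph !(linearB (th l p)) !(linearZZ (th l p)) !scalerBr !scalerA.
by rewrite [w%:~R * u%:~R]mulrC !opprB [LHS]addrACA [RHS]addrACA; congr (_ + _); exact: addrC.
Qed.

Lemma killsl_cons w s x : killsl (w :: s) x = phl w (killsl s x).
Proof. by []. Qed.

Lemma killsl_ph w s x : killsl s (phl w x) = phl w (killsl s x).
Proof. by elim: s => [|u s IH] //; rewrite !killsl_cons IH phlC. Qed.

Lemma killsl_cat s t x : killsl (s ++ t) x = killsl s (killsl t x).
Proof. by rewrite !mkLinE /kills foldr_cat. Qed.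

Lemma killslC s t x : killsl s (killsl t x) = killsl t (killsl s x).
Proof. by elim: s => [|w s IH] //; rewrite !killsl_cons IH killsl_ph. Qed.

(** Membership in the generalized eigenspace of [th] for the eigenvalue [w]. *)
Definition weight w x : Prop := exists N, killsl (nseq N w) x = 0.

Lemma weight_ker N w x M' : killsl (nseq N w) x = 0 -> (N <= M')%N -> killsl (nseq M' w) x = 0.
Proof. by move=> x0 /subnK <-; rewrite nseqD killsl_cat x0 linear0. Qed.

Lemma weight0 w : weight w 0.
Proof. by exists 0%N. Qed.
Lemma weightL w a x y : weight w x -> weight w y -> weight w (a *: x + y).
Proof.
move=> [N x0] [N' y0]; exists (maxn N N'); rewrite linearP.
by rewrite (weight_ker x0) ?leq_maxl // (weight_ker y0) ?leq_maxr // scaler0 addr0.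
Qed.
Lemma weight_kills w s x : weight w x -> weight w (killsl s x).
Proof. by move=> [N x0]; exists N; rewrite killslC x0 linear0. Qed.

Lemma ph_inj w u x : w != u -> weight u x -> phl w x = 0 -> x = 0.
Proof.
move=> wu [N x0] /eqP; rewrite mkLinE /ph subr_eq0 => /eqP thx.
have c0 : (w - u)%:~R != 0 :> k by rewrite intr_eq0_char0 subr_eq0.
have : (w - u)%:~R ^+ N *: x = 0.
  rewrite -[RHS]x0; elim: N {x0} => [|N IH]; first by rewrite scale1r.
  rewrite -[nseq _ _]/(u :: nseq N u) killsl_cons -IH (linearZZ (phl u)) -[phl u x]/(ph u x) /ph thx.
  by rewrite -scalerBl -rmorphB scalerA -exprSr.
by move/eqP; rewrite scaler_eq0 expf_eq0 (negbTE c0) andbF /= => /eqP.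
Qed.

(** On the generalized eigenspace of [u] each [th - w] with [w] different from [u] is injective,
    since distinct integers stay distinct in [k]. *)
Lemma kills_inj s u x : u \notin s -> weight u x -> killsl s x = 0 -> x = 0.
Proof.
elim: s x => [|w s IH] x //; rewrite inE negb_or => /andP[uw us] wx.
rewrite killsl_cons => k0; apply: IH => //.
have wu : w != u by apply: contra uw => /eqP ->.
exact: (ph_inj wu (weight_kills s wx) k0).
Qed.

Inductive sumW (D : pred int) : M l p -> Prop :=
| sumW0 : sumW D 0
| sumWD w y x : D w -> weight w y -> sumW D x -> sumW D (y + x).

Lemma sumWone (D : pred int) w x : D w -> weight w x -> sumW D x.
Proof. by move=> Dw wx; rewrite -[x]addr0; apply: sumWD wx (sumW0 D). Qed.

Lemma sumWadd D x y : sumW D x -> sumW D y -> sumW D (x + y).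
Proof.
by move=> Dx Dy; elim: Dx => [|w z u Dw wz _ IH]; rewrite ?add0r // -addrA; exact: (sumWD Dw wz IH).
Qed.

Lemma sumWZ D a x : sumW D x -> sumW D (a *: x).
Proof.
elim=> [|w y z Dw wy _ IH]; first by rewrite scaler0; exact: sumW0.
rewrite scalerDr; apply: (sumWD Dw _ IH).
by rewrite -[_ *: y]addr0; apply: weightL => //; exact: weight0.
Qed.

Lemma sumW_sub (D D' : pred int) x : (forall w, D w -> D' w) -> sumW D x -> sumW D' x.
Proof.
move=> DD'; elim=> [|w y z Dw wy _ IH]; first exact: sumW0.
exact: (sumWD (DD' _ Dw) wy IH).
Qed.

Lemma sumW_killed D x : sumW D x -> exists s, all D s /\ killsl s x = 0.
Proof.
elim=> [|w y z Dw [N y0] _ [s [Ds z0]]]; first by exists [::].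
exists (nseq N w ++ s); rewrite all_cat Ds all_nseq Dw orbT; split=> //.
by rewrite linearD !killsl_cat z0 linear0 addr0 killslC y0 linear0.
Qed.

(** Generalized eigenspaces for distinct eigenvalues are independent. *)
Lemma weight_sumW_eq0 D w x : ~~ D w -> weight w x -> sumW D x -> x = 0.
Proof.
move=> Dw wx /sumW_killed[s [/allP Ds]]; apply: kills_inj wx.
by apply/negP => /Ds; rewrite (negbTE Dw).
Qed.

End OneModule.

Section Naturality.
Variables (l l' : I) (p p' : int) (f : {linear M l p -> M l' p'}).
Hypothesis fth : forall x, f (th l p x) = th l' p' (f x).

Lemma ph_map w x : f (phl l p w x) = phl l' p' w (f x).
Proof. by rewrite -[phl l p w x]/(ph w x) /ph linearB (linearZZ f) fth. Qed.

Lemma kills_map s x : f (killsl l p s x) = killsl l' p' s (f x).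
Proof. by elim: s => [|w s IH] //; rewrite !killsl_cons ph_map IH. Qed.

Lemma weight_map w x : weight w x -> weight w (f x).
Proof. by move=> [N x0]; exists N; rewrite -kills_map x0 linear0. Qed.

Lemma sumW_map D x : sumW D x -> sumW D (f x).
Proof.
elim=> [|w y z Dw wy _ IH]; first by rewrite linear0; exact: sumW0.
by rewrite linearD; exact: (sumWD Dw (weight_map wy) IH).
Qed.
End Naturality.

Lemma ph_comp l m n e i p q r (d : p + q = r) w u a b :
  phl n r (w + u) (bm_fun (@op_comp _ _ _ M l m n e i) d a b) =
  bm_fun (op_comp M e i) d (phl l p w a) b + bm_fun (op_comp M e i) d a (phl m q u b).
Proof.
rewrite -[LHS]/(ph (w + u) _) -[phl l p w a]/(ph w a) -[phl m q u b]/(ph u b) /ph th_comp.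
rewrite bmDl bmDr -!scaleNr bmZl bmZr rmorphD scaleNr scalerDl opprD addrACA.
by rewrite !scaleNr.
Qed.

(** By the Leibniz rule, [th - (w + u)] applied to [a o_i b] is
    [(th - w) a o_i b + a o_i (th - u) b]; each term lowers one of the exponents, whence an
    induction on their sum. *)
Lemma weight_comp l m n e i p q r (d : p + q = r) w u a b :
  weight w a -> weight u b ->
  weight (w + u) (bm_fun (@op_comp _ _ _ M l m n e i) d a b).
Proof.
move=> [N +] [N' +]; have [c] := ubnP (N + N').
elim: c => // c IH in N N' a b *; rewrite ltnS.
case: N => [|N] Nc a0; first by move=> _; rewrite (_ : a = 0) ?bm0l //; exact: weight0.
case: N' => [|N'] in Nc * => b0; first by rewrite (_ : b = 0) ?bm0r //; exact: weight0.
have [X X0] : weight (w + u)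
    (phl n r (w + u) (bm_fun (@op_comp _ _ _ M l m n e i) d a b)).
  rewrite ph_comp -[X in weight _ (X + _)]scale1r; apply: weightL.
    apply: (IH N N'.+1) => //.
    by rewrite killsl_ph.
  apply: (IH N.+1 N') => //; first by rewrite addSnnS.
  by rewrite killsl_ph.
by exists X.+1; rewrite -[nseq _ _]/(_ :: nseq X (w + u)) killsl_cons -killsl_ph.
Qed.

Lemma sumW_comp (D E F : pred int) l m n e i p q r (d : p + q = r) a b :
  (forall w u, D w -> E u -> F (w + u)) -> sumW D a -> sumW E b ->
  sumW F (bm_fun (@op_comp _ _ _ M l m n e i) d a b).
Proof.
move=> DE; elim=> [|w y z Dw wy _ IH] bE; first by rewrite bm0l; exact: sumW0.
rewrite bmDl; apply: sumWadd (IH bE).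
elim: bE => [|u v t Eu uv _ IH']; first by rewrite bm0r; exact: sumW0.
by rewrite bmDr; exact: (sumWD (DE _ _ Dw Eu) (weight_comp _ _ _ wy uv) IH').
Qed.

Section Fitting.
Variables (w : int).

(** The polynomial in [th - w] with coefficients [c], constant term first. Polynomials in [th]
    commute with every map that commutes with [th]. *)
Fixpoint hornerf l p (c : seq k) (x : M l p) : M l p :=
  if c is a :: c' then a *: x + phl l p w (hornerf c' x) else 0.

Lemma horner_linear l p c : linear (@hornerf l p c).
Proof.
elim: c => [|b c IH] a x y; first by rewrite /= scaler0 addr0.
rewrite -[LHS]/(b *: (a *: x + y) + phl l p w (hornerf c (a *: x + y))).
rewrite IH (linearP (phl l p w)) scalerDr addrACA scalerA [b * a]mulrC -scalerA -scalerDr.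
exact: erefl.
Qed.
Definition hornerl l p c : {linear M l p -> M l p} := mkLin (@horner_linear l p c).

Lemma hornerl_cons l p a c x : hornerl l p (a :: c) x = a *: x + phl l p w (hornerl l p c x).
Proof. by []. Qed.

Lemma hornerl_map l l' p p' (f : {linear M l p -> M l' p'}) c x :
  (forall x, f (th l p x) = th l' p' (f x)) -> f (hornerl l p c x) = hornerl l' p' c (f x).
Proof.
move=> fth; elim: c => [|a c IH]; first by rewrite linear0.
by rewrite !hornerl_cons linearD (linearZZ f) ph_map // IH.
Qed.

Lemma hornerl_ph l p c x : hornerl l p c (phl l p w x) = phl l p w (hornerl l p c x).
Proof.
elim: c => [|a c IH]; first by rewrite linear0.
rewrite !hornerl_cons IH.
by rewrite [RHS](linearD (phl l p w)) (linearZZ (phl l p w)).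
Qed.

Lemma hornerl_th l p c x : hornerl l p c (th l p x) = th l p (hornerl l p c x).
Proof.
have thE y : th l p y = phl l p w y + w%:~R *: y by rewrite -[phl l p w y]/(ph w y) subrK.
by rewrite [th l p x]thE (linearD (hornerl l p c)) (linearZZ (hornerl l p c)) hornerl_ph -thE.
Qed.

Lemma hornerl_scale l p a c x : hornerl l p [seq a * b | b <- c] x = a *: hornerl l p c x.
Proof.
elim: c => [|b c IH]; first by rewrite scaler0.
by rewrite map_cons !hornerl_cons IH scalerDr scalerA (linearZZ (phl l p w)).
Qed.

(** With [X] for [th - w], write the annihilating polynomial as [X^N (a + X c')] with [a] nonzero.
    Then [X^N] kills [y + a^-1 X c' y]. *)
Lemma hornerl_annihilated l p c (y : M l p) : has (predC1 0) c -> hornerl l p c y = 0 ->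
  exists b, weight w (y - phl l p w (hornerl l p b y)).
Proof.
elim: c y => [|a c IH] y //; rewrite hornerl_cons -[has _ _]/((a != 0) || has (predC1 0) c).
have [->|a0] := eqVneq a 0.
  move=> hc; rewrite scale0r add0r -hornerl_ph => /(IH _ hc)[b [N bN]].
  exists b, N.+1; rewrite -[nseq _ _]/(w :: nseq N w) killsl_cons -killsl_ph.
  rewrite -[RHS]bN hornerl_ph; congr (killsl _ _ _ _); exact: (linearB (phl l p w)).
move=> _ e; exists [seq - a^-1 * x | x <- c]; exists 0%N.
rewrite hornerl_scale (linearZZ (phl l p w)) scaleNr opprK.
have -> : phl l p w (hornerl l p c y) = - (a *: y) by apply/eqP; rewrite -addr_eq0 addrC e.
by rewrite scalerN scalerA mulVf // scale1r subrr linear0.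
Qed.

(** Fitting's decomposition: by finite dimensionality some nonzero polynomial in [th - w]
    annihilates [y]. The complement to the weight part is expressed by a polynomial in [th] so that
    it commutes with differentials. *)
Lemma fitting l p (y : M l p) : exists b, weight w (y - phl l p w (hornerl l p b y)).
Proof.
have [s [cf cfP]] := fgen_coordinates (Mfg l p); pose m := size s.
pose A : 'M[k]_(m.+1, m) := \matrix_(i, j) cf (iter i (phl l p w) y) 0 j.
(* The first [m + 1] iterates of [y] have only [m] coordinates, so they are linearly dependent. *)
have : kermx A != 0.
  by rewrite -mxrank_eq0 mxrank_ker subn_eq0 -ltnNge ltnS rank_leq_col.
case/rowV0Pn => u /sub_kermxP uA u0.
apply: (@hornerl_annihilated _ _ [seq u 0 i | i <- enum 'I_m.+1]).
  apply: contraNT u0 => /hasPn u0; apply/eqP/rowP => i; rewrite mxE.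
  by have := u0 (u 0 i); rewrite map_f ?mem_enum //= negbK => /(_ isT)/eqP.
have hE c x : hornerl l p c x = \sum_(i < size c) c`_i *: iter i (phl l p w) x.
  elim: c x => [|a c IH] x; first by rewrite big_ord0.
  rewrite hornerl_cons big_ord_recl -hornerl_ph IH; congr (_ + _).
  by apply: eq_bigr => i _; rewrite lift0 iterSr.
rewrite hE size_map size_enum_ord.
have -> : \sum_(i < m.+1) [seq u 0 i | i <- enum 'I_m.+1]`_i *: iter i (phl l p w) y =
    \sum_(j < m) (u *m A) 0 j *: s`_j.
  transitivity (\sum_(i < m.+1) \sum_(j < m) (u 0 i * A i j) *: s`_j).
    apply: eq_bigr => i _; rewrite (nth_map i) ?size_enum_ord // nth_ord_enum.
    rewrite [iter i _ y in LHS]cfP scaler_sumr; apply: eq_bigr => j _.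
    by rewrite mxE scalerA.
  rewrite exchange_big; apply: eq_bigr => j _.
  by rewrite mxE scaler_suml.
by rewrite uA big1 // => j _; rewrite mxE scale0r.
Qed.
End Fitting.

Let low (p : int) : pred int := fun w => w < p.

(** By induction, the boundary of [(th - w) y] is also that of some [y1] of low weights. Fitting
    writes [y] as a part of weight [w] plus [(th - w) (B y)], and replacing the latter by [B y1]
    does not change the boundary. *)
Lemma boundary_of_weights l p (y : M l (p + 1)) s : all (fun w => w <= p) s ->
  killsl l p s (cx_d (M l) erefl y) = 0 ->
  exists2 y0, sumW (low (p + 1)) y0 & cx_d (M l) erefl y0 = cx_d (M l) (erefl (p + 1)) y.
Proof.
elim: s y => [|w s IH] y; first by move=> _ dy; exists 0; [exact: sumW0 | rewrite linear0 -[LHS]dy].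
rewrite -[all _ _]/((w <= p) && all (fun w => w <= p) s) => /andP[wp sp] dy.
have [] := IH (phl l (p + 1) w y) sp.
  rewrite (ph_map (f := cx_d (M l) erefl)) => [|x]; last exact: th_d.
  by rewrite killsl_ph.
move=> y1 y1W dy1; have [b yb] := fitting w y.
pose B := hornerl w l (p + 1) b.
exists (y - phl l _ w (B y) + B y1).
  apply: sumWD yb _; first by rewrite /low; lia.
  elim: y1W {dy1} => [|u v t up vu _ IH']; first by rewrite linear0; exact: sumW0.
  rewrite linearD; apply: (sumWD up _ IH'); apply: (@weight_map _ _ _ _ B) vu => x.
  exact: hornerl_th.
have nat x : cx_d (M l) (erefl (p + 1)) (B x) = hornerl w l p b (cx_d (M l) erefl x).
  by apply: hornerl_map => x'; exact: th_d.
rewrite linearD linearB nat dy1.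
rewrite !(ph_map (f := cx_d (M l) erefl)); try exact: th_d.
by rewrite nat hornerl_ph subrK.
Qed.

(** Since [th c - p c = d y], the Fitting complement [B (th c - p c)] equals the boundary [d (B y)];
    subtracting it leaves the part of weight [p]. *)
Lemma homologous_weight l p (c : cycles (M l) p) : exists y : M l (p + 1),
  weight p (cyc_val c - cx_d (M l) erefl y).
Proof.
have [y dy] := th_h c; have [b cb] := fitting p (cyc_val c).
exists (hornerl p l (p + 1) b y).
rewrite (@hornerl_map p l l _ _ (cx_d (M l) erefl)) => [|x]; last exact: th_d.
by rewrite dy -[_ - _ *: _]/(phl l p p (cyc_val c)) hornerl_ph.
Qed.

(** On homology in degree [p] the operator [th - w] is multiplication by [p - w], invertible for
    [w < p]. A product of such operators kills the cycle, so its class is zero. *)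
Lemma low_boundary l p (c : cycles (M l) p) : sumW (low p) (cyc_val c) -> hclass (M l) p c = 0.
Proof.
move=> /sumW_killed[s [sp c0]].
have : hclass (M l) p c = 0 \/ exists2 v : cycles (M l) p,
    cyc_val v = killsl l p s (cyc_val c) & hclass (M l) p v = 0.
  by right; exists 0; [rewrite c0 | exact: linear0].
elim: s sp {c0} => [|w s IH].
  by move=> _ [//|[v /val_inj ->]].
rewrite -[all _ _]/((w < p) && all (low p) s) => /andP[wp sp] [->//|[v vE v0]]; apply: IH sp _; right.
have cyc : killsl l p s (cyc_val c) \in @is_cycle k (M l) p.
  apply/cycleP => q e; rewrite (kills_map (f := cx_d (M l) e)); last by move=> x; exact: th_d.
  by rewrite cyc_d linear0.
exists (Cycles cyc) => //; set u := Cycles cyc.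
have [y dy] := th_h u; have [y' dy'] := (hclass0P v).1 v0.
have c0 : (p - w)%:~R != 0 :> k by rewrite intr_eq0_char0 subr_eq0; apply/eqP; lia.
apply/hclass0P; exists ((p - w)%:~R^-1 *: (y' - y)).
rewrite (linearZZ (cx_d _ _)) linearB dy dy' vE.
rewrite -[killsl l p _ _]/(phl l p w (cyc_val u)) -[phl l p w _]/(ph w _) /ph.
rewrite opprB [_ *: _ - th _ _ _]addrC addrACA subrr add0r [- _ + _]addrC.
by rewrite -scalerBl -rmorphB scalerA mulVf // scale1r.
Qed.

(* Modulo boundaries, the elements [z + u], with [z] a cycle of weight [p] and *)
(* [u] of weights below [p], compute the homology, and taking the class of [z] *)
(* is multiplicative since weights add up.                                     *)
Let Aset l p (x : M l p) : Prop := exists c : cycles (M l) p,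
  weight p (cyc_val c) /\ sumW (low p) (x - cyc_val c).

Let A0 l p : Aset (0 : M l p).
Proof. by exists 0; split; [exact: weight0 | rewrite subr0; exact: sumW0]. Qed.

Let AL_uniq l p a (x y : M l p) (c c' : cycles (M l) p) :
  weight p (cyc_val c) -> sumW (low p) (x - cyc_val c) ->
  weight p (cyc_val c') -> sumW (low p) (y - cyc_val c') ->
  weight p (cyc_val (a *: c + c')) /\ sumW (low p) (a *: x + y - cyc_val (a *: c + c')).
Proof.
move=> wc xc wc' yc'; split; first exact: weightL.
rewrite -[cyc_val _]/(a *: cyc_val c + cyc_val c') opprD addrACA -scalerBr.
by apply: sumWadd yc'; exact: sumWZ.
Qed.

Let AL l p a (x y : M l p) : Aset x -> Aset y -> Aset (a *: x + y).
Proof. by move=> [c [wc xc]] [c' [wc' yc']]; exists (a *: c + c'); exact: AL_uniq. Qed.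

Let A l p : submodule (M l p) := Submodule (@A0 l p) (@AL l p).

Let low_split l p q (e : p = q + 1) (u : M l p) : sumW (low p) u ->
  exists2 a, weight q a & sumW (low q) (u - a).
Proof.
elim=> [|w x y wp wx _ [a wa ya]].
  by exists 0; [exact: weight0 | rewrite subr0; exact: sumW0].
have [wq|wq] := eqVneq w q.
  exists (x + a); first by rewrite -[x]scale1r; apply: weightL => //; rewrite -wq.
  by rewrite opprD addrACA subrr add0r.
exists a => //; rewrite -addrA; apply: sumWD wx ya.
by rewrite /low in wp *; move/eqP: wq; lia.
Qed.

Let d_weight l p q (e : p = q + 1) w x : weight w x -> weight w (cx_d (M l) e x).
Proof. by apply: weight_map => y; exact: th_d. Qed.

(** The cycle part has zero boundary, and among the weights below [q + 1] only weight [q]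
    contributes a leading term. That term is a boundary, so its class vanishes, as a chain map to a
    zero differential requires. *)
Let Ad_spec l p q (e : p = q + 1) (x : M l p) (c : cycles (M l) p) :
  sumW (low p) (x - cyc_val c) -> exists c' : cycles (M l) q,
  [/\ weight q (cyc_val c'), sumW (low q) (cx_d (M l) e x - cyc_val c') & hclass _ _ c' = 0].
Proof.
move=> /(low_split e)[a wa xa].
have cyc : cx_d (M l) e a \in @is_cycle k (M l) q by apply/cycleP => r e'; exact: cx_dd.
exists (Cycles cyc); split; first exact: d_weight.
  rewrite -[cyc_val _]/(cx_d (M l) e a) -[cx_d (M l) e x]subr0 -[X in _ - X - _](cyc_d c e).
  rewrite -!linearB; apply: sumW_map xa => y; exact: th_d.
by subst p; apply/hclass0P; exists a.
Qed.

Let Ad l p q (e : p = q + 1) (x : M l p) : A l p x -> A l q (cx_d (M l) e x).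
Proof. by move=> [c [wc /(Ad_spec e)[c' [wc' xc' _]]]]; exists c'. Qed.

Let Aact_spec l (s : 'S_(ar l)) p (x : M l p) (c : cycles (M l) p) :
  weight p (cyc_val c) -> sumW (low p) (x - cyc_val c) ->
  weight p (cyc_val (cyc_map (op_act M s) c)) /\
  sumW (low p) (op_act M s p x - cyc_val (cyc_map (op_act M s) c)).
Proof.
move=> wc xc; split.
  by apply: (weight_map (f := op_act M s p)) wc => y; rewrite th_act.
rewrite -[cyc_val _]/(op_act M s p (cyc_val c)) -linearB.
by apply: sumW_map xc => y; rewrite th_act.
Qed.

Let Aact l (s : 'S_(ar l)) p (x : M l p) : A l p x -> A l p (op_act M s p x).
Proof. by move=> [c [wc xc]]; exists (cyc_map (op_act M s) c); exact: Aact_spec. Qed.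

(** Weights add: only the product of the leading terms reaches weight [p + q], and the three other
    products stay below. *)
Let Acomp_spec l m n (e : (ar l + ar m = (ar n).+1)%N) i p q r (d : p + q = r)
    (x : M l p) (y : M m q) (c : cycles (M l) p) (c' : cycles (M m) q) :
  weight p (cyc_val c) -> sumW (low p) (x - cyc_val c) ->
  weight q (cyc_val c') -> sumW (low q) (y - cyc_val c') ->
  weight r (cyc_val (cyc_mul (op_comp M e i) d c c')) /\
  sumW (low r) (bm_fun (op_comp M e i) d x y - cyc_val (cyc_mul (op_comp M e i) d c c')).
Proof.
move=> wc xc wc' yc'; split.
  have := weight_comp e i d wc wc'; rewrite [X in weight X _]d; exact.
rewrite -[cyc_val _]/(bm_fun (op_comp M e i) d (cyc_val c) (cyc_val c')).
rewrite (_ : _ - _ = bm_fun (op_comp M e i) d (x - cyc_val c) (y - cyc_val c') +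
    bm_fun (op_comp M e i) d (x - cyc_val c) (cyc_val c') +
    bm_fun (op_comp M e i) d (cyc_val c) (y - cyc_val c')); last first.
  by rewrite !bmBl !bmBr addrAC subrK addrA subrK.
apply: sumWadd; first apply: sumWadd.
- by apply: (sumW_comp e i d _ xc yc') => w w'; rewrite /low; lia.
- apply: (sumW_comp e i d _ xc (sumWone (D := pred1 q) _ wc')); last by rewrite /= eqxx.
  by move=> w w' /[swap] /eqP ->; rewrite /low; lia.
- apply: (sumW_comp e i d _ (sumWone (D := pred1 p) _ wc) yc'); last by rewrite /= eqxx.
  by move=> w w' /eqP ->; rewrite /low; lia.
Qed.

Let Acomp l m n (e : (ar l + ar m = (ar n).+1)%N) i p q r (d : p + q = r) (x : M l p) (y : M m q) :
  A l p x -> A m q y -> A n r (bm_fun (op_comp M e i) d x y).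
Proof.
move=> [c [wc xc]] [c' [wc' yc']].
by exists (cyc_mul (op_comp M e i) d c c'); exact: Acomp_spec.
Qed.

Let MA := subop Ad Aact Acomp.

Let zc l p (x : MA l p) : cycles (M l) p := projT1 (cid (msubP x)).
Let zcW l p (x : MA l p) : weight p (cyc_val (zc x)).
Proof. by rewrite /zc; case: (cid _) => c []. Qed.
Let zcL l p (x : MA l p) : sumW (low p) (mval x - cyc_val (zc x)).
Proof. by rewrite /zc; case: (cid _) => c []. Qed.

(** Two choices of leading term differ by an element both of weight [p] and of weights below [p]. *)
Let zc_uniq l p (x : MA l p) (c : cycles (M l) p) :
  weight p (cyc_val c) /\ sumW (low p) (mval x - cyc_val c) -> zc x = c.
Proof.
move=> [wc xc]; apply: val_inj; apply/eqP; rewrite -subr_eq0; apply/eqP.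
apply: (@weight_sumW_eq0 l p (low p) p); first by rewrite /low; lia.
  by rewrite addrC -scaleN1r; apply: weightL => //; exact: zcW.
have := sumWadd xc (sumWZ (-1) (zcL x)).
by rewrite scaleN1r opprB addrC addrA subrK.
Qed.

Let psi_fun l p (x : MA l p) : homology (M l) p := hclass (M l) p (zc x).
Let psi_linear l p : linear (@psi_fun l p).
Proof.
move=> a x y; rewrite /psi_fun -linearP; congr (hclass _ _ _); apply: zc_uniq.
by apply: AL_uniq; do ?[exact: zcW | exact: zcL].
Qed.

Let psi : operad_mor MA (homology_operad M).
Proof.
unshelve eexists.
- move=> l; exists (fun p => mkLin (@psi_linear l p) : {linear MA l p -> homology (M l) p}).
  move=> p q e x; have [c' [wc' xc' c0]] := Ad_spec e (zcL x).
  by rewrite -[RHS]/(hclass _ _ (zc (cx_d (MA l) e x))) (zc_uniq (c := c')).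
- move=> l s p x; rewrite -[LHS]/(hclass _ _ (zc (op_act MA s p x))).
  rewrite -[RHS]/(homology_map (op_act M s) p (hclass _ _ (zc x))) homology_mapE.
  congr (hclass _ _ _); apply: zc_uniq; apply: Aact_spec; [exact: zcW | exact: zcL].
- move=> l m n e i p q r d x y.
  rewrite -[RHS]/(bm_fun (homology_mul (op_comp M e i)) d (hclass _ _ (zc x)) (hclass _ _ (zc y))).
  rewrite homology_mulE -[LHS]/(hclass _ _ (zc (bm_fun (op_comp MA e i) d x y))).
  congr (hclass _ _ _); apply: zc_uniq.
  by apply: Acomp_spec; do ?[exact: zcW | exact: zcL].
Defined.

(** An element of [A] in degree [p] has weights at most [p], so if it bounds in [M] it bounds an
    element of weights below [p + 1]. Such an element lies in [A]. *)
Let boundary_in_A l p (x : MA l p) (y : M l (p + 1)) : cx_d (M l) erefl y = mval x ->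
  exists y0 : MA l (p + 1), cx_d (MA l) erefl y0 = x.
Proof.
move=> dy; have [s [sp s0]] : exists s, all (fun w => w <= p) s /\ killsl l p s (mval x) = 0.
  apply: sumW_killed; rewrite -[mval x](subrK (cyc_val (zc x))); apply: sumWadd.
    by apply: sumW_sub (zcL x) => w; rewrite /low; lia.
  by apply: (sumWone (w := p)) => //; exact: zcW.
have [|y0 y0W dy0] := boundary_of_weights (y := y) sp; first by rewrite dy.
have y0A : A l (p + 1) y0 by exists 0; split; [exact: weight0 | rewrite subr0].
by exists (mksub y0A); apply: val_inj; rewrite -[LHS]/(cx_d (M l) erefl y0) dy0.
Qed.

Let mem_A l p (c : cycles (M l) p) : weight p (cyc_val c) -> A l p (cyc_val c).
Proof. by move=> wc; exists c; split=> //; rewrite subrr; exact: sumW0. Qed.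

Let weight_repr l p (w : cycles (M l) p) : exists (z : cycles (MA l) p) (y : M l (p + 1)),
  cx_d (M l) erefl y = cyc_val w - mval (cyc_val z) /\
  cyc_val (zc (cyc_val z)) = mval (cyc_val z).
Proof.
have [y wy] := homologous_weight w.
have cyc : cyc_val w - cx_d (M l) (erefl (p + 1)) y \in @is_cycle k (M l) p.
  by apply/cycleP => q e; rewrite linearB cyc_d cx_dd subrr.
pose c := Cycles cyc; have cA : A l p (cyc_val c) by exact: mem_A.
have cyc' : mksub cA \in @is_cycle k (MA l) p.
  by apply/cycleP => q e; apply: val_inj; exact: (cyc_d c e).
exists (Cycles cyc'), y; split; first by rewrite opprB [RHS]addrC subrK.
by rewrite (zc_uniq (c := c)) //; split=> //; rewrite subrr; exact: sumW0.
Qed.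

Lemma weight_formality : formal M.
Proof.
have wi : weak_equivalence (subop_incl Ad Aact Acomp).
  move=> l; apply/quasi_isoP; split=> p; first by move=> z [y dy]; exact: boundary_in_A dy.
  by move=> w; have [z [y [dy _]]] := weight_repr w; exists z, y.
have wp : weak_equivalence psi.
  move=> l; apply/quasi_isoP; split=> p.
    move=> z [y0 z0]; have /hclass0P[y dy] : hclass (M l) p (zc (cyc_val z)) = 0 by exact: esym z0.
    have cyc : mval (cyc_val z) - cyc_val (zc (cyc_val z)) \in @is_cycle k (M l) p.
      apply/cycleP => q e; rewrite linearB cyc_d subr0.
      by have := congr1 val (cyc_d z e).
    have /hclass0P[y' dy'] := low_boundary (c := Cycles cyc) (zcL _).
    by apply: (boundary_in_A (y := y + y')); rewrite linearD dy dy' addrC subrK.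
  move=> w; elim/hclass_ind: (cyc_val w) => c; have [z [y [dy zE]]] := weight_repr c.
  exists z, 0; rewrite linear0; apply/esym/eqP; rewrite subr_eq0; apply/eqP.
  apply: (hclass_eq (e := erefl) (y := y)); rewrite dy; congr (_ - _); exact: esym zE.
apply: rst_trans (rst_sym _ _ _ _ (weak_equivalence_zigzag wi)) _.
exact: weak_equivalence_zigzag wp.
Qed.

End WeightFormality.

(** * Compactness and descent of derivations *)

Section AffineCompactness.
Variables (k : fieldType) (Y : Type) (mix : k -> Y -> Y -> Y).

(** A decreasing chain of nonempty affine subspaces; [mix a y y'] stands for [y' + a (y - y')]. *)
Definition affine_chain (C : nat -> Y -> Prop) : Prop :=
  [/\ forall N, exists y, C N y,
      forall N N' y, (N <= N')%N -> C N' y -> C N y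
    & forall N a y y', C N y -> C N y' -> C N (mix a y y')].

Definition affine_fun (f : Y -> k) : Prop :=
  forall a y y', f (mix a y y') = f y' + a * (f y - f y').

(** Either [f] is constant on some member of the chain, and that constant is attained on all, or it
    is nonconstant on each, hence surjective on each, and 0 will do. *)
Lemma affine_chain_value C f : affine_chain C -> affine_fun f ->
  exists c, affine_chain (fun N y => C N y /\ f y = c).
Proof.
move=> [C0 Cs Ca] fa.
suff [c cP] : exists c, forall N, exists y, C N y /\ f y = c.
  exists c; split=> // [N N' y NN' [Cy fy]|N a y y' [Cy fy] [Cy' fy']].
    by split=> //; exact: Cs NN' Cy.
  by split; [exact: Ca | rewrite fa fy fy' subrr mulr0 addr0].
have [[N [c cN]]|nc] := pselect (exists N c, forall y, C N y -> f y = c).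
  exists c => N'; have [y Cy] := C0 (maxn N N').
  by exists y; split; [apply: Cs Cy; exact: leq_maxr | apply: cN; apply: Cs Cy; exact: leq_maxl].
exists 0 => N; apply: contrapT => n0; apply: nc; exists N.
have [y' Cy'] := C0 N; exists (f y') => y Cy; apply: contrapT => ff.
(* The zero of [f] on the line through [y'] and [y]. *)
apply: n0; exists (mix (- f y' / (f y - f y')) y y'); split; first exact: Ca.
by rewrite fa divfK ?subrr // subr_eq0; apply/eqP.
Qed.

(** Fix the values of the coordinates one after another; each time the chain cut down by the chosen
    value is again an affine chain. *)
Lemma affine_compactness C (f : nat -> Y -> k) : affine_chain C -> (forall n, affine_fun (f n)) ->
  exists z : nat -> k, forall n N, exists y, C N y /\ forall m, (m < n)%N -> f m y = z m.
Proof.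
move=> CP fa; pose st := {C | affine_chain C}.
have next (s : st) n : {c | affine_chain (fun N y => sval s N y /\ f n y = c)}.
  by apply: cid; apply: affine_chain_value => //; exact: svalP.
pose nx (s : st) n : st :=
  exist _ (fun N y => sval s N y /\ f n y = sval (next s n)) (svalP (next s n)).
pose s := fix s n : st := if n is n'.+1 then nx (s n') n' else exist _ C CP.
exists (fun n => sval (next (s n) n)) => n N.
have [/(_ N)[y sy] _ _] := svalP (s n); exists y.
elim: n sy => [|n IH] //= [/IH[Cy yz] yn]; split=> // m.
by rewrite ltnS leq_eqVlt => /orP[/eqP->|/yz].
Qed.
End AffineCompactness.

Section Derivations.
Variables (k : fieldType) (M : operad k).
Hypothesis Mfg : forall l p, fgen (M l p).

Let Y := forall l p, {linear M l p -> M l p}.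

Definition weight_derivation N (th : Y) : Prop :=
  [/\ forall l p q (e : p = q + 1) x, (l < N)%N ->
        cx_d (M l) e (th l p x) = th l q (cx_d (M l) e x),
      forall l s p x, (l < N)%N -> th l p (op_act M s p x) = op_act M (l := l) s p (th l p x),
      forall l m n (e : (l.+1 + m.+1 = n.+2)%N) i p q r (d : p + q = r) a b, (n < N)%N ->
        th n r (bm_fun (@op_comp _ _ _ M l m n e i) d a b) =
        bm_fun (@op_comp _ _ _ M l m n e i) d (th l p a) b +
        bm_fun (@op_comp _ _ _ M l m n e i) d a (th m q b)
    & forall l p (z : cycles (M l) p), (l < N)%N ->
        exists y, cx_d (M l) (erefl (p + 1)) y = th l p (cyc_val z) - p%:~R *: cyc_val z].

Let mix_fun a (th th' : Y) l p (x : M l p) : M l p := th' l p x + a *: (th l p x - th' l p x).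
Let mix_linear a th th' l p : linear (@mix_fun a th th' l p).
Proof.
move=> b x y; rewrite /mix_fun (linearP (th l p)) (linearP (th' l p)) opprD addrACA -scalerBr.
by rewrite [a *: (_ + _)]scalerDr addrACA scalerA [a * b]mulrC -scalerA -scalerDr.
Qed.
Let mix a (th th' : Y) : Y := fun l p => mkLin (@mix_linear a th th' l p).

Let mixE a th th' l p x : mix a th th' l p x = th' l p x + a *: (th l p x - th' l p x).
Proof. by []. Qed.

Let weight_derivation_mix N a th th' :
  weight_derivation N th -> weight_derivation N th' -> weight_derivation N (mix a th th').
Proof.
move=> [d1 a1 c1 h1] [d2 a2 c2 h2]; split.
- move=> l p q e x lN; by rewrite !mixE !(linearD (cx_d (M l) e)) (linearZZ (cx_d (M l) e))
    (linearB (cx_d (M l) e)) d1 // d2.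
- move=> l s p x lN; by rewrite !mixE !(linearD (op_act M s p)) (linearZZ (op_act M s p))
    (linearB (op_act M s p)) a1 // a2.
- move=> l m n e i p q r d x y nN; rewrite !mixE c1 // c2 // bmDl bmDr bmZl bmZr bmBl bmBr.
  by rewrite opprD addrACA scalerDr addrACA.
- move=> l p z lN; have [y dy] := h1 l p z lN; have [y' dy'] := h2 l p z lN.
  exists (y' + a *: (y - y')).
  rewrite (linearD (cx_d _ _)) (linearZZ (cx_d _ _)) (linearB (cx_d _ _)) dy dy' mixE.
  by rewrite opprB addrA subrK addrAC.
Qed.

(** The coordinates are matrix entries with respect to generators of [M l p]; finitely many
    determine a component. *)
Let sep (lp : nat * int) : exists g : nat * nat -> Y -> k,
  (forall ij, affine_fun mix (g ij)) /\ exists m, forall th th' : Y,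
    (forall i j, (i < m)%N -> (j < m)%N -> g (i, j) th = g (i, j) th') ->
    th lp.1 lp.2 =1 th' lp.1 lp.2.
Proof.
case: lp => l p /=.
have [s [G GP]] := fgen_coordinates (Mfg l p).
exists (fun ij th => if insub ij.1 is Some i then G (th l p s`_ij.2) 0 i else 0); split.
  move=> [i j] a y y' /=; case: insubP => [u _ _|_]; last by rewrite subrr mulr0 addr0.
  by rewrite /mix_fun (linearD G) (linearZZ G) (linearB G) !mxE.
exists (size s) => th th' E x; rewrite [x]GP !linear_sum; apply: eq_bigr => j _.
rewrite !linearZZ; congr (_ *: _); rewrite [LHS]GP [RHS]GP; apply: eq_bigr => i _; congr (_ *: _).
by have := E i j (ltn_ord i) (ltn_ord j); rewrite /= valK.
Qed.

Lemma weight_derivation_compactness :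
  (forall N, exists th, weight_derivation N th) ->
  exists th, forall N, weight_derivation N th.
Proof.
move=> th_ex; have [g gP] := choice sep.
have gb lp := (gP lp).2; have [b bP] := choice gb.
pose f n th := if unpickle n is Some lpij then g (lpij : (nat * int) * (nat * nat)).1 lpij.2 th else 0.
have CP : affine_chain mix weight_derivation.
  split=> // N N' th NN' [d1 a1 c1 h1].
  split=> [l p q e x lN|l s p x lN|l m n e i p q r d x y nN|l p z lN].
  - by apply: d1; exact: leq_trans NN'.
  - by apply: a1; exact: leq_trans NN'.
  - by apply: c1; exact: leq_trans NN'.
  - by apply: h1; exact: leq_trans NN'.
have fa n : affine_fun mix (f n).
  rewrite /f; case: unpickle => [[lp ij]|]; first exact: (gP lp).1.
  by move=> a y y'; rewrite subrr mulr0 addr0.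
have [z zP] := affine_compactness CP fa.
pose bd lp := (\max_(i < b lp) \max_(j < b lp) pickle (lp, (val i, val j))).+1.
have bdP lp th th' : (forall m, (m < bd lp)%N -> f m th = f m th') -> th lp.1 lp.2 =1 th' lp.1 lp.2.
  move=> E; apply: bP => i j ib jb.
  have := E (pickle (lp, (i, j))); rewrite /f pickleK /=; apply.
  rewrite ltnS; apply: leq_trans (leq_bigmax (Ordinal ib)).
  exact: (leq_trans _ (leq_bigmax (Ordinal jb))).
have yP (nN : nat * nat) := zP nN.1 nN.2; have [y0 y0P] := choice yP.
(* Each component of [th] comes from a solution realizing enough of the limiting coordinates [z] to
   determine that component. *)
pose th : Y := fun l p => y0 (bd (l, p), 0%N) l p.
(* On any finite set of components [th] agrees with a solution at level [N]. Each instance of the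
   axioms involves at most three components, so [th] satisfies them all. *)
have agree (L : seq (nat * int)) N : exists y, weight_derivation N y /\
    forall lp, lp \in L -> th lp.1 lp.2 =1 y lp.1 lp.2.
  pose n := (\max_(lp <- L) bd lp)%N.
  have [y [yN yz]] := zP n N; exists y; split=> // -[l p] lpL /=.
  apply: (bdP (l, p) (y0 (bd (l, p), 0%N)) y) => m mb; rewrite yz; last first.
    by apply: leq_trans mb _; exact: (leq_bigmax_seq (F := bd)).
  by have [_ ->] := y0P (bd (l, p), 0%N).
exists th => N; split=> [l p q e x lN|l s p x lN|l m n e i p q r d x x' nN|l p c lN].
- have [y [[d1 _ _ _] yE]] := agree [:: (l, p); (l, q)] N.
  by rewrite (yE (l, p)) ?(yE (l, q)) ?inE ?eqxx ?orbT //; exact: d1.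
- have [y [[_ a1 _ _] yE]] := agree [:: (l, p)] N.
  by rewrite !(yE (l, p)) ?inE ?eqxx //; exact: a1.
- have [y [[_ _ c1 _] yE]] := agree [:: (l, p); (m, q); (n, r)] N.
  rewrite (yE (l, p)) ?(yE (m, q)) ?(yE (n, r)) ?inE ?eqxx ?orbT //; exact: c1.
- have [y [[_ _ _ h1] yE]] := agree [:: (l, p)] N.
  by rewrite (yE (l, p)) ?inE ?eqxx //; exact: h1.
Qed.

End Derivations.

Section ScalarRetraction.
Variables (k K : fieldType) (iota : {rmorphism k -> K}).

(** A ring map between fields is injective, so its regular inverse as a [k]-linear map is a
    retraction. *)
Lemma scalar_retraction : exists rho : K -> k,
  [/\ {morph rho : a b / a + b}, forall c b, rho (iota c * b) = c * rho b & forall c, rho (iota c) = c].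
Proof.
have iL : linear (fun c : k^o => iota c : restr iota K^o).
  by move=> a u v; rewrite rmorphD rmorphM.
have [g gP] := linear_regular (mkLin iL).
exists g; split=> [a b|c b|c]; first exact: (linearD g).
  exact: (linearZZ g c b).
by apply: (fmorph_inj iota); exact: gP.
Qed.

Variables (rho : K -> k) (rhoD : {morph rho : a b / a + b}).
Hypothesis rhoM : forall c b, rho (iota c * b) = c * rho b.
Hypothesis rho1 : forall c, rho (iota c) = c.

Section OneModule.
Variable V : lmodType k.

(** The map [v (x) b |-> rho b v] on formal sums. *)
Definition fg_retract (D : {freeg V / K}) : V := \sum_(v <- dom D) rho (coeff v D) *: v.

Let rho0 : rho 0 = 0.
Proof. by rewrite -(rmorph0 iota) rho1. Qed.

Lemma fg_retractE (s : seq V) D : uniq s -> {subset dom D <= s} ->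
  fg_retract D = \sum_(v <- s) rho (coeff v D) *: v.
Proof.
move=> us Ds; rewrite (bigID (mem (dom D)) _ (fun v => rho (coeff v D) *: v)) /=.
rewrite [X in _ + X]big1 ?addr0; last by move=> v /coeff_outdom ->; rewrite rho0 scale0r.
rewrite -big_filter; apply: perm_big; apply: uniq_perm; rewrite ?uniq_dom ?filter_uniq // => v.
by rewrite mem_filter; case: (boolP (v \in dom D)) => //= /Ds ->.
Qed.

Lemma fg_retractD D D' : fg_retract (D + D') = fg_retract D + fg_retract D'.
Proof.
pose s := undup (dom D ++ dom D' ++ dom (D + D')).
have us : uniq s by exact: undup_uniq.
rewrite !(@fg_retractE s) //; try by move=> v vD; rewrite mem_undup !mem_cat vD ?orbT.
by rewrite -big_split; apply: eq_bigr => v _; rewrite coeffD rhoD scalerDl.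
Qed.

Lemma fg_retractU b v : fg_retract << b *g v >> = rho b *: v.
Proof.
rewrite (@fg_retractE [:: v]) //; last first.
  move=> w; rewrite mem_dom inE coeffU [v == w]eq_sym; case: (w == v) => //.
  by rewrite mulr0 eqxx.
by rewrite big_seq1 coeffU eqxx mulr1.
Qed.

(** The relations are closed under [K]-scalars while the retraction is only [k]-linear, so the
    induction needs all multiples [b *: D]. *)
Lemma fg_retract_rel D : tens_rel iota D -> forall b, fg_retract (b *: D) = 0.
Proof.
have r0 : fg_retract 0 = 0.
  by apply: (addrI (fg_retract 0)); rewrite -fg_retractD !addr0.
have rN D' : fg_retract (- D') = - fg_retract D'.
  by apply: (addrI (fg_retract D')); rewrite -fg_retractD !subrr r0.
elim=> [b|a x y _ IHx _ IHy b|v w b|c v b].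
- by rewrite scaler0 r0.
- by rewrite scalerDr fg_retractD scalerA IHx IHy addr0.
- rewrite scalerBr fg_retractD rN scalerDr fg_retractD -!fgZ !fg_retractU.
  by rewrite scalerDr subrr.
- rewrite scalerBr fg_retractD rN scalerA -!fgZ !fg_retractU.
  by rewrite [b * _]mulrC rhoM scalerA mulrC subrr.
Qed.

Definition retract (x : tens iota V) : V := fg_retract (generic_quotient.repr x).

Lemma retract_mproj D : retract (@mproj _ _ (tens_submod iota V) D) = fg_retract D.
Proof.
have : tens_rel iota (generic_quotient.repr (@mproj _ _ (tens_submod iota V) D) - D).
  exact/(@mproj_eq _ _ (tens_submod iota V))/mproj_repr.
rewrite /retract; set x := generic_quotient.repr _ => /fg_retract_rel/(_ 1); rewrite scale1r => xD.
by rewrite -[x](subrK D) fg_retractD xD add0r.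
Qed.

Lemma retractD x y : retract (x + y) = retract x + retract y.
Proof.
elim/mproj_ind: x => x; elim/mproj_ind: y => y.
by rewrite -mprojD !retract_mproj fg_retractD.
Qed.

Lemma retract_pure v b : retract (tpure iota v b) = rho b *: v.
Proof. by rewrite retract_mproj fg_retractU. Qed.

Lemma retract0 : retract 0 = 0.
Proof. by apply: (addrI (retract 0)); rewrite -retractD !addr0. Qed.

Lemma retractN x : retract (- x) = - retract x.
Proof. by apply: (addrI (retract x)); rewrite -retractD !subrr retract0. Qed.

Lemma retractZ c x : retract (iota c *: x) = c *: retract x.
Proof.
elim/tens_ind: x => [|b v x IH]; first by rewrite scaler0 retract0 scaler0.
rewrite scalerDr !retractD IH scalerDr tpureZ !retract_pure; congr (_ + _).
by rewrite rhoM scalerA.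
Qed.
End OneModule.

Lemma retract_map (V W : lmodType k) (f : {linear V -> W}) x :
  retract (tens_map iota f x) = f (retract x).
Proof.
elim/tens_ind: x => [|b v x IH]; first by rewrite linear0 !retract0 linear0.
by rewrite linearD !retractD IH tens_mapE !retract_pure linearD linearZZ.
Qed.

Lemma retract_mull (A B C : complex k) (mu : bichain_map A B C) p q r (d : p + q = r) x v :
  retract (bm_fun (bm_tens iota mu) d x (tpure iota v 1)) = bm_fun mu d (retract x) v.
Proof.
elim/tens_ind: x => [|b u x IH]; first by rewrite bm0l !retract0 bm0l.
by rewrite bmDl !retractD IH bm_tensE !retract_pure mulr1 bmDl bmZl.
Qed.

Lemma retract_mulr (A B C : complex k) (mu : bichain_map A B C) p q r (d : p + q = r) v x :
  retract (bm_fun (bm_tens iota mu) d (tpure iota v 1) x) = bm_fun mu d v (retract x).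
Proof.
elim/tens_ind: x => [|b u x IH]; first by rewrite bm0r !retract0 bm0r.
by rewrite bmDr !retractD IH bm_tensE !retract_pure mul1r bmDr bmZr.
Qed.
End ScalarRetraction.

(** * Truncations and the theorem *)

Section Truncations.
Variables (k : fieldType) (N : nat).
Implicit Types P Q : operad k.

Definition truncation_mor P Q (f : operad_mor P Q) :
  operad_mor (truncation N P) (truncation N Q).
Proof.
unshelve refine (@OperadMor _ _ _ (truncation N P) (truncation N Q) (fun l : 'I_N => f l) _ _).
- by move=> l s p x; exact: (om_act f).
- by move=> l m n e i p q r d a b; exact: (om_comp f).
Defined.

Lemma zigzag_truncation P Q : zigzag P Q -> zigzag (truncation N P) (truncation N Q).
Proof.
elim=> {P Q} [P Q [f wf]|P|P Q _|P Q R _ + _].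
- by apply: (weak_equivalence_zigzag (f := truncation_mor f)) => l; exact: wf.
- exact: rst_refl.
- exact: rst_sym.
- exact: rst_trans.
Qed.

Definition truncation_homology P :
  operad_mor (truncation N (homology_operad P)) (homology_operad (truncation N P)).
Proof. by exists (fun l => cm_id _). Defined.

Lemma formal_truncation P : formal P -> formal (truncation N P).
Proof.
move=> /zigzag_truncation zz; apply: rst_trans zz _.
apply: (weak_equivalence_zigzag (f := truncation_homology P)) => l.
exact: quasi_iso_id.
Qed.

Definition truncation_tens (K : fieldType) (iota : {rmorphism k -> K}) P :
  operad_mor (operad_tens iota (truncation N P)) (truncation N (operad_tens iota P)).
Proof. by exists (fun l => cm_id _). Defined.

Lemma formal_truncation_tens (K : fieldType) (iota : {rmorphism k -> K}) P :
  [pchar k] =i pred0 -> formal (truncation N P) -> formal (truncation N (operad_tens iota P)).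
Proof.
move=> char_k /(formal_tens iota char_k); apply: formal_zigzag.
by apply: (weak_equivalence_zigzag (f := truncation_tens iota P)) => l; exact: quasi_iso_id.
Qed.
End Truncations.

Section Grading.
Variables (k : fieldType) (char_k : [pchar k] =i pred0) (I : Type) (ar : I -> nat).
Variables (B : nat) (ar_bound : forall l, (ar l < B)%N) (ar_pos : forall l, (0 < ar l)%N).
Variables (Q H : operad_on k ar).
Hypothesis Qcof : forall n, cofibrant_at Q n.
Hypothesis Q1 : forall l, ar l = 1%N -> forall p (x : Q l p), x = 0.
Hypothesis H0 : forall l (p q : int) (e : p = q + 1) x, cx_d (H l) e x = 0.
Variables (g : operad_mor Q H) (g_we : weak_equivalence g).

(* On [H] multiplication by the degree is a derivation; it lifts through [g]. *)
Lemma weight_derivation_lift : exists F : forall l, chain_map (Q l) (Q l),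
  [/\ forall l s p x, F l p (op_act Q s p x) = op_act Q (l := l) s p (F l p x),
      forall l m n (e : (ar l + ar m = (ar n).+1)%N) i p q r (d : p + q = r) a b,
        F n r (bm_fun (op_comp Q e i) d a b) =
        bm_fun (op_comp Q e i) d (F l p a) b + bm_fun (op_comp Q e i) d a (F m q b)
    & forall l p (z : cycles (Q l) p),
        exists y, cx_d (Q l) (erefl (p + 1)) y = F l p (cyc_val z) - p%:~R *: cyc_val z].
Proof.
have g_surj l p y : exists x, g l p x = y.
  have [_ gs] := (quasi_isoP (g l)).1 (g_we l).
  have cyc : y \in @is_cycle k (H l) p by apply/cycleP => q e.
  have [z [u]] := gs p (Cycles cyc); rewrite H0 => /esym/eqP.
  by rewrite subr_eq0 => /eqP gz; exists (cyc_val z).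
have DL l p : linear (fun x : Q l p => p%:~R *: g l p x).
  by move=> a x y; rewrite (linearP (g l p)) scalerDr !scalerA [_ * a]mulrC.
have Dd l p q (e : p = q + 1) x : cx_d (H l) e (p%:~R *: g l p x) = q%:~R *: g l q (cx_d (Q l) e x).
  by rewrite -cm_d !H0 scaler0.
pose D l : chain_map (Q l) (H l) := ChainMap (cm_fun := fun p => mkLin (@DL l p)) (Dd l).
have [||F [FE Fg FM]] := lift_derivation char_k ar_bound ar_pos Qcof Q1 g_surj g_we
  (j := om_id Q) (g := D).
- move=> l s p x; rewrite -[LHS]/(p%:~R *: g l p (op_act Q s p x)) om_act.
  by rewrite -[RHS]/(op_act H s p (p%:~R *: g l p x)) linearZZ.
- move=> l m n e i p q r d a b.
  rewrite -[LHS]/(r%:~R *: g n r (bm_fun (op_comp Q e i) d a b)) om_comp.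
  rewrite -[X in _ = X + _]/(bm_fun (op_comp H e i) d (p%:~R *: g l p a) (g m q b)).
  rewrite -[X in _ = _ + X]/(bm_fun (op_comp H e i) d (g l p a) (q%:~R *: g m q b)).
  by rewrite bmZl bmZr -scalerDl -rmorphD d.
exists F; split=> // l p z.
have cyc : F l p (cyc_val z) - p%:~R *: cyc_val z \in @is_cycle k (Q l) p.
  by apply/cycleP => q e; rewrite linearB linearZZ cm_d cyc_d linear0 scaler0 subrr.
have [gi _] := (quasi_isoP (g l)).1 (g_we l).
apply: (gi p (Cycles cyc)); exists 0; rewrite linear0.
by rewrite (linearB (g l p)) (linearZZ (g l p)) Fg subrr.
Qed.
End Grading.

Section Descent.
Variables (k K : fieldType) (iota : {rmorphism k -> K}).
Hypothesis char_k : [pchar k] =i pred0.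

(** Set [th v] to be the retraction of [F (v (x) 1)]. The retraction commutes with maps defined over
    [k] and with composition by elements [v (x) 1], so the equations carry over; the eigenvalue [p]
    is an integer and retracts to itself. *)
Lemma weight_derivation_descent (M : operad k) N :
  (exists F : forall l : 'I_N, chain_map (operad_tens iota M l) (operad_tens iota M l),
  [/\ forall (l : 'I_N) s p x, F l p (op_act (truncation N (operad_tens iota M)) s p x) =
        op_act (truncation N (operad_tens iota M)) (l := l) s p (F l p x),
      forall (l m n : 'I_N) (e : (l.+1 + m.+1 = n.+2)%N) i p q r (d : p + q = r) a b,
        F n r (bm_fun (@op_comp _ _ _ (truncation N (operad_tens iota M)) l m n e i) d a b) =
        bm_fun (@op_comp _ _ _ (truncation N (operad_tens iota M)) l m n e i) d (F l p a) b +
        bm_fun (@op_comp _ _ _ (truncation N (operad_tens iota M)) l m n e i) d a (F m q b)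
    & forall (l : 'I_N) p (z : cycles (operad_tens iota M l) p),
        exists y, cx_d (operad_tens iota M l) (erefl (p + 1)) y =
          F l p (cyc_val z) - p%:~R *: cyc_val z]) ->
  exists th, weight_derivation (M := M) N th.
Proof.
move=> [F [FE FM FH]].
have [rho [rhoD rhoM rho1]] := scalar_retraction iota.
pose R V (x : tens iota V) := retract rho x.
have RD V (x y : tens iota V) : R V (x + y) = R V x + R V y by exact: retractD.
have RB V (x y : tens iota V) : R V (x - y) = R V x - R V y.
  by rewrite RD; congr (_ + _); exact: retractN.
have RZ V c (x : tens iota V) : R V (iota c *: x) = c *: R V x by exact: retractZ.
have Rpure V v b : R V (tpure iota v b) = rho b *: v by exact: retract_pure.
have Rmap (V W : lmodType k) (f : {linear V -> W}) x : R W (tens_map iota f x) = f (R V x).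
  exact: retract_map.
have thL (l : 'I_N) p : linear (fun v : M l p => R (M l p) (F l p (tpure iota v 1))).
  by move=> c u v; rewrite tpure_linl (linearP (F l p)) RD RZ.
have : forall lp : nat * int, exists th : {linear M lp.1 lp.2 -> M lp.1 lp.2},
    forall (h : (lp.1 < N)%N) v, th v = R _ (F (Ordinal h) lp.2 (tpure iota v 1)).
  move=> [l p] /=; have [h|h] := pselect (l < N)%N; last by exists \0.
  by exists (mkLin (@thL (Ordinal h) p)) => h' v; rewrite (bool_irrelevance h' h).
case/dep_choice => th0 th0P; pose th l p : {linear M l p -> M l p} := th0 (l, p).
have thE l p (h : (l < N)%N) v : th l p v = R _ (F (Ordinal h) p (tpure iota v 1)).
  exact: (th0P (l, p)).
exists th; split=> [l p q e x h|l s p x h|l m n e i p q r d a b h|l p z h].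
- rewrite !(thE _ _ h) -Rmap; congr (R _ _).
  rewrite -[LHS]/(cx_d (operad_tens iota M l) e (F (Ordinal h) p (tpure iota x 1))).
  by rewrite (cm_d (F (Ordinal h))) -[cx_d _ _ _]/(tens_map iota (cx_d (M l) e) _) tens_mapE.
- rewrite !(thE _ _ h) -Rmap; congr (R _ _).
  rewrite -[RHS]/(op_act (truncation N (operad_tens iota M)) (l := Ordinal h) s p
    (F (Ordinal h) p (tpure iota x 1))).
  by rewrite -FE; congr (F (Ordinal h) p _); symmetry; exact: tens_mapE.
- have hl : (l < N)%N by lia.
  have hm : (m < N)%N by lia.
  pose ta : cx_tens iota (M l) p := tpure iota a 1.
  pose tb : cx_tens iota (M m) q := tpure iota b 1.
  pose C := @op_comp _ _ _ M l m n e i.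
  have E : bm_fun (bm_tens iota C) d ta tb = tpure iota (bm_fun C d a b) 1.
    by rewrite /ta /tb bm_tensE mulr1.
  rewrite (thE n r h) -[tpure iota _ 1]E.
  have := FM (Ordinal hl) (Ordinal hm) (Ordinal h) e i p q r d ta tb.
  move=> /(congr1 (R (M n r))); rewrite RD => {E} E.
  rewrite -[LHS]/(R (M n r) (F (Ordinal h) r (bm_fun
    (@op_comp _ _ _ (truncation N (operad_tens iota M)) (Ordinal hl) (Ordinal hm) (Ordinal h) e i)
    d ta tb))).
  rewrite E; congr (_ + _).
    rewrite (thE l p hl); exact: (retract_mull rhoD rhoM rho1 (@op_comp _ _ _ M l m n e i)).
  rewrite (thE m q hm); exact: (retract_mulr rhoD rhoM rho1 (@op_comp _ _ _ M l m n e i)).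
- have cyc : tpure iota (cyc_val z) 1 \in @is_cycle K (operad_tens iota M l) p.
    apply/cycleP => q e; rewrite -[LHS]/(tens_map iota (cx_d (M l) e) _) tens_mapE cyc_d.
    exact: tpure0.
  have [y dy] := FH (Ordinal h) p (Cycles cyc); exists (R _ y).
  rewrite -Rmap (thE _ _ h) -[tens_map _ _ _]/(cx_d (operad_tens iota M l) erefl y) dy RB.
  by congr (_ - _); rewrite tpureZ mulr1 Rpure -(rmorph_int iota) rho1.
Qed.

(** Formality of each truncation over [K] gives a weight derivation of the truncated model over [K].
    Descent, compactness and [weight_formality] then act on the model, whose formality passes to
    [P]. *)
Lemma formal_of_truncations (P : operad k) :
  homology_arity1_trivial P -> homology_finite_type P ->
  (forall N, formal (truncation N (operad_tens iota P))) -> formal P.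
Proof.
move=> P1 Pfin PN; have char_K : [pchar K] =i pred0 by move=> p; rewrite (fmorph_pchar iota) char_k.
have zMP := weak_equivalence_zigzag (model_we char_k P1 Pfin).
apply: (formal_zigzag zMP); set M := model char_k P1 Pfin in zMP *.
have [th thP] : exists th, forall N, weight_derivation (M := M) N th.
  apply: weight_derivation_compactness; first exact: model_fgen.
  move=> N; apply: weight_derivation_descent.
  pose Q := truncation N (operad_tens iota M).
  have Qcof n : cofibrant_at Q n by apply: cofibrant_tens => m; exact: model_cofibrant.
  have Q1 (l : 'I_N) : l.+1 = 1%N -> forall p (x : Q l p), x = 0.
    case: l => [[|l] h] // _ p x; elim/tens_ind: x => // b v x ->.
    by rewrite (model_arity1 v) tpure0 addr0.
  have zPH : zigzag (truncation N (operad_tens iota P))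
    (homology_operad (truncation N (operad_tens iota P))) by exact: PN.
  have lB (l : 'I_N) : (l.+1 < N.+1)%N by rewrite ltnS.
  have lpos (l : 'I_N) : (0 < l.+1)%N by [].
  have [[g g_we] _] : (exists h : operad_mor Q (homology_operad (truncation N (operad_tens iota P))),
      weak_equivalence h) /\ True.
    split=> //; apply/(cofibrant_zigzag char_K lB lpos Qcof Q1 zPH).
    exists (truncation_mor N (om_tens iota (model_map char_k P1 Pfin))) => l.
    exact: (weak_equivalence_tens iota char_k (model_we char_k P1 Pfin) l).
  exact: (weight_derivation_lift char_K lB lpos Qcof Q1 _ g_we).
have th1 := thP 0%N; apply: (weight_formality char_k (th := th)).
- exact: model_fgen.
- by move=> l; have [h _ _ _] := thP l.+1; move=> *; exact: h.
- by move=> l; have [_ h _ _] := thP l.+1; move=> *; exact: h.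
- by move=> l m n; have [_ _ h _] := thP n.+1; move=> *; exact: h.
- by move=> l; have [_ _ _ h] := thP l.+1; move=> *; exact: h.
Qed.
End Descent.

Theorem theorem6p2p1 (k K : fieldType) (iota : {rmorphism k -> K})
  (char_k : [pchar k]%R =i pred0)
  (P : operad k)
  (HP1 : homology_arity1_trivial P)
  (HPfin : homology_finite_type P) :
  [<-> formal P;
       formal (operad_tens iota P : operad K);
       forall n : nat, formal (truncation n P)].
Proof.
tfae.
- exact: formal_tens.
- move=> fPK n; apply: formal_truncation.
  by apply: (@formal_of_truncations _ _ iota) => // N; exact: formal_truncation.
(* The criterion is applied to the identity extension of [k]. *)
- move=> fP; apply: (@formal_of_truncations _ _ (GRing.RMorphism.clone k k idfun _)) => // N.
  exact: formal_truncation_tens.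
Qed.
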